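(* Let $\alpha,\sigma,\beta$ and, for $b_0\in\mathbb N$, the sets $\Omega$ and $\mathcal K$ be as in the context. There exist $\theta>1$ (not depending on $b_0$) and $B$ such that for every integer $b_0\ge B$ the following holds: if $\bar\omega\in\Omega^{\mathbb N}$ and $f\in\mathcal L^S_{\bar\omega}\cap\mathcal K$ (so that $f$ is infinitely renormalizable of combinatorial type $\bar\omega$), then $f$ satisfies the weak Markov property.
   Context: Lorenz maps. Fix $\alpha>1$. For $u,v\in[0,1]$, $c\in(0,1)$ let $Q(x)=u\bigl(1-(\frac{c-x}{c})^\alpha\bigr)$ for $x\in[0,c)$ and $Q(x)=1+v\bigl(-1+(\frac{x-c}{1-c})^\alpha\bigr)$ for $x\in(c,1]$. A $C^k$-Lorenz map $f=(u,v,c,\phi,\psi)$ is a map on $[0,1]\setminus\{c\}$ with $f=\phi\circ Q$ on $[0,c)$, $f=\psi\circ Q$ on $(c,1]$, where $\phi,\psi$ are orientation-preserving $C^k$-diffeomorphisms of $[0,1]$ (homeomorphisms if $k=0$). $\mathcal L^k$ is the set of these maps, and $\mathcal L^S\subset\mathcal L^3$ the subset of maps with negative Schwarzian derivative $\frac{D^3f}{Df}-\frac32\bigl(\frac{D^2f}{Df}\bigr)^2<0$. Put $\varepsilon(f)=1-c$, $c_1^-=\lim_{x\uparrow c}f(x)$, $c_1^+=\lim_{x\downarrow c}f(x)$; $f$ is nontrivial if $c_1^+<c<c_1^-$ (always assumed unless noted). Renormalization. $f$ is renormalizable if there is an interval $C\subsetneq[0,1]$ properly containing $c$ such that the first-return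 map $\tilde f$ to $C$ is affinely conjugate to a nontrivial Lorenz map; $C$ is chosen maximal. Let $L,R$ be the left and right components of $C\setminus\{c\}$; then $\tilde f=f^{a+1}$ on $L$ and $\tilde f=f^{b+1}$ on $R$ for some minimal positive integers $a,b$. The renormalization is $\mathcal Rf=h^{-1}\circ\tilde f\circ h$, with $h$ the orientation-preserving affine map of $[0,1]$ onto $C$. $f$ is renormalizable of monotone type $\omega=(0\,1^{a},1\,0^{b})$ if moreover $f^i(L)\subset(c,1)$ for $1\le i\le a$ and $f^j(R)\subset(0,c)$ for $1\le j\le b$. For $\bar\omega=(\omega_0,\omega_1,\dots)$, $f$ is infinitely renormalizable of combinatorial type $\bar\omega$ if $\mathcal R^nf$ is $\omega_n$-renormalizable for all $n\ge0$; the set of such maps in $\mathcal L^S$ is $\mathcal L^S_{\bar\omega}$. The sets $\Omega$, $\mathcal K$. Fix $\sigma\in(0,1)$ such that some integer $a$ satisfies $\alpha+\sigma\le a+1\le2\alpha-\sigma$, and $\beta\in(0,(\sigma/\alpha)^2)$. For $b_0\in\mathbb N$, $\Omega=\{(0\,1^a,1\,0^b):\alpha+\sigma\le a+1\le2\alpha-\sigma,\ b_0\le b\le(1+(\sigma/\alpha)^2-\beta)b_0\}$ ($a,b$ integers), and, with $\delta=(1/b_0)^2$, $\mathcal K=\{f\in\mathcal L^1:\alpha^{-b_0/\alpha}\le\varepsilon(f)\le\theta\alpha^{-b_0\sigma/\alpha^2},\ \mathrm{Dist}\,\phi\le\delta,\ \mathrm{Dist}\,\psi\le\delta\}$, where $\mathrm{Dist}\,\phi=\sup_{x,y}\log\frac{D\phi(x)}{D\phi(y)}$.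 Weak Markov property. A nice interval of $f$ is an open interval $C\ni c$ such that the orbit of $\partial C$ is disjoint from $C$. The transfer map to $C$ is $x\mapsto f^{\tau(x)}(x)$ on $\bigcup_{n\ge0}f^{-n}(C)$, $\tau(x)\ge0$ being the smallest integer with $f^{\tau(x)}(x)\in C$. For intervals $I\subset J$, $J$ contains a $\delta'$-scaled neighborhood of $I$ if $J\setminus I$ has two components each of length $>\delta'|I|$. $f$ satisfies the weak Markov property if there exist $\delta'>0$ and nested nice intervals $C_1\supset C_2\supset\cdots$ such that for every $n>0$, $C_n$ contains a $\delta'$-scaled neighborhood of $C_{n+1}$ and the transfer map to $C_n$ is defined almost everywhere. *)

(* Defs.v *)
From HB Require Import structures.
From mathcomp Require Import all_boot all_order all_algebra.
From mathcomp Require Import all_classical all_reals all_analysis.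
Set Implicit Arguments.
Unset Strict Implicit.
Unset Printing Implicit Defensive.
Import Order.TTheory GRing.Theory Num.Theory.
Import numFieldNormedType.Exports.
Local Open Scope classical_set_scope.
Local Open Scope ring_scope.

(** Derivatives relative to a set [A]; at an endpoint of an interval [A] they
    are the one-sided derivatives. *)

Definition diff_quot (R : realType) (g : R -> R) (x y : R) : R :=
  (g y - g x) / (y - x).

Definition derivable_in (R : realType) (A : set R) (g : R -> R) (x : R) : Prop :=
  cvg (diff_quot g x @ within A x^').

Definition deriv_in (R : realType) (A : set R) (g : R -> R) (x : R) : R :=
  lim (diff_quot g x @ within A x^').

Definition nderiv_in (R : realType) (A : set R) (n : nat) (g : R -> R) : R -> R :=
  iter n (deriv_in A) g.

Definition Ck_on (R : realType) (A : set R) (k : nat) (g : R -> R) : Prop :=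
  (forall i x, (i < k)%N -> A x -> derivable_in A (nderiv_in A i g) x) /\
  (forall i, (i <= k)%N -> {within A, continuous (nderiv_in A i g)}).

(** Orientation-preserving C^k-diffeomorphism of [0,1] (homeomorphism if
    [k = 0]).  Values of [phi] outside [0,1] are irrelevant. *)
Definition diffeo01 (R : realType) (k : nat) (phi : R -> R) : Prop :=
  {in `[0, 1] &, {homo phi : x y / x < y}} /\
  exists phi' : R -> R,
    [/\ {homo phi : x / x \in `[0, 1]}, {homo phi' : x / x \in `[0, 1]},
        {in `[0, 1], cancel phi phi'}, {in `[0, 1], cancel phi' phi} &
        Ck_on `[0, 1] k phi /\ Ck_on `[0, 1] k phi'].

Definition Dist (R : realType) (phi : R -> R) : \bar R :=
  ereal_sup [set d | exists x y : R, [/\ x \in `[0, 1], y \in `[0, 1] &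
    d = (ln (deriv_in `[0, 1] phi x / deriv_in `[0, 1] phi y))%:E]].

(** A Lorenz map is the tuple (u, v, c, phi, psi): the diffeomorphisms are part
    of the data, and are not determined by the underlying map. *)
Record lorenz (R : realType) := Lorenz {
  lu : R; lv : R; lc : R; lphi : R -> R; lpsi : R -> R }.

Definition lorenzQ (R : realType) (alpha u v c x : R) : R :=
  if x < c then u * (1 - ((c - x) / c) `^ alpha)
  else 1 + v * (- 1 + ((x - c) / (1 - c)) `^ alpha).

(** Total extension of the underlying map; only meaningful on [ldom]. *)
Definition lfun (R : realType) (alpha : R) (F : lorenz R) (x : R) : R :=
  let Qx := lorenzQ alpha (lu F) (lv F) (lc F) x in
  if x < lc F then lphi F Qx else lpsi F Qx.

Definition ldom (R : realType) (F : lorenz R) : set R :=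
  [set x | 0 <= x <= 1 /\ x != lc F].

(** The underlying partial map on [0,1] \ {c}, and its iterates: [liter n x] is
    [None] as soon as the orbit of [x] hits [c] before time [n]. *)
Definition lmap (R : realType) (alpha : R) (F : lorenz R) (x : R) : option R :=
  if (0 <= x <= 1) && (x != lc F) then Some (lfun alpha F x) else None.

Definition liter (R : realType) (alpha : R) (F : lorenz R) (n : nat) (x : R) :
    option R :=
  iter n (obind (lmap alpha F)) (Some x).

Definition lorenz_class (R : realType) (k : nat) (F : lorenz R) : Prop :=
  [/\ 0 <= lu F <= 1, 0 <= lv F <= 1, 0 < lc F < 1,
      diffeo01 k (lphi F) & diffeo01 k (lpsi F)].

Definition leps (R : realType) (F : lorenz R) : R := 1 - lc F.

Definition c1m (R : realType) (alpha : R) (F : lorenz R) : R :=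
  lim (lfun alpha F x @[x --> (lc F)^'-]).

Definition c1p (R : realType) (alpha : R) (F : lorenz R) : R :=
  lim (lfun alpha F x @[x --> (lc F)^'+]).

Definition nontrivial (R : realType) (alpha : R) (F : lorenz R) : Prop :=
  c1p alpha F < lc F < c1m alpha F.

Definition schwarzian (R : realType) (alpha : R) (F : lorenz R) (x : R) : R :=
  let D n := nderiv_in (ldom F) n (lfun alpha F) x in
  D 3%N / D 1%N - 3 / 2 * (D 2%N / D 1%N) ^+ 2.

Definition lorenzS (R : realType) (alpha : R) (F : lorenz R) : Prop :=
  [/\ lorenz_class 3 F, nontrivial alpha F &
      forall x, ldom F x -> schwarzian alpha F x < 0].

(** [first_entry alpha F C m x y]: [y = f^n(x)], where [n] is the smallest
    integer [>= m] with [f^n(x)] in [C].  This is the graph of the first-return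
    map for [m = 1] and that of the transfer map for [m = 0]. *)
Definition first_entry (R : realType) (alpha : R) (F : lorenz R) (C : set R)
    (m : nat) (x y : R) : Prop :=
  exists n : nat, [/\ (m <= n)%N, liter alpha F n x = Some y, C y &
    forall i z, (m <= i < n)%N -> liter alpha F i x = Some z -> ~ C z].

Definition first_return (R : realType) (alpha : R) (F : lorenz R) (C : set R)
    (x y : R) : Prop :=
  C x /\ first_entry alpha F C 1 x y.

Definition transfer (R : realType) (alpha : R) (F : lorenz R) (C : set R)
    (x y : R) : Prop :=
  first_entry alpha F C 0 x y.

(** The first-return map of [F] to [C = [p,q]] is conjugate to the nontrivial
    Lorenz map [G] by the affine map of [0,1] onto [C].  The equivalence is
    between partial maps, so it forces the critical point of [G] to be sent to
    that of [F]. *)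
Definition return_to (R : realType) (alpha : R) (F : lorenz R) (p q : R)
    (G : lorenz R) : Prop :=
  let C := `[p, q]%classic in
  let h x := p + (q - p) * x in
  [/\ C `<` `[0, 1]%classic, [set lc F] `<` C,
      lorenz_class 0 G, nontrivial alpha G &
      forall x y, x \in `[0, 1] -> y \in `[0, 1] ->
        (lmap alpha G x = Some y <-> first_return alpha F C (h x) (h y))].

Definition maximal_return_to (R : realType) (alpha : R) (F : lorenz R) (p q : R)
    (G : lorenz R) : Prop :=
  return_to alpha F p q G /\
  forall (p' q' : R) (G' : lorenz R), return_to alpha F p' q' G' ->
    `[p, q]%classic `<=` `[p', q']%classic ->
    `[p', q']%classic = `[p, q]%classic.

Definition return_is_iter (R : realType) (alpha : R) (F : lorenz R)
    (C A : set R) (n : nat) : Prop :=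
  forall x y, A x ->
    (first_return alpha F C x y <-> liter alpha F n x = Some y).

Definition return_exponent (R : realType) (alpha : R) (F : lorenz R)
    (C A : set R) (a : nat) : Prop :=
  [/\ (0 < a)%N, return_is_iter alpha F C A a.+1 &
      forall a', (0 < a')%N -> return_is_iter alpha F C A a'.+1 -> (a <= a')%N].

(** [F] is renormalizable of monotone type (01^a, 10^b), encoded as the pair
    [w = (a, b)], and [G] represents its renormalization: the underlying map of
    [G] is determined by [F], its tuple is not. *)
Definition renormalizes_to (R : realType) (alpha : R) (w : nat * nat)
    (F G : lorenz R) : Prop :=
  exists p q : R,
    let C := `[p, q]%classic in
    let L := `[p, lc F[%classic in
    let Rt := `]lc F, q]%classic in
    [/\ maximal_return_to alpha F p q G,
        return_exponent alpha F C L w.1, return_exponent alpha F C Rt w.2,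
        (forall i x, (1 <= i <= w.1)%N -> L x ->
           exists2 y, liter alpha F i x = Some y & lc F < y < 1) &
        (forall j x, (1 <= j <= w.2)%N -> Rt x ->
           exists2 y, liter alpha F j x = Some y & 0 < y < lc F)].

Definition inf_renormalizable (R : realType) (alpha : R) (w : nat -> nat * nat)
    (F : lorenz R) : Prop :=
  exists G : nat -> lorenz R, G 0%N = F /\
    forall n, renormalizes_to alpha (w n) (G n) (G n.+1).

Definition lorenzS_type (R : realType) (alpha : R) (w : nat -> nat * nat)
    (F : lorenz R) : Prop :=
  lorenzS alpha F /\ inf_renormalizable alpha w F.

Definition Omega (R : realType) (alpha sigma beta : R) (b0 : nat) :
    set (nat * nat) :=
  [set w | alpha + sigma <= w.1%:R + 1 <= 2 * alpha - sigma /\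
           (b0 <= w.2)%N /\
           w.2%:R <= (1 + (sigma / alpha) ^+ 2 - beta) * b0%:R].

Definition setK (R : realType) (alpha sigma theta : R) (b0 : nat) :
    set (lorenz R) :=
  [set F | let delta : R := (1 / b0%:R) ^+ 2 in
    [/\ lorenz_class 1 F, nontrivial alpha F,
        alpha `^ (- (b0%:R / alpha)) <= leps F
          <= theta * alpha `^ (- (b0%:R * sigma / alpha ^+ 2)),
        (Dist (lphi F) <= delta%:E)%E & (Dist (lpsi F) <= delta%:E)%E]].

(** The open interval [(p, q)] is nice. *)
Definition nice (R : realType) (alpha : R) (F : lorenz R) (p q : R) : Prop :=
  [/\ 0 <= p, q <= 1, p < lc F < q &
      forall x n y, x = p \/ x = q -> liter alpha F n x = Some y ->
        ~ `]p, q[%classic y].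

(** The two components of [(p, q) \ (p', q')] are [(p, p']] and [[q', q)]. *)
Definition scaled_nbhd (R : realType) (d p q p' q' : R) : Prop :=
  d * (q' - p') < p' - p /\ d * (q' - p') < q - q'.

Definition weak_markov (R : realType) (alpha : R) (F : lorenz R) : Prop :=
  exists (d : R) (p q : nat -> R), 0 < d /\
    forall n, (0 < n)%N ->
      [/\ nice alpha F (p n) (q n),
          `]p n.+1, q n.+1[%classic `<=` `]p n, q n[%classic,
          scaled_nbhd d (p n) (q n) (p n.+1) (q n.+1) &
          {ae (@lebesgue_measure R), forall x, 0 <= x <= 1 ->
            exists y, transfer alpha F `]p n, q n[%classic x y}].

(* Main.v *)
Require Import Defs.
From HB Require Import structures.
From mathcomp Require Import all_boot all_order all_algebra.
From mathcomp Require Import all_classical all_reals all_analysis.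
From mathcomp Require Import ring lra zify.
From Stdlib Require QArith_base Pnat Nnat.
From Stdlib.micromega Require RingMicromega QMicromega Tauto EnvRing.
Set Implicit Arguments.
Unset Strict Implicit.
Unset Printing Implicit Defensive.
Import Order.TTheory GRing.Theory Num.Theory.
Import numFieldNormedType.Exports.
Local Open Scope classical_set_scope.
Local Open Scope ring_scope.

(** A map satisfies the weak Markov property as soon as its return intervals
    [C_n] shrink to the critical point and almost every orbit enters each of
    them: sparse subsequences of the [C_n] are then nested with definite space.

    Only cross ratios are used of the negative Schwarzian derivative: the branches
    of all renormalizations expand them, so that Koebe's principle bounds their
    distortion.  A renormalization is described by its two branches, each the
    composition of an affine map, a power law and a nearly affine homeomorphism.
    Following the orbits of the critical values along the fixed points 0 and 1 of
    the branches gives [eps'^alpha ~ eps^(alpha - a - 1) alpha^(- b)] up to a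
    constant factor, where [eps = 1 - c] and [eps'] is the next one; so the bounds
    on [eps] in the definition of [setK] are invariant, and the return interval
    occupies less than half of the domain at each level.

    The points of one level that avoid its return interval [[p, q]] lie in iterated
    preimages of the intervals from [p] and [q] to the orbits of [q] and [p].  The
    inverse branches there extend up to the orbits of the critical values, so by
    expansion of cross ratios each pullback of [[p, q]] takes a definite proportion
    away, and the set has zero content.  Zero content is preserved by pulling back
    through the branches, which passes to all levels by induction. *)

(** The exponents in [setK] come from the recursion for [eps], where [alpha - a - 1] lies between
    [sigma - alpha] and [- sigma]. If [eps] is at its lower bound [alpha^(- b0 / alpha)], then
    [eps'^alpha] is at most a constant times [alpha^(- b0 sigma / alpha)]: this is the upper bound,
    and [theta] takes up the constant. If [eps] is at its upper bound, then [eps'^alpha] is at least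
    a constant times [alpha^((beta - 1) b0)], by the bound on [b]: this is the lower bound, and the
    margin [beta b0] takes up the constant. These constants do not depend on [b0], since an orbit of
    length comparable to [b0] is followed with relative errors of order [1 / b0^2] per step. To keep
    this rate at all levels, the distortion caused by iteration is estimated afresh from the space
    around each return interval, never accumulated. The estimates also need the right critical value
    to stay below 1/2. Otherwise its orbit would approach [c] superexponentially, making the return
    interval too short for the size of [eps]. At the next level this uses a crude lower bound on
    [eps'], available before the sharp one. *)

(** * Linear arithmetic *)

(** [lra] of Algebra Tactics looks for a canonical structure at each operation
    of each hypothesis, which is slow in the large contexts below.  The [lra]
    redefined here reads off the terms syntactically and calls the same
    certificate checker; it falls back on the former one. *)
Section LinearArithmetic.
Variable F : realType.

Inductive lterm :=
| LVar of nat | LNat of nat | LInv of nat | LAdd of lterm & lterm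
| LOpp of lterm | LMul of lterm & lterm | LMuln of lterm & nat
| LPow of lterm & nat.

Inductive lform := LLe of lterm & lterm | LLt of lterm & lterm | LEq of lterm & lterm.

Fixpoint lval (env : seq F) (t : lterm) : F :=
  match t with
  | LVar i => nth 0 env i
  | LNat n => n%:R
  | LInv n => n%:R^-1
  | LAdd a b => lval env a + lval env b
  | LOpp a => - lval env a
  | LMul a b => lval env a * lval env b
  | LMuln a n => lval env a *+ n
  | LPow a n => lval env a ^+ n
  end.

Definition lholds (env : seq F) (f : lform) : Prop :=
  match f with
  | LLe a b => lval env a <= lval env b
  | LLt a b => lval env a < lval env b
  | LEq a b => lval env a = lval env b
  end.

Fixpoint lrefuted (env : seq F) (fs : seq lform) : Prop :=
  if fs is f :: fs then lholds env f -> lrefuted env fs else False.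

Definition Qnat n := QArith_base.Qmake (BinInt.Z.of_nat n) BinNums.xH.

Fixpoint lterm_pexpr (t : lterm) : EnvRing.PExpr QArith_base.Q :=
  match t with
  | LVar i => EnvRing.PEX (BinPos.Pos.of_succ_nat i)
  | LNat n => EnvRing.PEc (Qnat n)
  | LInv n => EnvRing.PEc (QArith_base.Qinv (Qnat n))
  | LAdd a b => EnvRing.PEadd (lterm_pexpr a) (lterm_pexpr b)
  | LOpp a => EnvRing.PEopp (lterm_pexpr a)
  | LMul a b => EnvRing.PEmul (lterm_pexpr a) (lterm_pexpr b)
  | LMuln a n => EnvRing.PEmul (lterm_pexpr a) (EnvRing.PEc (Qnat n))
  | LPow a n => EnvRing.PEpow (lterm_pexpr a) (BinNat.N.of_nat n)
  end.

Definition lform_formula (f : lform) : RingMicromega.Formula QArith_base.Q :=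
  match f with
  | LLe a b => RingMicromega.Build_Formula (lterm_pexpr a) RingMicromega.OpLe (lterm_pexpr b)
  | LLt a b => RingMicromega.Build_Formula (lterm_pexpr a) RingMicromega.OpLt (lterm_pexpr b)
  | LEq a b => RingMicromega.Build_Formula (lterm_pexpr a) RingMicromega.OpEq (lterm_pexpr b)
  end.

Fixpoint lrefuted_formula (fs : seq lform) :
    Tauto.BFormula (RingMicromega.Formula QArith_base.Q) Tauto.isProp :=
  if fs is f :: fs then
    Tauto.IMPL (Tauto.A Tauto.isProp (lform_formula f) tt) None (lrefuted_formula fs)
  else Tauto.FF Tauto.isProp.

Let eval_q (env : BinNums.positive -> F) (t : RingMicromega.Formula QArith_base.Q) :=
  RingMicromega.eval_formula +%R *%R (fun x y => x - y) -%R eq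
    (fun x y => x <= y) (fun x y => x < y) common.R_of_Q BinNat.N.to_nat (@GRing.exp F) env t.

Let eval_k env k t : Tauto.rtyp k :=
  match k with Tauto.isProp => eval_q env t | Tauto.isBool => `[< eval_q env t >] end.

Lemma tauto_checker_eval f w env :
  QMicromega.QTautoChecker f w -> Tauto.eval_bf (eval_k env) f.
Proof.
move=> H; move: H env.
apply: (@Tauto.tauto_checker_sound _ _ _ _ _ _ _ _
  (RingMicromega.eval_nformula 0 +%R *%R eq (fun x y => x <= y) (fun x y => x < y)
     (@common.R_of_Q F))).
- exact: (RingMicromega.eval_nformula_dec (common.Rsor F)).
- by move=> [? ?] ? ?; apply: (RingMicromega.check_inconsistent_sound (common.Rsor F) (common.FSORaddon F)).
- move=> t t' u tu env et et'.
  exact: (RingMicromega.nformula_plus_nformula_correct (common.Rsor F) (common.FSORaddon F) env t t').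
- move=> env k t tg /(RingMicromega.cnf_normalise_correct (common.Rsor F) (common.FSORaddon F) env t tg).1 H.
  by case: k => //=; apply/asboolP.
- move=> env k t tg /(RingMicromega.cnf_negate_correct (common.Rsor F) (common.FSORaddon F) env t tg).1 H.
  by case: k => //=; apply/asboolPn.
- move=> t w0 cw0 env.
  rewrite (Refl.make_impl_map (RingMicromega.eval_nformula 0 +%R *%R eq (fun x y => x <= y) (fun x y => x < y) (@common.R_of_Q F) env))//.
  exact: (RingMicromega.checker_nf_sound (common.Rsor F) (common.FSORaddon F)) cw0 env.
Qed.

Lemma R_of_Qnat n : common.R_of_Q (Qnat n) = n%:R :> F.
Proof. by rewrite /common.R_of_Q/= divr1; case: n => //= n; rewrite Pnat.SuccNat2Pos.id_succ. Qed.

Lemma lterm_pexprE env t :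
  RingMicromega.eval_pexpr +%R *%R (fun x y => x - y) -%R common.R_of_Q BinNat.N.to_nat
    (@GRing.exp F) (fun i => nth 0 env (BinPos.Pos.to_nat i).-1) (lterm_pexpr t) = lval env t.
Proof.
elim: t => //=.
- by move=> i; rewrite /Env.nth Pnat.SuccNat2Pos.id_succ.
- by move=> n; rewrite R_of_Qnat.
(* Both sides use the convention that 0 has inverse 0. *)
- case=> [|n]; first by rewrite /common.R_of_Q/= mul0r invr0.
  by rewrite /common.R_of_Q/= Pnat.SuccNat2Pos.id_succ div1r.
- by move=> a -> b ->.
- by move=> a ->.
- by move=> a -> b ->.
- by move=> a -> n; rewrite R_of_Qnat mulr_natr.
- by move=> a -> n; rewrite Nnat.Nat2N.id.
Qed.

Lemma lrefuted_checked env fs w :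
  QMicromega.QTautoChecker (lrefuted_formula fs) w -> lrefuted env fs.
Proof.
move=> /(tauto_checker_eval (fun i => nth 0 env (BinPos.Pos.to_nat i).-1)).
elim: fs => //= f fs IH H hf; apply: IH; apply: H.
by case: f hf => a b /=; rewrite !lterm_pexprE.
Qed.

Lemma proj1_andb (a b : bool) : a && b -> a.
Proof. by case/andP. Qed.

Lemma proj2_andb (a b : bool) : a && b -> b.
Proof. by case/andP. Qed.

Lemma le_by_contra (x y : F) : (y < x -> False) -> x <= y.
Proof. by move=> H; rewrite leNgt; apply/negP. Qed.

Lemma lt_by_contra (x y : F) : (y <= x -> False) -> x < y.
Proof. by move=> H; rewrite ltNge; apply/negP. Qed.
End LinearArithmetic.

Ltac is_literal n :=
  lazymatch n with O => true | S ?m => is_literal m | _ => false end.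

Ltac atom_index x l :=
  lazymatch l with
  | x :: _ => O
  | _ :: ?l' => let n := atom_index x l' in constr:(S n)
  end.

Ltac add_atom x env :=
  let rec go l :=
    lazymatch l with
    | x :: _ => env
    | _ :: ?l' => go l'
    | @nil ?T =>
        let rec snoc l :=
          lazymatch l with
          | ?y :: ?l' => let l'' := snoc l' in constr:(@cons T y l'')
          | _ => constr:(@cons T x l)
          end in
        snoc env
    end in
  go env.

Ltac add_atoms t env :=
  lazymatch t with
  | GRing.add ?a ?b => let env := add_atoms a env in add_atoms b env
  | GRing.mul ?a ?b => let env := add_atoms a env in add_atoms b env
  | GRing.opp ?a => add_atoms a env
  | @GRing.zero _ => env
  | @GRing.one _ => env
  | GRing.inv (GRing.natmul (@GRing.one _) ?n) =>
      let l := is_literal n in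
      lazymatch l with true => env | _ => add_atom t env end
  | GRing.natmul ?a ?n =>
      let l := is_literal n in
      lazymatch l with true => add_atoms a env | _ => add_atom t env end
  | GRing.exp ?a ?n =>
      let l := is_literal n in
      lazymatch l with true => add_atoms a env | _ => add_atom t env end
  | _ => add_atom t env
  end.

Ltac reify_atom env t := let i := atom_index t env in constr:(LVar i).

Ltac reify_term env t :=
  lazymatch t with
  | GRing.add ?a ?b =>
      let a := reify_term env a in let b := reify_term env b in constr:(LAdd a b)
  | GRing.mul ?a ?b =>
      let a := reify_term env a in let b := reify_term env b in constr:(LMul a b)
  | GRing.opp ?a => let a := reify_term env a in constr:(LOpp a)
  | @GRing.zero _ => constr:(LNat 0)
  | @GRing.one _ => constr:(LNat 1)
  | GRing.inv (GRing.natmul (@GRing.one _) ?n) =>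
      let l := is_literal n in
      lazymatch l with
      | true => constr:(LInv n)
      | _ => reify_atom env t
      end
  | GRing.natmul (@GRing.one _) ?n =>
      let l := is_literal n in
      lazymatch l with
      | true => constr:(LNat n)
      | _ => reify_atom env t
      end
  | GRing.natmul ?a ?n =>
      let l := is_literal n in
      lazymatch l with
      | true => let a := reify_term env a in constr:(LMuln a n)
      | _ => reify_atom env t
      end
  | GRing.exp ?a ?n =>
      let l := is_literal n in
      lazymatch l with
      | true => let a := reify_term env a in constr:(LPow a n)
      | _ => reify_atom env t
      end
  | _ => reify_atom env t
  end.

Ltac goal_atoms g env :=
  lazymatch g with
  | is_true (Order.le ?a ?b) -> ?g =>
      let env := add_atoms a env in let env := add_atoms b env in goal_atoms g env
  | is_true (Order.lt ?a ?b) -> ?g =>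
      let env := add_atoms a env in let env := add_atoms b env in goal_atoms g env
  | ?a = ?b -> ?g =>
      let env := add_atoms a env in let env := add_atoms b env in goal_atoms g env
  | False => env
  end.

Ltac reify_goal env g :=
  lazymatch g with
  | is_true (Order.le ?a ?b) -> ?g =>
      let a := reify_term env a in let b := reify_term env b in
      let g := reify_goal env g in constr:(LLe a b :: g)
  | is_true (Order.lt ?a ?b) -> ?g =>
      let a := reify_term env a in let b := reify_term env b in
      let g := reify_goal env g in constr:(LLt a b :: g)
  | ?a = ?b -> ?g =>
      let a := reify_term env a in let b := reify_term env b in
      let g := reify_goal env g in constr:(LEq a b :: g)
  | False => constr:(@nil lform)
  end.

(* [move=> {H}] fails on section hypotheses, on which proofs must not come to
   depend; they are older than the local ones, so the first of them ends a loop. *)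
Ltac revert_relation R H a :=
  tryif (let T := type of a in unify T (Real.sort R)) then (generalize H; move=> + {H}) else clear H.

Ltac revert_relations R :=
  repeat lazymatch goal with H : is_true (_ && _) |- _ =>
    generalize (proj1_andb H) (proj2_andb H); move=> + + {H} end;
  repeat lazymatch goal with H : is_true (Order.le ?a _) |- _ => revert_relation R H a end;
  repeat lazymatch goal with H : is_true (Order.lt ?a _) |- _ => revert_relation R H a end;
  repeat match goal with H : @eq ?T _ _ |- _ =>
    unify T (Real.sort R); generalize H; move=> + {H} end.

Ltac refute R :=
  revert_relations R;
  lazymatch goal with |- ?g =>
    let env := goal_atoms g (@nil (Real.sort R)) in
    let fs := reify_goal env g in
    let f := eval vm_compute in (lrefuted_formula fs) in
    let w := fresh "w" in
    wlra_Q w f;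
    let pf := constr:(@lrefuted_checked R env fs w
      (@erefl bool true <: QMicromega.QTautoChecker (lrefuted_formula fs) w = true)) in
    exact_no_check pf
  end.

Ltac linear R :=
  intros;
  lazymatch goal with
  | |- is_true true => exact isT
  | |- is_true (_ != _) => apply/eqP => ?; refute R
  | |- is_true (_ && _) => apply/andP; split; linear R
  | |- _ /\ _ => split; linear R
  | |- is_true (Order.le _ _) => apply: le_by_contra; intro; refute R
  | |- is_true (Order.lt _ _) => apply: lt_by_contra; intro; refute R
  | |- _ = _ => apply/le_anti/andP; split; linear R
  | |- False => refute R
  end.

Tactic Notation "lra" :=
  first [lazymatch goal with R : realType |- _ => linear R end | lra].
(** * Cross ratios and distortion *)

Section Calculus.
Variable R : realType.
Implicit Types (f g : R -> R) (x a b k : R).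

(** Derivation rules in pointwise form with the value of the derivative as a free parameter: a
    derivative is assembled from them and then brought to the wanted form through [der_eq] by [ring]
    or [field]. *)
Lemma der_eq f x a b : is_derive x 1 f a -> a = b -> is_derive x 1 f b.
Proof. by move=> ? <-. Qed.
Lemma derC k x : is_derive x 1 (fun _ : R => k : R) (0 : R).
Proof. exact: is_derive_cst. Qed.
Lemma derI x : is_derive x 1 (fun z : R => z) (1 : R).
Proof. exact: is_derive_id. Qed.
Lemma derD f g x a b : is_derive x 1 f a -> is_derive x 1 g b ->
  is_derive x 1 (fun z => f z + g z) (a + b).
Proof. exact: is_deriveD. Qed.
Lemma derB f g x a b : is_derive x 1 f a -> is_derive x 1 g b ->
  is_derive x 1 (fun z => f z - g z) (a - b).
Proof. exact: is_deriveB. Qed.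
Lemma derN f x a : is_derive x 1 f a -> is_derive x 1 (fun z => - f z) (- a).
Proof. exact: is_deriveN. Qed.
Lemma derM f g x a b : is_derive x 1 f a -> is_derive x 1 g b ->
  is_derive x 1 (fun z => f z * g z) (f x * b + a * g x).
Proof. by move=> fa gb; rewrite [a * _]mulrC; exact: (is_deriveM fa gb). Qed.
Lemma derV f x a : f x != 0 -> is_derive x 1 f a ->
  is_derive x 1 (fun z => (f z)^-1) (- a / f x ^+ 2).
Proof.
by move=> f0 fa; apply: der_eq (is_deriveV f0 fa) _; rewrite /GRing.scale/=; field.
Qed.
Lemma der_comp f g x a b : is_derive (g x) 1 f a -> is_derive x 1 g b ->
  is_derive x 1 (fun z => f (g z)) (a * b).
Proof. exact: is_derive1_comp. Qed.
Lemma der_ln g x b : 0 < g x -> is_derive x 1 g b ->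
  is_derive x 1 (fun z => ln (g z)) (b / g x).
Proof.
move=> g0 gb; rewrite mulrC; exact: (der_comp (is_derive1_ln g0) gb).
Qed.
Lemma der_exp g x b : is_derive x 1 g b ->
  is_derive x 1 (fun z => expR (g z)) (expR (g x) * b).
Proof. move=> gb; exact: (der_comp (is_derive_expR _) gb). Qed.
Lemma der_pow r g x b : 0 < g x -> is_derive x 1 g b ->
  is_derive x 1 (fun z => g z `^ r) (r * g x `^ (r - 1) * b).
Proof.
move=> g0 gb; exact: (der_comp (f := fun z => z `^ r) (is_derive1_powR r g0) gb).
Qed.
End Calculus.

Section CrossRatio.
Variable R : realType.
Implicit Types (f g : R -> R) (a b : R).

Lemma mean_value f (df : R -> R) a b : a < b ->
  (forall x, a <= x <= b -> is_derive x 1 f (df x)) ->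
  exists2 x, a < x < b & f b - f a = df x * (b - a).
Proof.
move=> ab dfE.
have [||x xab ->] := @MVT R f df a b ab.
- by move=> x; rewrite in_itv/= => /andP[/ltW ax /ltW xb]; apply: dfE; rewrite ax.
- apply: derivable_within_continuous => x; rewrite in_itv/= => xab.
  exact: @ex_derive _ _ _ _ _ _ _ (dfE x xab).
by exists x => //; move: xab; rewrite in_itv.
Qed.

Lemma derive_ge0_le f (df : R -> R) a b : a <= b ->
  (forall x, a <= x <= b -> is_derive x 1 f (df x)) ->
  (forall x, a <= x <= b -> 0 <= df x) -> f a <= f b.
Proof.
rewrite le_eqVlt => /predU1P[->//|ab] dfE df0.
have [x /andP[ax xb] fab] := mean_value ab dfE.
by rewrite -subr_ge0 fab mulr_ge0 ?subr_ge0 ?(ltW ab)// df0// !ltW.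
Qed.

(** Multiplicative form of the expansion of cross ratios
    [|T||J| / (|L||R|)] by [f], free of divisions. *)
Definition expands_cross_ratio f a b := forall x1 x2 x3 x4,
  a <= x1 -> x1 < x2 -> x2 < x3 -> x3 < x4 -> x4 <= b ->
  (f x2 - f x1) * (f x4 - f x3) * ((x4 - x1) * (x3 - x2)) <=
  (f x4 - f x1) * (f x3 - f x2) * ((x2 - x1) * (x4 - x3)).

Section NegativeSchwarzian.
Variables (s t : R) (f f1 f2 f3 : R -> R).
Hypothesis df : forall x, s < x < t -> is_derive x 1 f (f1 x).
Hypothesis df1 : forall x, s < x < t -> is_derive x 1 f1 (f2 x).
Hypothesis df2 : forall x, s < x < t -> is_derive x 1 f2 (f3 x).
Hypothesis f1_gt0 : forall x, s < x < t -> 0 < f1 x.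
Hypothesis Sf_lt0 : forall x, s < x < t ->
  f3 x / f1 x - 3 / 2 * (f2 x / f1 x) ^+ 2 < 0.

Lemma increasing_of_derive x y : s < x -> x < y -> y < t -> f x < f y.
Proof.
move=> sx xy yt; have [z zz|z zz E] := @mean_value f f1 x y xy.
  by apply: df; lra.
by rewrite -subr_gt0 E mulr_gt0 ?subr_gt0// f1_gt0//; lra.
Qed.

(** [h] is [(Df)^(-1/2)], with derivatives [h1] and [h2]. It solves [h'' = - (Sf / 2) h], so
    negative Schwarzian derivative makes [h] convex. *)
Let h x : R := expR (- ln (f1 x) / 2).
Let h1 x : R := - (f2 x / f1 x) / 2 * h x.
Let h2 x : R := (- (f3 x / f1 x) / 2 + 3 / 4 * (f2 x / f1 x) ^+ 2) * h x.

Let h_gt0 x : 0 < h x. Proof. exact: expR_gt0. Qed.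

Let hf1 x : s < x < t -> h x ^+ 2 * f1 x = 1.
Proof.
move=> xst; rewrite expr2 -expRD.
have -> : - ln (f1 x) / 2 + - ln (f1 x) / 2 = - ln (f1 x) by field.
by rewrite expRN lnK ?mulVf ?gt_eqF ?posrE ?f1_gt0.
Qed.

Let dh x : s < x < t -> is_derive x 1 h (h1 x).
Proof.
move=> xst; have f10 := f1_gt0 xst; have d1 := df1 xst.
apply: der_eq (der_exp (derM (derN (der_ln f10 d1)) (derC 2^-1 x))) _.
by rewrite /h1 /h; field; rewrite gt_eqF.
Qed.

Let dh1 x : s < x < t -> is_derive x 1 h1 (h2 x).
Proof.
move=> xst; have f10 := f1_gt0 xst; have f1n : f1 x != 0 by rewrite gt_eqF.
have d1 := df1 xst; have d2 := df2 xst; have dhx := dh xst.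
apply: der_eq (derM (derM (derN (derM d2 (derV f1n d1))) (derC 2^-1 x)) dhx) _.
by rewrite /h2 /h1; field.
Qed.

Let h2_ge0 x : s < x < t -> 0 <= h2 x.
Proof.
move=> xst; apply: mulr_ge0; last exact/ltW/h_gt0.
by have := Sf_lt0 xst; lra.
Qed.

(** The function [r z = (f z - f x) h z] is convex for [z >= x], as the terms with [h1] cancel in
    [r'' = (f - f x) h'']. Its slope at [x] is [1 / h x], hence [(y - x) / h x <= r y]; squaring
    gives the claim by [h^2 f1 = 1]. *)
Lemma slope_sqr_ge x y : s < x -> x < y -> y < t ->
  f1 x * f1 y * (y - x) ^+ 2 <= (f y - f x) ^+ 2.
Proof.
move=> sx xy yt.
have xyst z : x <= z <= y -> s < z < t by lra.
pose r z := (f z - f x) * h z.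
pose r1 z := f1 z * h z + (f z - f x) * h1 z.
have dr z : x <= z <= y -> is_derive z 1 r (r1 z).
  move=> /xyst zst; have dfz := df zst; have dhz := dh zst.
  apply: der_eq (derM (derB dfz (derC (f x) z)) dhz) _.
  by rewrite /r1; ring.
have fxz z : x <= z -> z <= y -> 0 <= f z - f x.
  rewrite le_eqVlt => /predU1P[->|xz] zy; first by rewrite subrr.
  by rewrite subr_ge0 ltW// increasing_of_derive//; lra.
have dr1 z : x <= z <= y -> is_derive z 1 r1 ((f z - f x) * h2 z).
  move=> xzy; have zst := xyst _ xzy.
  have dfz := df zst; have df1z := df1 zst; have dhz := dh zst; have dh1z := dh1 zst.
  apply: der_eq (derD (derM df1z dhz) (derM (derB dfz (derC (f x) z)) dh1z)) _.
  rewrite /h2 /h1; field.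
  by rewrite gt_eqF// f1_gt0.
have r1_ge z : x <= z <= y -> (h x)^-1 <= r1 z.
  move=> /andP[xz zy]; have -> : (h x)^-1 = r1 x.
    have xst : s < x < t by lra.
    rewrite /r1 subrr mul0r addr0; apply: (mulfI (lt0r_neq0 (h_gt0 x))).
    by rewrite mulfV ?gt_eqF// mulrCA mulrC -expr2 hf1.
  apply: (@derive_ge0_le r1 (fun w => (f w - f x) * h2 w)) => // w ww.
    by apply: dr1; lra.
  by apply: mulr_ge0; [apply: fxz; lra | apply/h2_ge0/xyst; lra].
have rxy : (h x)^-1 * (y - x) <= r y.
  have [z xzy ryx] := mean_value xy dr.
  have -> : r y = r y - r x by rewrite /r subrr mul0r subr0.
  by rewrite ryx ler_wpM2r ?subr_ge0 ?(ltW xy)// r1_ge; lra.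
have key : y - x <= (f y - f x) * h y * h x.
  move: rxy; rewrite mulrC -/(r y) ler_pdivrMr//.
have xst : s < x < t by lra.
have yst : s < y < t by lra.
have e1 : 0 <= y - x by lra.
have key2 : (y - x) ^+ 2 <= ((f y - f x) * h y * h x) ^+ 2.
  by rewrite ler_sqr ?nnegrE// (le_trans e1).
have -> : (f y - f x) ^+ 2 = f1 x * f1 y * ((f y - f x) * h y * h x) ^+ 2.
  transitivity ((f y - f x) ^+ 2 * (h x ^+ 2 * f1 x) * (h y ^+ 2 * f1 y)); last by ring.
  by rewrite !hf1// !mulr1.
by apply: ler_wpM2l => //; apply: mulr_ge0; apply/ltW/f1_gt0.
Qed.

(** Both sides are derivatives in [y] of the logarithm of a slope of [f], from [b] and from [a]. As
    a function of this other end point, their derivative has a sign by [slope_sqr_ge]. *)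
Lemma slope_log_diff_decr a b y : s < a -> a < b -> b < y -> y < t ->
  f1 y / (f y - f b) - (y - b)^-1 <= f1 y / (f y - f a) - (y - a)^-1.
Proof.
move=> sa ab bey yt.
pose K x := (y - x)^-1 - f1 y / (f y - f x).
pose K1 x := (y - x) ^- 2 - f1 y * f1 x / (f y - f x) ^+ 2.
have fxy x : a <= x <= b -> 0 < f y - f x.
  by move=> xab; rewrite subr_gt0 increasing_of_derive//; lra.
suff : K a <= K b by rewrite /K; lra.
apply: (@derive_ge0_le K K1); first exact: ltW.
  move=> x xab; have xst : s < x < t by lra.
  have dfx := df xst; have fx := fxy _ xab.
  have nz : f y - f x != 0 by rewrite gt_eqF.
  have nz2 : y - x != 0 by rewrite gt_eqF//; lra.
  apply: der_eq (derB (derV (f := fun z => y - z) nz2 (derB (derC y x) (derI x)))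
    (derM (derC (f1 y) x) (derV (f := fun z => f y - f z) nz (derB (derC (f y) x) dfx)))) _.
  by rewrite /K1; field; rewrite nz nz2.
move=> x xab; rewrite /K1 subr_ge0.
have fx := fxy _ xab.
have h0 : 0 < (y - x) ^+ 2 by apply: exprn_gt0; lra.
rewrite ler_pdivrMr ?exprn_gt0// [leRHS]mulrC ler_pdivlMr//.
by rewrite [f1 y * _]mulrC; apply: slope_sqr_ge; lra.
Qed.

Lemma expands_cross_ratio_interior a b : s < a -> b < t ->
  expands_cross_ratio f a b.
Proof.
move=> sa bt x1 x2 x3 x4 ax1 x12 x23 x34 x4b.
have inc := increasing_of_derive.
(* [N y] is the logarithm of the ratio of the slopes of [f] from [x1] and from [x2] to [y]; it is
   nondecreasing by the previous lemma. *)
pose N y := ln (f y - f x1) - ln (y - x1) - ln (f y - f x2) + ln (y - x2).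
pose N1 y := f1 y / (f y - f x1) - (y - x1)^-1 - f1 y / (f y - f x2) + (y - x2)^-1.
have dN y : x3 <= y <= x4 -> is_derive y 1 N (N1 y).
  move=> xy; have yst : s < y < t by lra.
  have dfy := df yst.
  have F k : 0 < f y - f k -> is_derive y 1 (fun z => ln (f z - f k)) (f1 y / (f y - f k)).
    move=> fk; apply: der_eq (der_ln (g := fun z => f z - f k) fk (derB dfy (derC (f k) y))) _.
    by rewrite subr0.
  have G k : 0 < y - k -> is_derive y 1 (fun z : R => ln (z - k)) (y - k)^-1.
    move=> fk; apply: der_eq (der_ln (g := fun z => z - k) fk (derB (derI y) (derC k y))) _.
    by rewrite subr0 mul1r.
  have p1 : 0 < f y - f x1 by rewrite subr_gt0 inc//; lra.
  have p2 : 0 < f y - f x2 by rewrite subr_gt0 inc//; lra.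
  have p3 : 0 < y - x1 by lra.
  have p4 : 0 < y - x2 by lra.
  exact: (derD (derB (derB (F _ p1) (G _ p3)) (F _ p2)) (G _ p4)).
have NN : N x3 <= N x4.
  apply: (derive_ge0_le (ltW x34) dN) => y xy.
  have := @slope_log_diff_decr x1 x2 y; rewrite /N1.
  by move=> /(_ _ _ _ _); lra.
have P x y : s < x -> x < y -> y < t -> f y - f x \is Num.pos.
  by move=> *; rewrite posrE subr_gt0 inc.
have Q (x y : R) : x < y -> y - x \is Num.pos by rewrite posrE subr_gt0.
have p13 : f x3 - f x1 \is Num.pos by apply: P; lra.
have p14 : f x4 - f x1 \is Num.pos by apply: P; lra.
have p23 : f x3 - f x2 \is Num.pos by apply: P; lra.
have p24 : f x4 - f x2 \is Num.pos by apply: P; lra.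
have q13 : x3 - x1 \is Num.pos by apply: Q; lra.
have q14 : x4 - x1 \is Num.pos by apply: Q; lra.
have q23 : x3 - x2 \is Num.pos by apply: Q; lra.
have q24 : x4 - x2 \is Num.pos by apply: Q; lra.
have : ln ((f x3 - f x1) * (f x4 - f x2) * ((x4 - x1) * (x3 - x2))) <=
     ln ((f x4 - f x1) * (f x3 - f x2) * ((x3 - x1) * (x4 - x2))).
  rewrite !lnM ?rpredM//; move: NN; rewrite /N; lra.
(* By [(x3 - x1) (x4 - x2) = (x4 - x1) (x3 - x2) + (x2 - x1) (x4 - x3)], for the points and for
   their images, the inequality passes to the other cross ratio. *)
rewrite ler_ln ?rpredM//; lra.
Qed.

End NegativeSchwarzian.
End CrossRatio.

(** * Monotone maps, Koebe's principle and distortion *)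

Section Distortion.
Variable R : realType.
Implicit Types (f g : R -> R) (a b x y z D E : R).

Definition increasing_on f a b :=
  forall x y, a <= x -> x < y -> y <= b -> f x < f y.

Definition upper_lipschitz K f a b :=
  forall x y, a <= x -> x <= y -> y <= b -> f y - f x <= K * (y - x).

Lemma increasing_onW f a b x y : increasing_on f a b ->
  a <= x -> x <= y -> y <= b -> f x <= f y.
Proof.
move=> fi ax; rewrite le_eqVlt => /predU1P[->//|xy] yb.
by apply/ltW/fi.
Qed.

Lemma increasing_on_sub f a b a' b' : a <= a' -> b' <= b ->
  increasing_on f a b -> increasing_on f a' b'.
Proof. by move=> aa bb fi x y ax xy yb; apply: fi; lra. Qed.

Lemma increasing_on_lt f a b x y : increasing_on f a b ->
  a <= x <= b -> a <= y <= b -> (f x < f y) = (x < y).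
Proof.
move=> fi xab yab; apply/idP/idP => [|xy]; last by apply: fi; lra.
apply: contraTT; rewrite -!leNgt => yx; apply: (increasing_onW fi); lra.
Qed.

Lemma increasing_on_le f a b x y : increasing_on f a b ->
  a <= x <= b -> a <= y <= b -> (f x <= f y) = (x <= y).
Proof. by move=> fi xab yab; rewrite !leNgt (increasing_on_lt fi). Qed.

Lemma increasing_on_comp f g a b c d : increasing_on f a b ->
  increasing_on g c d -> c <= f a -> f b <= d ->
  increasing_on (fun x => g (f x)) a b.
Proof.
move=> fi gi cfa fbd x y ax xy yb; apply: gi; last 1 first.
- by apply: le_trans fbd; apply: (increasing_onW fi); lra.
- by apply: le_trans cfa _; apply: (increasing_onW fi); lra.
- exact: fi.
Qed.

Lemma crx_sub f a b a' b' : a <= a' -> b' <= b ->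
  expands_cross_ratio f a b -> expands_cross_ratio f a' b'.
Proof. by move=> aa bb fi x1 x2 x3 x4 *; apply: fi; lra. Qed.

Lemma crx_comp f g a b c d : increasing_on f a b ->
  increasing_on g c d -> c <= f a -> f b <= d ->
  expands_cross_ratio f a b -> expands_cross_ratio g c d ->
  expands_cross_ratio (fun x => g (f x)) a b.
Proof.
move=> fi gi cfa fbd cf cg x1 x2 x3 x4 ax1 x12 x23 x34 x4b.
have f12 : f x1 < f x2 by apply: fi; lra.
have f23 : f x2 < f x3 by apply: fi; lra.
have f34 : f x3 < f x4 by apply: fi; lra.
have cf1 : c <= f x1 by apply: le_trans cfa _; apply: (increasing_onW fi); lra.
have f4d : f x4 <= d by apply: le_trans fbd; apply: (increasing_onW fi); lra.
have H1 := cf _ _ _ _ ax1 x12 x23 x34 x4b.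
have H2 := cg _ _ _ _ cf1 f12 f23 f34 f4d.
have g12 : 0 < g (f x2) - g (f x1) by rewrite subr_gt0; apply: gi; lra.
have g23 : 0 < g (f x3) - g (f x2) by rewrite subr_gt0; apply: gi; lra.
have g34 : 0 < g (f x4) - g (f x3) by rewrite subr_gt0; apply: gi; lra.
set g12' := _ - g (f x1) in H2 g12 *; set g34' := _ - g (f x3) in H2 g34 *.
set u := (f x4 - f x1) * (f x3 - f x2) in H1 H2.
set v := (f x2 - f x1) * (f x4 - f x3) in H1 H2.
set G := (g (f x4) - g (f x1)) * _ in H2 *.
set X := (x4 - x1) * _ in H1 *; set Y := (x2 - x1) * _ in H1 *.
have u0 : 0 < u by apply: mulr_gt0; lra.
have v0 : 0 < v by apply: mulr_gt0; lra.
have Y0 : 0 < Y by apply: mulr_gt0; lra.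
have X0 : 0 < X by apply: mulr_gt0; lra.
have gg : 0 < g12' * g34' by apply: mulr_gt0.
rewrite -(ler_pM2l v0).
apply: (@le_trans _ _ (g12' * g34' * (u * Y))).
  have := ler_wpM2l (ltW gg) H1; lra.
have := ler_wpM2r (ltW Y0) H2; lra.
Qed.

Lemma crx_affine m k a b : expands_cross_ratio (fun x => m + k * x) a b.
Proof.
move=> x1 x2 x3 x4 *; rewrite le_eqVlt; apply/orP; left; apply/eqP; ring.
Qed.

Lemma crx_affine_post f m k a b : expands_cross_ratio f a b ->
  expands_cross_ratio (fun x => (f x - m) / k) a b.
Proof.
move=> cf x1 x2 x3 x4 ax1 x12 x23 x34 x4b.
have := ler_wpM2l (sqr_ge0 k^-1) (cf _ _ _ _ ax1 x12 x23 x34 x4b).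
by congr (_ <= _); ring.
Qed.

Lemma increasing_affine m k a b : 0 < k -> increasing_on (fun x => m + k * x) a b.
Proof. by move=> k0 x y _ xy _; rewrite ltrD2l ltr_pM2l. Qed.

Lemma increasing_affine_post f m k a b : 0 < k -> increasing_on f a b ->
  increasing_on (fun x => (f x - m) / k) a b.
Proof.
by move=> k0 fi x y ax xy yb; rewrite ltr_pM2r ?invr_gt0// ltrD2r; apply: fi.
Qed.

Lemma upper_lipschitz_comp f g a b c d K L : 0 <= L -> increasing_on f a b ->
  upper_lipschitz K f a b -> upper_lipschitz L g c d -> c <= f a -> f b <= d ->
  upper_lipschitz (L * K) (fun x => g (f x)) a b.
Proof.
move=> L0 fi fl gl cfa fbd x y ax xy yb.
apply: (@le_trans _ _ (L * (f y - f x))).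
  apply: gl.
  - by apply: le_trans cfa _; apply: (increasing_onW fi); lra.
  - by apply: (increasing_onW fi).
  - by apply: le_trans fbd; apply: (increasing_onW fi); lra.
by rewrite -mulrA; apply: ler_wpM2l => //; apply: fl.
Qed.

Lemma upper_lipschitz_gt0 K f a b : a < b -> increasing_on f a b ->
  upper_lipschitz K f a b -> 0 < K.
Proof.
move=> ab fi fl; have := fl a b (lexx a) (ltW ab) (lexx b).
have := fi a b (lexx a) ab (lexx b).
rewrite -subr_gt0 => p q; have := lt_le_trans p q.
by rewrite pmulr_lgt0// subr_gt0.
Qed.

Lemma cvg_right_of_lipschitz K f a b : a < b -> increasing_on f a b ->
  upper_lipschitz K f a b -> f (a + e) @[e --> 0^'+] --> f a.
Proof.
move=> ab fi fl; have K0 := upper_lipschitz_gt0 ab fi fl.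
apply/cvgrPdist_le => /= d d0; near=> e.
have e0 : 0 < e by near: e; exact: nbhs_right_gt.
have eb : e < b - a by near: e; apply: nbhs_right_lt; lra.
have ed : e < d / K by near: e; apply: nbhs_right_lt; rewrite divr_gt0.
have h1 : f (a + e) - f a <= K * (a + e - a) by apply: fl; lra.
have h2 : f a < f (a + e) by apply: fi; lra.
rewrite distrC ger0_norm; last by lra.
apply: (le_trans h1); rewrite addrC addKr mulrC -ler_pdivlMr//; lra.
Unshelve. all: by end_near. Qed.

Lemma cvg_left_of_lipschitz K f a b : a < b -> increasing_on f a b ->
  upper_lipschitz K f a b -> f (b - e) @[e --> 0^'+] --> f b.
Proof.
move=> ab fi fl; have K0 := upper_lipschitz_gt0 ab fi fl.
apply/cvgrPdist_le => /= d d0; near=> e.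
have e0 : 0 < e by near: e; exact: nbhs_right_gt.
have eb : e < b - a by near: e; apply: nbhs_right_lt; lra.
have ed : e < d / K by near: e; apply: nbhs_right_lt; rewrite divr_gt0.
have h1 : f b - f (b - e) <= K * (b - (b - e)) by apply: fl; lra.
have h2 : f (b - e) < f b by apply: fi; lra.
rewrite ger0_norm; last by lra.
apply: (le_trans h1); rewrite opprB addrC subrK mulrC -ler_pdivlMr//; lra.
Unshelve. all: by end_near. Qed.

(** The criterion by derivatives only applies inside the domain of a branch, since the slope
    vanishes at [c]. Only the outer points can lie at the ends; they are moved inwards by [e], and
    [e] tends to 0. *)
Lemma crx_closure K f a b : a < b -> increasing_on f a b ->
  upper_lipschitz K f a b ->
  (forall a' b', a < a' -> b' < b -> expands_cross_ratio f a' b') ->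
  expands_cross_ratio f a b.
Proof.
move=> ab fi fl fc x1 x2 x3 x4 ax1 x12 x23 x34 x4b.
pose l e := (f x2 - f (x1 + e)) * (f (x4 - e) - f x3) *
  ((x4 - e - (x1 + e)) * (x3 - x2)).
pose r e := (f (x4 - e) - f (x1 + e)) * (f x3 - f x2) *
  ((x2 - (x1 + e)) * (x4 - e - x3)).
have c1 : f (x1 + e) @[e --> 0^'+] --> f x1.
  apply: (@cvg_right_of_lipschitz K f x1 b); first by lra.
    by apply: increasing_on_sub fi; lra.
  by move=> x y *; apply: fl; lra.
have c4 : f (x4 - e) @[e --> 0^'+] --> f x4.
  apply: (@cvg_left_of_lipschitz K f a x4); first by lra.
    by apply: increasing_on_sub fi; lra.
  by move=> x y *; apply: fl; lra.
have d1 : x1 + e @[e --> (0:R)^'+] --> x1.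
  by apply: (@cvg_right_of_lipschitz 1 id x1 x2) => // x y *; rewrite mul1r.
have d4 : x4 - e @[e --> (0:R)^'+] --> x4.
  by apply: (@cvg_left_of_lipschitz 1 id x3 x4) => // x y *; rewrite mul1r.
have cl : l e @[e --> 0^'+] --> (f x2 - f x1) * (f x4 - f x3) * ((x4 - x1) * (x3 - x2)).
  apply: cvgM; first by apply: cvgM; apply: cvgB => //; exact: cvg_cst.
  by apply: cvgM; [apply: cvgB | exact: cvg_cst].
have cr : r e @[e --> 0^'+] --> (f x4 - f x1) * (f x3 - f x2) * ((x2 - x1) * (x4 - x3)).
  apply: cvgM; first by apply: cvgM; [apply: cvgB | exact: cvg_cst].
  by apply: cvgM; apply: cvgB => //; exact: cvg_cst.
apply: (ler_cvg_to cl cr); near=> e.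
have e0 : 0 < e by near: e; exact: nbhs_right_gt.
have e1 : e < x2 - x1 by near: e; apply: nbhs_right_lt; lra.
have e2 : e < x4 - x3 by near: e; apply: nbhs_right_lt; lra.
by apply: (fc (x1 + e) (x4 - e)); lra.
Unshelve. all: by end_near. Qed.

(** The cross ratio with leftmost point [a] compares the slopes on [[y, z]] and [[x, y]]. The two
    long factors cost nothing in the domain, by [x - a <= z - a], and [1 + tau] in the range,
    because of the space on the left. *)
Lemma Koebe_right f a d tau x y z : increasing_on f a d ->
  expands_cross_ratio f a d -> a < x -> x < y -> y < z -> z <= d ->
  f z - f x <= tau * (f x - f a) ->
  (f z - f y) * (y - x) <= (1 + tau) * ((f y - f x) * (z - y)).
Proof.
move=> fi fc ax xy yz zd sp.
have H := fc _ _ _ _ (lexx a) ax xy yz zd.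
have fax : 0 < f x - f a by rewrite subr_gt0; apply: fi; lra.
have fxy : 0 < f y - f x by rewrite subr_gt0; apply: fi; lra.
have fyz : 0 < f z - f y by rewrite subr_gt0; apply: fi; lra.
have xa : 0 < x - a by lra.
rewrite -(ler_pM2l (mulr_gt0 fax xa)).
apply: (@le_trans _ _ ((f x - f a) * (f z - f y) * ((z - a) * (y - x)))).
  have : 0 <= (f x - f a) * (f z - f y) * ((z - x) * (y - x)).
    by rewrite !mulr_ge0//; lra.
  lra.
apply: le_trans H _.
have k1 : f z - f a <= (1 + tau) * (f x - f a) by lra.
have k2 : 0 <= (f y - f x) * ((x - a) * (z - y)) by rewrite !mulr_ge0//; lra.
have := ler_wpM2r k2 k1; lra.
Qed.

Lemma Koebe_left f a d tau x y z : increasing_on f a d ->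
  expands_cross_ratio f a d -> a <= x -> x < y -> y < z -> z < d ->
  f z - f x <= tau * (f d - f z) ->
  (f y - f x) * (z - y) <= (1 + tau) * ((f z - f y) * (y - x)).
Proof.
move=> fi fc ax xy yz zd sp.
have H := fc _ _ _ _ ax xy yz zd (lexx d).
have fzd : 0 < f d - f z by rewrite subr_gt0; apply: fi; lra.
have fxy : 0 < f y - f x by rewrite subr_gt0; apply: fi; lra.
have fyz : 0 < f z - f y by rewrite subr_gt0; apply: fi; lra.
have dz : 0 < d - z by lra.
rewrite -(ler_pM2l (mulr_gt0 fzd dz)).
apply: (@le_trans _ _ ((f y - f x) * (f d - f z) * ((d - x) * (z - y)))).
  have : 0 <= (f y - f x) * (f d - f z) * ((z - x) * (z - y)).
    by rewrite !mulr_ge0//; lra.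
  lra.
apply: le_trans H _.
have k1 : f d - f x <= (1 + tau) * (f d - f z) by lra.
have k2 : 0 <= (f z - f y) * ((y - x) * (d - z)) by rewrite !mulr_ge0//; lra.
have := ler_wpM2r k2 k1; lra.
Qed.

(** The slope on [[x, y]] is compared with those on [[s, x]] and [[y, t]], each time with the space
    on one side, and the inequalities are added up. *)
Lemma Koebe f a d tau s t x y : 0 <= tau -> increasing_on f a d ->
  expands_cross_ratio f a d -> a < s -> s < t -> t < d ->
  f t - f s <= tau * (f s - f a) -> f t - f s <= tau * (f d - f t) ->
  s <= x -> x <= y -> y <= t ->
  (f t - f s) * (y - x) <= (1 + tau) * ((f y - f x) * (t - s)) /\
  (f y - f x) * (t - s) <= (1 + tau) * ((f t - f s) * (y - x)).
Proof.
move=> tau0 fi fc as_ st td spl spr sx xy yt.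
have [->|xy'] := eqVneq x y; first by rewrite !subrr !(mulr0, mul0r).
have {xy'}xy : x < y by rewrite lt_def eq_sym xy' xy.
have mono u v : s <= u -> u <= v -> v <= t -> f u <= f v.
  by move=> *; apply: (increasing_onW fi); lra.
have fsx : f s <= f x by apply: mono; lra.
have fxy : f x <= f y by apply: mono; lra.
have fyt : f y <= f t by apply: mono; lra.
have tt : tau * (f s - f a) <= tau * (f x - f a) by apply: ler_wpM2l => //; lra.
have ttr : tau * (f d - f t) <= tau * (f d - f y) by apply: ler_wpM2l => //; lra.
have [L1 L2] : (f x - f s) * (y - x) <= (1 + tau) * ((f y - f x) * (x - s)) /\
   (f y - f x) * (x - s) <= (1 + tau) * ((f x - f s) * (y - x)).
  move: sx; rewrite le_eqVlt => /predU1P[<-|sx]; first by rewrite !subrr !(mulr0, mul0r).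
  split; [apply: (Koebe_left fi fc) | apply: (Koebe_right fi fc)]; lra.
have [R1 R2] : (f t - f y) * (y - x) <= (1 + tau) * ((f y - f x) * (t - y)) /\
   (f y - f x) * (t - y) <= (1 + tau) * ((f t - f y) * (y - x)).
  move: yt; rewrite le_eqVlt => /predU1P[->|yt]; first by rewrite !subrr !(mulr0, mul0r).
  split; [apply: (Koebe_right fi fc) | apply: (Koebe_left fi fc)]; lra.
have M : 0 <= tau * ((f y - f x) * (y - x)) by rewrite !mulr_ge0//; lra.
split; lra.
Qed.

Definition bilipschitz01 E f := forall x y, 0 <= x -> x <= y -> y <= 1 ->
  y - x <= E * (f y - f x) /\ f y - f x <= E * (y - x).

(** [Dist f <= ln D], expressed with difference quotients. *)
Definition distortion_le D f := forall x y z w,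
  0 <= x -> x <= y -> y <= 1 -> 0 <= z -> z <= w -> w <= 1 ->
  (f y - f x) * (w - z) <= D * ((f w - f z) * (y - x)).

Definition homeo01 f := [/\ increasing_on f 0 1, f 0 = 0 & f 1 = 1].

Lemma distortion_bilipschitz D f : homeo01 f -> distortion_le D f ->
  bilipschitz01 D f.
Proof.
move=> [fi f0 f1] fd x y x0 xy y1.
have := fd x y 0 1 x0 xy y1 (lexx 0) ler01 (lexx 1).
have := fd 0 1 x y (lexx 0) ler01 (lexx 1) x0 xy y1.
rewrite f0 f1; lra.
Qed.

Lemma bilipschitz_comp K D f g : 0 <= K -> 0 <= D ->
  homeo01 f -> homeo01 g -> bilipschitz01 K f ->
  bilipschitz01 D g -> bilipschitz01 (K * D) (fun x => f (g x)).
Proof.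
move=> K0 D0 [fi f0 f1] [gi g0 g1] fb gb x y x0 xy y1.
have [G1 G2] := gb _ _ x0 xy y1.
have gx0 : 0 <= g x by rewrite -g0; apply: (increasing_onW gi); lra.
have gy1 : g y <= 1 by rewrite -g1; apply: (increasing_onW gi); lra.
have gxy : g x <= g y by apply: (increasing_onW gi); lra.
have [F1 F2] := fb _ _ gx0 gxy gy1.
have := ler_wpM2l D0 F1; have := ler_wpM2l K0 G2; lra.
Qed.

(** Being a comparison of difference quotients, the distortion bound is invariant under affine
    changes of domain and range. *)
Lemma distortion_restrict D f a b : 0 <= a -> a < b -> b <= 1 ->
  homeo01 f -> distortion_le D f ->
  homeo01 (fun t => (f (a + (b - a) * t) - f a) / (f b - f a)) /\
  distortion_le D (fun t => (f (a + (b - a) * t) - f a) / (f b - f a)).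
Proof.
move=> a0 ab b1 [fi f0 f1] fd.
have fab : 0 < f b - f a by rewrite subr_gt0; apply: fi.
have rng t : 0 <= t -> t <= 1 -> 0 <= (b - a) * t <= b - a.
  by move=> t0 t1; rewrite mulr_ge0 ?ler_piMr; lra.
split.
  split.
  - apply: increasing_affine_post => //.
    apply: (increasing_on_comp (c := 0) (d := 1)) fi _ _; last by lra.
    + by apply: increasing_affine; lra.
    + by lra.
  - by rewrite mulr0 addr0 subrr mul0r.
  - by rewrite mulr1 [a + (b - a)]addrC subrK divff ?gt_eqF.
move=> x y z w x0 xy y1 z0 zw w1.
have xx : 0 <= (b - a) * x <= b - a by apply: rng; lra.
have yy : 0 <= (b - a) * y <= b - a by apply: rng; lra.
have zz : 0 <= (b - a) * z <= b - a by apply: rng; lra.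
have ww : 0 <= (b - a) * w <= b - a by apply: rng; lra.
have xy' : (b - a) * x <= (b - a) * y by apply: ler_wpM2l; lra.
have zw' : (b - a) * z <= (b - a) * w by apply: ler_wpM2l; lra.
have H := fd (a + (b - a) * x) (a + (b - a) * y) (a + (b - a) * z) (a + (b - a) * w).
have ba : 0 < b - a by lra.
rewrite -(ler_pM2l (mulr_gt0 fab ba)).
set fx := f (a + (b - a) * x); set fy := f (a + (b - a) * y).
set fz := f (a + (b - a) * z); set fw := f (a + (b - a) * w).
have -> : (f b - f a) * (b - a) * (((fy - f a) / (f b - f a) - (fx - f a) / (f b - f a)) * (w - z)) =
   (fy - fx) * (a + (b - a) * w - (a + (b - a) * z)) by field; rewrite gt_eqF.
have -> : (f b - f a) * (b - a) * (D * (((fw - f a) / (f b - f a) - (fz - f a) / (f b - f a)) * (y - x))) =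
   D * ((fw - fz) * (a + (b - a) * y - (a + (b - a) * x))) by field; rewrite gt_eqF.
by apply: H; lra.
Qed.

Lemma lipschitz_surj K f a b y : a < b -> increasing_on f a b ->
  upper_lipschitz K f a b -> f a <= y <= f b -> exists2 x, a <= x <= b & f x = y.
Proof.
move=> ab fi fl yab; have K0 := upper_lipschitz_gt0 ab fi fl.
have fc : {within `[a, b], continuous f}.
  apply/subspace_continuousP => x; rewrite /= in_itv/= => xab.
  apply/cvgrPdist_le => /= d d0; near=> z.
  have zab : a <= z <= b.
    by near: z; apply: withinT; move=> z; rewrite /= in_itv.
  have zx : `|x - z| < d / K.
    near: z; apply: cvg_within; apply: (@nbhsx_ballx _ R x (d / K)).
    by rewrite divr_gt0.
  have [xz|zx'] := leP x z.
    have h1 : f z - f x <= K * (z - x) by apply: fl; lra.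
    have h2 : f x <= f z by apply: (increasing_onW fi); lra.
    rewrite distrC ger0_norm ?subr_ge0//.
    have {}zx : z - x < d / K by move: zx; rewrite distrC ger0_norm ?subr_ge0.
    by apply: (le_trans h1); rewrite mulrC -ler_pdivlMr// ltW.
  have h1 : f x - f z <= K * (x - z) by apply: fl; lra.
  have h2 : f z <= f x by apply: (increasing_onW fi); lra.
  rewrite ger0_norm ?subr_ge0//.
  have {}zx : x - z < d / K by move: zx; rewrite ger0_norm ?subr_ge0 1?ltW.
  by apply: (le_trans h1); rewrite mulrC -ler_pdivlMr// ltW.
have fab : f a < f b by apply: fi; lra.
have [|x xab <-] := @IVT R f a b y (ltW ab) fc.
  by rewrite (min_l (ltW fab)) (max_r (ltW fab)).
by exists x => //; move: xab; rewrite in_itv.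
Unshelve. all: by end_near. Qed.

End Distortion.

(** * Orbits of the branches *)

(** The coordinates measure the distance to [c], normalized to be 1 at the endpoint fixed by the
    branch. The charts are the two halves of [lorenzQ], each one extended up to [c]. *)
Definition left_coord (R : realType) (c x : R) := (c - x) / c.
Definition left_chart (R : realType) (alpha c u x : R) :=
  u * (1 - left_coord c x `^ alpha).
Definition left_map (R : realType) (alpha c u : R) (Phi : R -> R) x :=
  Phi (left_chart alpha c u x).
Definition right_coord (R : realType) (c x : R) := (x - c) / (1 - c).
Definition right_chart (R : realType) (alpha c v x : R) :=
  1 - v * (1 - right_coord c x `^ alpha).
Definition right_map (R : realType) (alpha c v : R) (Psi : R -> R) x :=
  Psi (right_chart alpha c v x).

Section PowerBranches.
Variables (R : realType) (alpha : R).
Hypothesis alpha_gt1 : 1 < alpha.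
Implicit Types (s t x y : R).

Let alpha_gt0 : 0 < alpha. Proof. exact: (lt_trans ltr01). Qed.
Let alpha_neq0 : alpha != 0. Proof. exact: lt0r_neq0. Qed.
Let alpha1_neq0 : alpha - 1 != 0. Proof. by rewrite subr_eq0 gt_eqF. Qed.

Lemma powR_mulB1 s : 0 <= s -> s * s `^ (alpha - 1) = s `^ alpha.
Proof.
have al1 := alpha_gt1. by move=> s0; apply: mulr_powRB1 => //; lra. Qed.

Lemma ler_powRr r s t : 0 <= r -> 0 <= s -> s <= t -> s `^ r <= t `^ r.
Proof.
by move=> r0 s0 st; apply: ge0_ler_powR; rewrite ?nnegrE//; lra. Qed.

Lemma powRB_bounds s t : 0 <= t -> t <= s ->
  alpha * t `^ (alpha - 1) * (s - t) <= s `^ alpha - t `^ alpha <=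
  alpha * s `^ (alpha - 1) * (s - t).
Proof.
have al1 := alpha_gt1. rewrite le_eqVlt => /predU1P[<-|t0].
  move=> s0; rewrite (powR0 alpha_neq0) (powR0 alpha1_neq0).
  rewrite mulr0 mul0r !subr0 powR_ge0/= -mulrA [_ * s]mulrC powR_mulB1// ler_peMl ?powR_ge0//; lra.
rewrite le_eqVlt => /predU1P[->|ts]; first by rewrite !subrr !mulr0 lexx.
have [x tx|x xts ->] := @mean_value R (fun z => z `^ alpha)
    (fun z => alpha * z `^ (alpha - 1)) t s ts.
  by apply: is_derive1_powR; lra.
by rewrite !ler_pM2r ?subr_gt0// !ler_pM2l; try lra; rewrite !ler_powRr; lra.
Qed.

Lemma powR_le_self s : 0 <= s -> s <= 1 -> s `^ alpha <= s.
Proof.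
have al1 := alpha_gt1. rewrite le_eqVlt => /predU1P[<-|s0 s1]; first by rewrite powR0.
by apply: ge1r_powR; lra.
Qed.

Section Branches.
Variables (c u E : R) (Phi : R -> R).
Hypothesis c01 : 0 < c < 1.
Hypothesis u01 : 0 < u <= 1.
Hypothesis E1 : 1 <= E.
Hypothesis Phih : homeo01 Phi.
Hypothesis Phib : bilipschitz01 E Phi.

Ltac hyps3 := move: (alpha_gt1) (c01) (u01) => ? ? ?.
Ltac hyps := move: (alpha_gt1) (c01) (u01) (E1) => ? ? ? ?.

Lemma pow01 s : 0 <= s -> s <= 1 -> 0 <= s `^ alpha <= 1.
Proof.
have al1 := alpha_gt1. by move=> s0 s1; rewrite powR_ge0/= (le_trans (powR_le_self s0 s1)). Qed.

Section Left.
Local Notation Y := (left_coord c).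
Local Notation Q := (left_chart alpha c u).
Local Notation g := (left_map alpha c u Phi).

Lemma left_Y x : 0 <= x <= c -> 0 <= Y x <= 1.
Proof.
move: (c01) => ?. by move=> xc; rewrite /left_coord divr_ge0 ?ler_pdivrMr; lra. Qed.

Lemma left_YB x x' : Y x - Y x' = (x' - x) / c.
Proof.
move: (c01) => ?. by rewrite /left_coord; field; lra. Qed.

Lemma left_Q01 x : 0 <= x <= c -> 0 <= Q x <= u.
Proof.
hyps3. move=> /left_Y /andP[Y0 Y1]; have /andP[P0 P1] := pow01 Y0 Y1.
by rewrite /left_chart mulr_ge0 ?ler_piMr//; lra.
Qed.

Lemma left_QB x x' : 0 <= x -> x <= x' -> x' <= c ->
  u * alpha / c * Y x' `^ (alpha - 1) * (x' - x) <= Q x' - Q x <=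
  u * alpha / c * Y x `^ (alpha - 1) * (x' - x).
Proof.
hyps3. move=> x0 xx xc.
have xc' : 0 <= x <= c by lra.
have xc'' : 0 <= x' <= c by lra.
have /andP[Y0 Y1] := left_Y xc'; have /andP[Z0 Z1] := left_Y xc''.
have YZ : Y x' <= Y x by rewrite -subr_ge0 left_YB divr_ge0; lra.
have /andP[A B] := powRB_bounds Z0 YZ.
rewrite left_YB in A B.
have -> : Q x' - Q x = u * (Y x `^ alpha - Y x' `^ alpha) by rewrite /left_chart; ring.
have u0 : 0 <= u by lra.
have := ler_wpM2l u0 A; have := ler_wpM2l u0 B; lra.
Qed.

Lemma left_Q_increasing : increasing_on Q 0 c.
Proof.
hyps3. move=> x x' x0 xx xc; rewrite /left_chart ltr_pM2l; last by lra.
rewrite ltrD2l ltrN2; apply: gt0_ltr_powR; rewrite ?nnegrE.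
- by lra.
- by have /left_Y/andP[] : 0 <= x' <= c by lra.
- by have /left_Y/andP[] : 0 <= x <= c by lra.
- by rewrite -subr_gt0 left_YB divr_gt0; lra.
Qed.

Lemma left_at0 : g 0 = 0.
Proof.
move: (c01) => ?. have [_ P0 _] := Phih.
by rewrite /left_map /left_chart /left_coord subr0 divff ?powR1 ?subrr ?mulr0//; lra.
Qed.

Lemma left_atc : g c = Phi u.
Proof.
hyps3. by rewrite /left_map /left_chart /left_coord subrr mul0r powR0 ?subr0 ?mulr1//; lra. Qed.

Lemma left_increasing : increasing_on g 0 c.
Proof.
hyps3. have [Pi _ _] := Phih.
apply: (increasing_on_comp (c := 0) (d := 1)) left_Q_increasing Pi _ _.
  by have /andP[] := @left_Q01 0 ltac:(lra).
by have /andP[] := @left_Q01 c ltac:(lra); lra.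
Qed.

Lemma left_slope x x' : 0 <= x -> x <= x' -> x' <= c ->
  u * alpha / c * Y x' `^ (alpha - 1) * (x' - x) <= E * (g x' - g x) /\
  g x' - g x <= E * (u * alpha / c) * Y x `^ (alpha - 1) * (x' - x).
Proof.
hyps. move=> x0 xx xc; have /andP[A B] := left_QB x0 xx xc.
have /andP[q0 _] := @left_Q01 x ltac:(lra).
have /andP[_ q1] := @left_Q01 x' ltac:(lra).
have qq : Q x <= Q x' by apply: (increasing_onW left_Q_increasing); lra.
have [C D] := Phib q0 qq ltac:(lra).
split; first by apply: le_trans A C.
apply: le_trans D _; rewrite -!mulrA; apply: ler_wpM2l; first by lra.
by rewrite !mulrA.
Qed.

Lemma left_lipschitz : upper_lipschitz (E * (u * alpha / c)) g 0 c.
Proof.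
hyps. move=> x x' x0 xx xc; have [_ H] := left_slope x0 xx xc.
apply: le_trans H _; apply: ler_wpM2r; first by lra.
rewrite ler_piMr//.
  by rewrite !mulr_ge0 ?invr_ge0; lra.
have /andP[Y0 Y1] := @left_Y x ltac:(lra).
apply: (le_trans (ler_powRr _ Y0 Y1)); first by lra.
by rewrite powR1.
Qed.

(** Relative form of the drop below the critical value: [u] is itself at most [E * Phi u], whence
    the second factor [E]. *)
Lemma left_drop x : 0 <= x <= c -> Phi u - g x <= E ^+ 2 * Phi u * Y x `^ alpha.
Proof.
hyps. move=> xc; have /andP[q0 q1] := left_Q01 xc.
have [_ B] := Phib q0 q1 ltac:(lra).
have [C _] := @Phib 0 u (lexx _) ltac:(lra) ltac:(lra).
have [_ P0 _] := Phih; rewrite P0 !subr0 in C.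
have yy := powR_ge0 (Y x) alpha.
have uQ : u - Q x = u * Y x `^ alpha by rewrite /left_chart; ring.
rewrite uQ in B; apply: (le_trans B).
have := ler_wpM2r yy C => H; have := ler_wpM2l (le_trans ler01 E1) H; lra.
Qed.

Lemma left_gap x : 0 <= x <= c -> Y x `^ alpha <= E * (1 - g x).
Proof.
hyps. move=> xc; have /andP[q0 q1] := left_Q01 xc.
have [_ _ P1] := Phih.
have [A _] := @Phib (Q x) 1 q0 ltac:(lra) (lexx _); rewrite P1 in A.
apply: le_trans A.
have /andP[Y0 Y1] := left_Y xc; have /andP[Z0 Z1] := pow01 Y0 Y1.
have : u * (1 - Y x `^ alpha) <= 1 - Y x `^ alpha by rewrite ler_piMl; lra.
by rewrite /left_chart; lra.
Qed.

Lemma left_jump x : 0 <= x <= c ->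
  u * Y x `^ alpha <= E * (g c - g x) /\ g c - g x <= E * (u * Y x `^ alpha).
Proof.
hyps. move=> xc; have /andP[q0 q1] := left_Q01 xc.
have := Phib q0 q1 ltac:(lra); rewrite left_atc.
by have -> : u - Q x = u * Y x `^ alpha by rewrite /left_chart; ring.
Qed.

End Left.

Section Right.
Local Notation T := (right_coord c).
Local Notation Q := (right_chart alpha c u).
Local Notation g := (right_map alpha c u Phi).

Lemma right_T x : c <= x <= 1 -> 0 <= T x <= 1.
Proof.
move: (c01) => ?. by move=> xc; rewrite /right_coord divr_ge0 ?ler_pdivrMr; lra. Qed.

Lemma right_TB x x' : T x' - T x = (x' - x) / (1 - c).
Proof.
move: (c01) => ?. by rewrite /right_coord; field; lra. Qed.

Lemma right_Q01 x : c <= x <= 1 -> 1 - u <= Q x <= 1.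
Proof.
hyps3. move=> /right_T /andP[Y0 Y1]; have /andP[P0 P1] := pow01 Y0 Y1.
have : 0 <= u * (1 - T x `^ alpha) by rewrite mulr_ge0; lra.
have : u * (1 - T x `^ alpha) <= u by rewrite ler_piMr; lra.
by rewrite /right_chart; lra.
Qed.

Lemma right_QB x x' : c <= x -> x <= x' -> x' <= 1 ->
  u * alpha / (1 - c) * T x `^ (alpha - 1) * (x' - x) <= Q x' - Q x <=
  u * alpha / (1 - c) * T x' `^ (alpha - 1) * (x' - x).
Proof.
hyps3. move=> x0 xx xc.
have xc' : c <= x <= 1 by lra.
have xc'' : c <= x' <= 1 by lra.
have /andP[Y0 Y1] := right_T xc'; have /andP[Z0 Z1] := right_T xc''.
have YZ : T x <= T x' by rewrite -subr_ge0 right_TB divr_ge0; lra.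
have /andP[A B] := powRB_bounds Y0 YZ.
rewrite right_TB in A B.
have -> : Q x' - Q x = u * (T x' `^ alpha - T x `^ alpha) by rewrite /right_chart; ring.
have u0 : 0 <= u by lra.
have := ler_wpM2l u0 A; have := ler_wpM2l u0 B; lra.
Qed.

Lemma right_Q_increasing : increasing_on Q c 1.
Proof.
hyps3. move=> x x' x0 xx xc; rewrite /right_chart ltrD2l ltrN2 ltr_pM2l; last by lra.
rewrite ltrD2l ltrN2; apply: gt0_ltr_powR; rewrite ?nnegrE.
- by lra.
- by have /right_T/andP[] : c <= x <= 1 by lra.
- by have /right_T/andP[] : c <= x' <= 1 by lra.
- by rewrite -subr_gt0 right_TB divr_gt0; lra.
Qed.

Lemma right_at1 : g 1 = 1.
Proof.
move: (c01) => ?. have [_ _ P1] := Phih.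
by rewrite /right_map /right_chart /right_coord divff ?powR1 ?subrr ?mulr0 ?subr0//; lra.
Qed.

Lemma right_atc : g c = Phi (1 - u).
Proof.
hyps3. by rewrite /right_map /right_chart /right_coord subrr mul0r powR0 ?subr0 ?mulr1//; lra. Qed.

Lemma right_increasing : increasing_on g c 1.
Proof.
hyps3. have [Pi _ _] := Phih.
apply: (increasing_on_comp (c := 0) (d := 1)) right_Q_increasing Pi _ _.
  by have /andP[] := @right_Q01 c ltac:(lra); lra.
by have /andP[] := @right_Q01 1 ltac:(lra).
Qed.

Lemma right_slope x x' : c <= x -> x <= x' -> x' <= 1 ->
  u * alpha / (1 - c) * T x `^ (alpha - 1) * (x' - x) <= E * (g x' - g x) /\
  g x' - g x <= E * (u * alpha / (1 - c)) * T x' `^ (alpha - 1) * (x' - x).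
Proof.
hyps. move=> x0 xx xc; have /andP[A B] := right_QB x0 xx xc.
have /andP[q0 _] := @right_Q01 x ltac:(lra).
have /andP[_ q1] := @right_Q01 x' ltac:(lra).
have qq : Q x <= Q x' by apply: (increasing_onW right_Q_increasing); lra.
have [C D] := @Phib (Q x) (Q x') ltac:(lra) qq q1.
split; first by apply: le_trans A C.
apply: le_trans D _; rewrite -!mulrA; apply: ler_wpM2l; first by lra.
by rewrite !mulrA.
Qed.

Lemma right_lipschitz : upper_lipschitz (E * (u * alpha / (1 - c))) g c 1.
Proof.
hyps. move=> x x' x0 xx xc; have [_ H] := right_slope x0 xx xc.
apply: le_trans H _; apply: ler_wpM2r; first by lra.
rewrite ler_piMr//.
  by rewrite !mulr_ge0 ?invr_ge0; lra.
have /andP[Y0 Y1] := @right_T x' ltac:(lra).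
apply: (le_trans (ler_powRr _ Y0 Y1)); first by lra.
by rewrite powR1.
Qed.

(** Only [T x ^ alpha <= T x] is used in place of the slope [alpha] at the fixed point 1: the
    estimate then holds on the whole branch, and the lost factor is harmless as it occurs [a] times
    and [a] is bounded. *)
Lemma right_gap x : c <= x <= 1 -> u * (1 - x) <= E * (1 - c) * (1 - g x).
Proof.
hyps. move=> xc; have /andP[q0 q1] := right_Q01 xc.
have [_ _ P1] := Phih.
have [A _] := @Phib (Q x) 1 ltac:(lra) q1 (lexx _); rewrite P1 in A.
have /andP[Y0 Y1] := right_T xc; have Z := powR_le_self Y0 Y1.
have B : u * (1 - T x) <= E * (1 - g x).
  apply: le_trans A; rewrite /right_chart opprB addrCA subrr addr0.
  by apply: ler_wpM2l; lra.
have -> : u * (1 - x) = (1 - c) * (u * (1 - T x)) by rewrite /right_coord; field; lra.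
have : (1 - c) * (u * (1 - T x)) <= (1 - c) * (E * (1 - g x)) by apply: ler_wpM2l; lra.
lra.
Qed.

Lemma right_jump x : c <= x <= 1 ->
  u * T x `^ alpha <= E * (g x - g c) /\ g x - g c <= E * (u * T x `^ alpha).
Proof.
hyps. move=> xc; have /andP[q0 q1] := right_Q01 xc.
have := @Phib (1 - u) (Q x) ltac:(lra) q0 q1; rewrite right_atc.
by have -> : Q x - (1 - u) = u * T x `^ alpha by rewrite /right_chart; ring.
Qed.

Lemma right_drop : 1 - g c <= E * u.
Proof.
hyps3. have [_ _ P1] := Phih.
have [_ A] := @Phib (1 - u) 1 ltac:(lra) ltac:(lra) (lexx _).
by rewrite right_atc; rewrite P1 in A; lra.
Qed.

End Right.
End Branches.
End PowerBranches.

(** * Derivatives and gaps along orbits of one branch *)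

Section Orbits.
Variables (R : realType) (alpha c u E : R) (Phi : R -> R).
Hypothesis alpha_gt1 : 1 < alpha.
Hypothesis c01 : 0 < c < 1.
Hypothesis u01 : 0 < u <= 1.
Hypothesis E1 : 1 <= E.
Hypothesis Phih : homeo01 Phi.
Hypothesis Phib : bilipschitz01 E Phi.
Implicit Types (x s t M : R) (n : nat).
Ltac hyps := move: (alpha_gt1) (c01) (u01) (E1) => ? ? ? ?.

Section LeftOrbits.
Local Notation Y := (left_coord c).
Local Notation g := (left_map alpha c u Phi).

Definition orbit_within a b (h : R -> R) n x :=
  forall i, (i < n)%N -> a <= iter i h x <= b.

Lemma orbit_within0 a b h n x : orbit_within a b h n.+1 x -> a <= x <= b.
Proof. by move=> /(_ 0%N isT). Qed.

Lemma orbit_withinS a b h n x : orbit_within a b h n.+1 x ->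
  orbit_within a b h n (h x).
Proof. by move=> o i ni; rewrite -iterSr; apply: o. Qed.

(** Up to factors [E], the derivative of the [n]th iterate at [x] is this product times
    [(u * alpha / c) ^+ n]. *)
Definition orbit_prod n x := \prod_(i < n) Y (iter i g x) `^ (alpha - 1).

Lemma orbit_prodS n x :
  orbit_prod n.+1 x = Y x `^ (alpha - 1) * orbit_prod n (g x).
Proof.
rewrite /orbit_prod big_ord_recl /=; congr (_ * _).
by apply: eq_bigr => i _; rewrite -iterSr.
Qed.

Lemma orbit_prod_ge0 n x : 0 <= orbit_prod n x.
Proof. by apply: prodr_ge0 => i _; apply: powR_ge0. Qed.

Lemma left_coord_mulB1 x : 0 <= x <= c ->
  Y x * Y x `^ (alpha - 1) = Y x `^ alpha.
Proof. by hyps; move=> /(left_Y c01)/andP[Y0 _]; rewrite powR_mulB1. Qed.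

Lemma left_coord_ub x : c <= Phi u -> 0 <= x ->
  Phi u * Y x <= Phi u - x.
Proof.
hyps; move=> cu x0; have -> : Phi u * Y x = Phi u - x * (Phi u / c).
  by rewrite /left_coord; field; lra.
by rewrite lerD2l lerN2 ler_peMr// ler_pdivlMr ?mul1r; lra.
Qed.

Lemma left_map_ge0 x : 0 <= x <= c -> 0 <= g x.
Proof.
hyps; move=> xc; rewrite -[leLHS](left_at0 alpha u c01 Phih).
by apply: (increasing_onW (left_increasing alpha_gt1 c01 u01 Phih)); lra.
Qed.

Lemma left_coord_step x : c <= Phi u -> 0 <= x <= c ->
  Y (g x) <= E ^+ 2 * Y x `^ alpha.
Proof.
hyps; move=> cu xc; have g0 := left_map_ge0 xc.
have A := left_drop alpha_gt1 c01 u01 E1 Phih Phib xc.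
have B := left_coord_ub cu g0.
have Pu : 0 < Phi u by lra.
by rewrite -(ler_pM2l Pu); lra.
Qed.

Lemma orbit_drop n x : c <= Phi u -> orbit_within 0 c g n.+1 x ->
  Phi u - iter n.+1 g x <= Phi u * E ^+ (2 * n.+1) * (Y x * orbit_prod n.+1 x).
Proof.
hyps; move=> cu; elim: n x => [|n IH] x o.
  have xc := orbit_within0 o.
  rewrite orbit_prodS /orbit_prod big_ord0 mulr1 left_coord_mulB1//=.
  by rewrite [Phi u * _]mulrC; apply: left_drop.
have xc := orbit_within0 o.
rewrite iterSr; apply: (le_trans (IH _ (orbit_withinS o))).
rewrite [orbit_prod n.+2 x]orbit_prodS [Y x * _]mulrA left_coord_mulB1//.
rewrite (mulnDr 2 1 n.+1) exprD muln1.
have P0 := orbit_prod_ge0 n.+1 (g x).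
have Pu : 0 < Phi u by lra.
have EE : 0 <= Phi u * E ^+ (2 * n.+1) by rewrite mulr_ge0 ?exprn_ge0; lra.
have := ler_wpM2l EE (ler_wpM2r P0 (left_coord_step cu xc)); lra.
Qed.

(** Converse of [orbit_drop]. A step yields [1 - g x] where [Y (g x)] is wanted; they differ by a
    factor of at most [E] as long as [1 - c] is small compared with the coordinate. *)
Lemma orbit_prod_le n x : orbit_within 0 c g n.+1 x ->
  (forall i, (0 < i < n.+1)%N -> 1 - c <= (E - 1) * Y (iter i g x)) ->
  Y x * orbit_prod n.+1 x <= E ^+ (2 * n.+1) * (1 - iter n.+1 g x).
Proof.
hyps; elim: n x => [|n IH] x o gap.
  have xc := orbit_within0 o.
  rewrite orbit_prodS /orbit_prod big_ord0 mulr1 left_coord_mulB1//=.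
  have A := left_gap alpha_gt1 c01 u01 E1 Phih Phib xc.
  have Y0 := powR_ge0 (Y x) alpha.
  have g1 : 0 <= 1 - g x.
    have : 0 <= E * (1 - g x) by lra.
    by rewrite pmulr_rge0//; lra.
  apply: (le_trans A); apply: ler_wpM2r => //.
  by rewrite muln1 expr2 ler_peMr; lra.
have xc := orbit_within0 o.
rewrite orbit_prodS mulrA left_coord_mulB1//.
have A := left_gap alpha_gt1 c01 u01 E1 Phih Phib xc.
have P0 := orbit_prod_ge0 n.+1 (g x).
have G : 1 - c <= (E - 1) * Y (g x) := gap 1%N isT.
have gxc : 0 <= g x <= c by have := o 1%N isT.
have /andP[Y0 Y1] := left_Y c01 gxc.
have B : 1 - g x <= E * Y (g x).
  have -> : 1 - g x = (1 - c) + c * Y (g x) by rewrite /left_coord; field; lra.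
  have : c * Y (g x) <= Y (g x) by rewrite ler_piMl; lra.
  by lra.
have {}IH : Y (g x) * orbit_prod n.+1 (g x) <= E ^+ (2 * n.+1) * (1 - iter n.+2 g x).
  rewrite iterSr; apply: IH; first exact: orbit_withinS.
  move=> i /andP[i0 ni]; by rewrite -iterSr; apply: gap.
rewrite (mulnDr 2 1 n.+1) exprD muln1.
have E0 : 0 <= E by lra.
have H1 := ler_wpM2r P0 A; have H2 := ler_wpM2r P0 (ler_wpM2l E0 B).
have H3 := ler_wpM2l (sqr_ge0 E) IH; lra.
Qed.

(** The coordinate decreases along the branch, so the chain rule takes the left end for the upper
    bound and the right end for the lower one. *)
Lemma orbit_interval n s t : s <= t ->
  orbit_within 0 c g n s -> orbit_within 0 c g n t ->
  [/\ iter n g s <= iter n g t,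
   iter n g t - iter n g s <= (E * (u * alpha / c)) ^+ n * orbit_prod n s * (t - s) &
   (u * alpha / c) ^+ n * orbit_prod n t * (t - s) <=
     E ^+ n * (iter n g t - iter n g s)].
Proof.
hyps; have k0 : 0 <= u * alpha / c by rewrite !mulr_ge0 ?invr_ge0; lra.
have E0 : 0 <= E by lra.
have Ek0 : 0 <= E * (u * alpha / c) by exact: mulr_ge0.
elim: n s t => [|n IH] s t st os ot.
  by rewrite /orbit_prod !big_ord0 !expr0 /= !mulr1 !mul1r; split.
have /andP[s0 sc] := orbit_within0 os; have /andP[t0 tc] := orbit_within0 ot.
have gst : g s <= g t.
  exact: (increasing_onW (left_increasing alpha_gt1 c01 u01 Phih)).
have [L U] := left_slope alpha_gt1 c01 u01 E1 Phib s0 st tc.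
have [I J K] := IH _ _ gst (orbit_withinS os) (orbit_withinS ot).
rewrite !iterSr !orbit_prodS; split => //.
  apply: (le_trans J); rewrite exprSr.
  have e0 := mulr_ge0 (exprn_ge0 n Ek0) (orbit_prod_ge0 n (g s)).
  apply: le_trans (ler_wpM2l e0 U) _; rewrite le_eqVlt; apply/orP; left; apply/eqP.
  by move: ((E * (u * alpha / c)) ^+ n) (orbit_prod n (g s)) (Y s `^ _) => *; ring.
have e0 := mulr_ge0 (exprn_ge0 n k0) (orbit_prod_ge0 n (g t)).
have H := le_trans (ler_wpM2l e0 L) (_ : _ <= E * (E ^+ n * (iter n g (g t) - iter n g (g s)))).
apply: le_trans (le_trans _ (H _)) _.
- rewrite exprSr le_eqVlt; apply/orP; left; apply/eqP.
  by move: ((u * alpha / c) ^+ n) (orbit_prod n (g t)) (Y t `^ _) => *; ring.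
- by rewrite mulrCA; apply: ler_wpM2l.
- by rewrite exprS mulrA.
Qed.

(** Backward induction: a gap below the critical value forces the previous point away from [c], by
    [left_drop], and a point away from [c] is below the critical value by [Phi u * M] at least. The
    last condition says that [M] reproduces itself. *)
Lemma orbit_coord_ge n x M : c <= Phi u -> 0 <= M ->
  orbit_within 0 c g n.+1 x ->
  E ^+ 2 * Phi u * M `^ alpha <= Phi u - iter n.+1 g x ->
  E ^+ 2 * M `^ alpha <= M ->
  forall i, (i < n.+1)%N -> M <= Y (iter i g x).
Proof.
hyps; move=> cu M0; have Pu : 0 < Phi u by lra.
have EP : 0 < E ^+ 2 * Phi u by rewrite mulr_gt0 ?exprn_gt0//; lra.
have key x' : 0 <= x' <= c -> E ^+ 2 * Phi u * M `^ alpha <= Phi u - g x' -> M <= Y x'.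
  move=> xc H; have /andP[Y0 _] := left_Y c01 xc.
  have A := left_drop alpha_gt1 c01 u01 E1 Phih Phib xc.
  have B : M `^ alpha <= Y x' `^ alpha.
    by rewrite -(ler_pM2l EP); lra.
  rewrite leNgt; apply/negP => YM.
  have := @gt0_ltr_powR R alpha ltac:(lra) (Y x') M.
  by rewrite !nnegrE => /(_ Y0 M0 YM); lra.
move=> + + MM; elim: n x => [|n IH] x o H.
  by case=> // _; apply: key => //; exact: orbit_within0 o.
have xc := orbit_within0 o.
have gxc : 0 <= g x <= c by have := o 1%N isT.
have {}IH := IH _ (orbit_withinS o) _.
case=> [_|i ni] /=; last by rewrite -iterS iterSr; apply: IH; rewrite // -iterSr.
apply: key => //.
have M1 : M <= Y (g x) by apply: (IH _ 0%N); rewrite // -iterSr.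
have := left_coord_ub cu (x := g x) ltac:(lra).
have := ler_wpM2l (ltW Pu) (le_trans MM M1); lra.
Qed.

(** Each step maps a coordinate [y] to at most [E ^ 2 * y ^ alpha]. Lowering the exponent to
    [(1 + alpha) / 2] spares a power of 1/2 with exponent at least [(alpha - 1) / 2], which absorbs
    [E ^ 2]. *)
Lemma orbit_coord_superexp n x : c <= Phi u ->
  E ^+ 2 * 2^-1 `^ ((alpha - 1) / 2) <= 1 ->
  orbit_within 0 c g n x -> Y x <= 2^-1 ->
  Y (iter n g x) <= 2^-1 `^ (((1 + alpha) / 2) ^+ n).
Proof.
hyps; move=> cu EE; elim: n => [|n IH] o yx.
  by rewrite /= expr0 powRr1//; lra.
have {}IH : Y (iter n g x) <= 2^-1 `^ (((1 + alpha) / 2) ^+ n).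
  by apply: IH => // i ni; apply: o; exact: ltnW.
have xc : 0 <= iter n g x <= c by apply: o.
have /andP[Y0 _] := left_Y c01 xc.
rewrite iterS; apply: (le_trans (left_coord_step cu xc)).
have k1 : 1 <= ((1 + alpha) / 2) ^+ n by apply: exprn_ege1; lra.
rewrite [_ ^+ n.+1]exprS; move: (_ ^+ n) k1 IH => k k1 IH.
have a0 : 0 <= alpha by lra.
have H := ler_powRr a0 Y0 IH.
have -> : (1 + alpha) / 2 * k = k * alpha - (k * ((alpha - 1) / 2)) by field.
rewrite powRB; last by apply/implyP => _; rewrite invr_eq0 pnatr_eq0.
rewrite powRrM.
have p0 : 0 < (2^-1 : R) `^ (k * ((alpha - 1) / 2)) by rewrite powR_gt0 ?invr_gt0.
rewrite ler_pdivlMr//.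
have pk : (2^-1 : R) `^ (k * ((alpha - 1) / 2)) <= 2^-1 `^ ((alpha - 1) / 2).
  by apply: ger_powR; [lra | rewrite ler_peMl//; lra].
have A : E ^+ 2 * 2^-1 `^ (k * ((alpha - 1) / 2)) <= 1.
  by apply: le_trans EE; apply: ler_wpM2l => //; exact: sqr_ge0.
move: H A p0 (sqr_ge0 E) (powR_ge0 (2^-1 `^ k) alpha).
move: (E ^+ 2) (_ `^ (k * _)) ((2^-1 `^ k) `^ alpha) (_ `^ alpha) => e q m y H A p0 e0 m0.
have := ler_wpM2r m0 A; have := ler_wpM2r (mulr_ge0 e0 (ltW p0)) H; lra.
Qed.

End LeftOrbits.

Section RightOrbits.
Local Notation T := (right_coord c).
Local Notation g := (right_map alpha c u Phi).

Lemma orbit_gap n x : orbit_within c 1 g n x ->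
  1 - x <= (E * (1 - c) / u) ^+ n * (1 - iter n g x).
Proof.
hyps; have k0 : 0 <= E * (1 - c) / u by rewrite divr_ge0 ?mulr_ge0; lra.
have u0 : 0 < u by lra.
elim: n x => [|n IH] x o; first by rewrite expr0 mul1r.
have xc := orbit_within0 o.
have A := right_gap alpha_gt1 c01 u01 E1 Phih Phib xc.
have {}IH := IH _ (orbit_withinS o).
have B : 1 - x <= E * (1 - c) / u * (1 - g x).
  rewrite -(ler_pM2l u0).
  by have -> : u * (E * (1 - c) / u * (1 - g x)) = E * (1 - c) * (1 - g x) by field; lra.
rewrite iterSr exprS; apply: (le_trans B).
by rewrite -[leRHS]mulrA; apply: ler_wpM2l.
Qed.

Lemma right_orbit_interval n s t : s <= t ->
  orbit_within c 1 g n s -> orbit_within c 1 g n t ->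
  iter n g s <= iter n g t /\
  iter n g t - iter n g s <= (E * (u * alpha / (1 - c))) ^+ n * (t - s).
Proof.
hyps; have k0 : 0 <= E * (u * alpha / (1 - c)) by rewrite !mulr_ge0 ?invr_ge0; lra.
elim: n s t => [|n IH] s t st os ot.
  by rewrite expr0 mul1r.
have s0 := orbit_within0 os; have t0 := orbit_within0 ot.
have gst : g s <= g t.
  by apply: (increasing_onW (right_increasing alpha_gt1 c01 u01 Phih)); lra.
have [I J] := IH _ _ gst (orbit_withinS os) (orbit_withinS ot).
rewrite !iterSr; split => //; apply: (le_trans J).
rewrite exprSr -[leRHS]mulrA; apply: ler_wpM2l; first exact: exprn_ge0.
by apply: (right_lipschitz alpha_gt1 c01 u01 E1 Phib); lra.
Qed.

Lemma right_orbit_interval_ge n s t : s <= t ->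
  orbit_within c 1 g n s -> orbit_within c 1 g n t ->
  (forall i, (i < n)%N -> 2^-1 <= T (iter i g s)) ->
  (u * alpha / (1 - c) * 2^-1 `^ (alpha - 1)) ^+ n * (t - s) <=
   E ^+ n * (iter n g t - iter n g s).
Proof.
hyps; have k0 : 0 <= u * alpha / (1 - c) by rewrite !mulr_ge0 ?invr_ge0; lra.
have kk : 0 <= u * alpha / (1 - c) * 2^-1 `^ (alpha - 1) by rewrite mulr_ge0// powR_ge0.
have E0 : 0 <= E by lra.
elim: n s t => [|n IH] s t st os ot half.
  by rewrite !expr0 !mul1r.
have s0 := orbit_within0 os; have t0 := orbit_within0 ot.
have gst : g s <= g t.
  by apply: (increasing_onW (right_increasing alpha_gt1 c01 u01 Phih)); lra.
rewrite !iterSr.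
set k := u * alpha / (1 - c) * _ in IH *.
have H : k * (t - s) <= E * (g t - g s).
  have /andP[s0l _] := s0; have /andP[_ t0r] := t0.
  have [A _] := right_slope alpha_gt1 c01 u01 E1 Phib s0l st t0r.
  apply: le_trans A; apply: ler_wpM2r; first by rewrite subr_ge0.
  by apply: ler_wpM2l => //; apply: ler_powRr; [lra|lra|exact: (half 0%N)].
have {}IH : k ^+ n * (g t - g s) <= E ^+ n * (iter n g (g t) - iter n g (g s)).
  apply: IH gst (orbit_withinS os) (orbit_withinS ot) _ => i ni.
  by rewrite -iterSr; apply: half.
rewrite exprSr -mulrA exprS -mulrA; apply: (le_trans (ler_wpM2l (exprn_ge0 n kk) H)).
by rewrite mulrCA; apply: ler_wpM2l.
Qed.

End RightOrbits.
End Orbits.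

(** A renormalization in terms of the branches alone: the ends of [[p, q]] are fixed by the return
    map, their orbits stay outside until they return, and the critical values return within [[p, q]]
    on the other side of [c]. *)
Record renorm_data (R : realType) (gl gr : R -> R) (c : R) (a b : nat) (p q : R) := {
  rd_p : 0 < p < c;
  rd_q : c < q < 1;
  rd_a0 : (0 < a)%N;
  rd_b0 : (0 < b)%N;
  rd_out_l : forall i, (i < a)%N -> q < iter i gr (gl p);
  rd_fix_l : iter a gr (gl p) = p;
  rd_out_r : forall j, (j < b)%N -> iter j gl (gr q) < p;
  rd_fix_r : iter b gl (gr q) = q;
  rd_nontriv_l : c < iter a gr (gl c) <= q;
  rd_nontriv_r : p <= iter b gl (gr c) < c }.

(** * Position of the critical value of the right branch *)

Section Core.
Variables (R : realType) (alpha c u v E : R) (Phi Psi : R -> R) (a b : nat) (p q : R).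
Hypothesis alpha_gt1 : 1 < alpha.
Hypothesis c01 : 0 < c < 1.
Hypothesis u01 : 0 < u <= 1.
Hypothesis v01 : 0 < v <= 1.
Hypothesis E1 : 1 <= E.
Hypothesis Phih : homeo01 Phi.
Hypothesis Phib : bilipschitz01 E Phi.
Hypothesis Psih : homeo01 Psi.
Hypothesis Psib : bilipschitz01 E Psi.
Local Notation gl := (left_map alpha c u Phi).
Local Notation gr := (right_map alpha c v Psi).
Local Notation Y := (left_coord c).
Local Notation T := (right_coord c).
Hypothesis rd : renorm_data gl gr c a b p q.

Let gli := left_increasing alpha_gt1 c01 u01 Phih.
Let gri := right_increasing alpha_gt1 c01 v01 Psih.
Ltac pq := move: (rd_p rd) (rd_q rd) (c01) => ? ? ?.

Lemma right_orbit_between x i : gl p <= x -> x <= 1 -> (i <= a)%N ->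
  iter i gr (gl p) <= iter i gr x <= 1.
Proof.
pq; move=> px x1; elim: i => [|i IH] ia; first by rewrite /= px.
have /andP[A B] := IH (ltnW ia); have C := rd_out_l rd ia.
rewrite !iterS; have cl : c <= iter i gr (gl p) by lra.
rewrite (increasing_onW gri cl A B)/=.
rewrite -[leRHS](right_at1 alpha v c01 Psih); apply: (increasing_onW gri); lra.
Qed.

Lemma right_orbit_within x : gl p <= x -> x <= 1 -> orbit_within c 1 gr a x.
Proof.
pq; move=> px x1 i ia; have /andP[A B] := right_orbit_between px x1 (ltnW ia).
by have C := rd_out_l rd ia; lra.
Qed.

Lemma left_orbit_between x j : 0 <= x -> x <= gr q -> (j <= b)%N ->
  0 <= iter j gl x <= iter j gl (gr q).
Proof.
pq; move=> x0 xq; elim: j => [|j IH] jb; first by rewrite /= x0.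
have /andP[A B] := IH (ltnW jb); have C := rd_out_r rd jb.
rewrite !iterS; have cl : iter j gl (gr q) <= c by lra.
rewrite (increasing_onW gli A B cl) andbT.
by apply: left_map_ge0 => //; lra.
Qed.

Lemma left_orbit_within x : 0 <= x -> x <= gr q -> orbit_within 0 c gl b x.
Proof.
pq; move=> x0 xq j jb; have /andP[A B] := left_orbit_between x0 xq (ltnW jb).
by have C := rd_out_r rd jb; lra.
Qed.

Lemma gl_le1 x : 0 <= x <= c -> gl x <= 1.
Proof.
move=> /(left_Q01 alpha_gt1 c01 u01)/andP[A B]; have [Pi P0 P1] := Phih.
rewrite -[leRHS]P1; apply: (increasing_onW Pi) => //.
by move/andP: u01 => [_ ?]; exact: le_trans B _.
Qed.

Lemma gr_ge0 x : c <= x <= 1 -> 0 <= gr x.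
Proof.
move=> /(right_Q01 alpha_gt1 c01 v01)/andP[A B]; have [Pi P0 P1] := Psih.
by rewrite -[leLHS]P0; apply: (increasing_onW Pi) => //; move: v01 => ?; lra.
Qed.

Lemma gl_c_gt : q < Phi u.
Proof.
pq; rewrite -(left_atc alpha_gt1 Phi c01 u01).
have := rd_out_l rd (rd_a0 rd) => /= H; apply: (lt_le_trans H).
by apply: (increasing_onW gli); lra.
Qed.

Lemma Phi_u_le1 : Phi u <= 1.
Proof.
by rewrite -(left_atc alpha_gt1 Phi c01 u01); apply: gl_le1; move: c01 => ?; lra.
Qed.

Lemma gr_c_lt_gr_q : gr c < gr q.
Proof. by pq; apply: gri; lra. Qed.

Lemma gr_q_lt_p : gr q < p.
Proof. exact: (rd_out_r rd (rd_b0 rd)). Qed.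

Lemma orbit_c : orbit_within 0 c gl b (gr c).
Proof.
by pq; apply: left_orbit_within; [apply: gr_ge0; lra|exact/ltW/gr_c_lt_gr_q].
Qed.

Lemma orbit_q : orbit_within 0 c gl b (gr q).
Proof. by pq; apply: left_orbit_within => //; apply: gr_ge0; lra. Qed.

Lemma orbit_prod_le1 n x : orbit_within 0 c gl n x -> orbit_prod alpha c u Phi n x <= 1.
Proof.
move=> o; apply: (@le_trans _ _ (\prod_(i < n) 1)); last by rewrite big1_eq.
apply: ler_prod => i _; rewrite powR_ge0/=.
have /andP[Y0 Y1] := left_Y c01 (o i (ltn_ord i)).
by apply: (le_trans (ler_powRr _ Y0 Y1)); rewrite ?powR1//; move: alpha_gt1 => ?; lra.
Qed.

(** Suppose [gr c > 1/2]. Then the orbit of [gr c] approaches [c] superexponentially, so that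
    [q - c] is tiny. But [q] is fixed by the return map, which is a power law at [c] followed by
    slopes of product at most [(4 alpha) ^ b], so [q - c] cannot be that small compared with
    [1 - c]. *)
Lemma critical_value_le_half :
  E <= 2 -> E ^+ 2 * 2^-1 `^ ((alpha - 1) / 2) <= 1 ->
  (4 * alpha) ^+ b * 2 * (4 * 2^-1 `^ (((1 + alpha) / 2) ^+ b.-1)) `^ (alpha - 1)
    < (1 - c) `^ alpha ->
  gr c <= 2^-1.
Proof.
move=> E2 EE small; rewrite leNgt; apply/negP => half.
have gq := gr_c_lt_gr_q; have qp := gr_q_lt_p.
have jp : 0 <= gr q - gr c by rewrite subr_ge0 ltW.
move: half gq qp jp; set gc := gr c; set gQ := gr q => half gq qp jp.
pq; have al1 := alpha_gt1; have ul := u01; have vl := v01; have El := E1.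
have c2 : 2^-1 < c by lra.
have qc : c <= q <= 1 by lra.
have /andP[/ltW u0 u1] := ul.
have k0 : 0 <= E * (u * alpha / c) by rewrite !mulr_ge0 ?invr_ge0; lra.
have k1 : E * (u * alpha / c) <= 4 * alpha.
  rewrite mulrA ler_pdivrMr; last by lra.
  have : E * u <= 2 by have := ler_pM (le_trans ler01 El) u0 E2 u1; lra.
  move=> Eu; have : E * u * alpha <= 2 * alpha by apply: ler_wpM2r; lra.
  have : 4 * alpha * 2^-1 <= 4 * alpha * c by apply: ler_wpM2l; lra.
  lra.
have Ev : E * v <= 2.
  have /andP[/ltW v0 v1] := vl.
  by have := ler_pM (le_trans ler01 El) v0 E2 v1; rewrite mulr1.
have E4 : E ^+ 2 <= 4.
  by have := ler_pM (le_trans ler01 El) (le_trans ler01 El) E2 E2; rewrite -expr2; lra.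
have y2 : Y gc <= 2^-1 by rewrite /left_coord ler_pdivrMr; lra.
have Pu := gl_c_gt; have Pu1 := Phi_u_le1.
have oc := orbit_c.
have bE : b = b.-1.+1 by rewrite prednK// (rd_b0 rd).
have oc' : orbit_within 0 c gl b.-1 gc.
  by move=> i ib; apply: oc; rewrite bE ltnS ltnW.
have cPu : c <= Phi u by lra.
have A := orbit_coord_superexp alpha_gt1 c01 u01 E1 Phih Phib cPu EE oc' y2.
have xb : 0 <= iter b.-1 gl gc <= c by apply: oc; rewrite {2}bE.
have B := left_drop alpha_gt1 c01 u01 E1 Phih Phib xb.
have /andP[Yb0 Yb1] := left_Y c01 xb.
have C := powR_le_self alpha_gt1 Yb0 Yb1.
have sb : gl (iter b.-1 gl gc) < c.
  by have := rd_nontriv_r rd; rewrite -iterS -bE => /andP[].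
(* The critical value exceeds [q] and the last iterate is still below [c], so [q - c] is at most the
   drop at the last step. *)
have r1 : q - c <= 4 * 2^-1 `^ (((1 + alpha) / 2) ^+ b.-1).
  move: A B C; set y := Y _; set y' := y `^ alpha; set z := 2^-1 `^ _ => A B C.
  have y'0 : 0 <= y' by exact: powR_ge0.
  have : E ^+ 2 * Phi u * y' <= 4 * y'.
    apply: ler_wpM2r => //.
    have := ler_pM (sqr_ge0 E) (ltW (lt_trans (_ : 0 < q) Pu)) E4 Pu1; rewrite mulr1; lra.
  lra.
have r0 : 0 < q - c by lra.
have D : (q - c) `^ (alpha - 1) <= (4 * 2^-1 `^ (((1 + alpha) / 2) ^+ b.-1)) `^ (alpha - 1).
  by apply: ler_powRr => //; [lra | exact: ltW].
have [_ U _] := orbit_interval alpha_gt1 c01 u01 E1 Phih Phib (ltW gq) oc orbit_q.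
rewrite (rd_fix_r rd) in U.
have sb' : iter b gl gc < c by rewrite {1}bE.
have pr1 := orbit_prod_le1 oc.
have pr0 := orbit_prod_ge0 alpha c u Phi b gc.
have [_ J] := right_jump alpha_gt1 c01 v01 E1 Psib qc.
have k2 : (E * (u * alpha / c)) ^+ b <= (4 * alpha) ^+ b by apply: lerXn2r; rewrite ?nnegrE//; lra.
move: U small k2; have kb0 := exprn_ge0 b k0.
move: kb0 pr0 pr1; move: (_ ^+ b) ((4 * alpha) ^+ b) (orbit_prod _ _ _ _ _ _) => K K' P K0 P0 P1 U small KK.
have T0 : 0 <= T q by have /andP[] := right_T c01 qc.
have Ta0 := powR_ge0 (T q) alpha.
have U2 : q - c <= K' * 2 * T q `^ alpha.
  have h1 : K * P <= K' by have := ler_pM K0 P0 KK P1; rewrite mulr1.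
  have h2 := ler_wpM2r jp h1.
  have h3 : gQ - gc <= 2 * T q `^ alpha.
    apply: (le_trans J).
    by have := ler_wpM2r Ta0 Ev; lra.
  have K'0 : 0 <= K' by apply: le_trans KK.
  have := ler_wpM2l K'0 h3; lra.
(* One factor [q - c] cancels, which leaves a positive power of [q - c] as an upper bound for
   [(1 - c) ^ alpha]. *)
have TE : T q `^ alpha * (1 - c) `^ alpha = (q - c) `^ (alpha - 1) * (q - c).
  rewrite -powRM//; last by lra.
  by rewrite [RHS]mulrC powR_mulB1 ?ltW// /right_coord divfK//; lra.
have e0 : 0 <= (1 - c) `^ alpha by exact: powR_ge0.
have U3 := ler_wpM2r e0 U2; rewrite -[K' * 2 * _ * _]mulrA TE in U3.
have K'0 : 0 <= K' * 2 by rewrite mulr_ge0// (le_trans K0).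
have H : (1 - c) `^ alpha <= K' * 2 * (q - c) `^ (alpha - 1).
  by rewrite -(ler_pM2l r0); lra.
have := ler_wpM2l K'0 D; lra.
Qed.

End Core.

(** * Nonlinear inequalities behind the size estimates *)

Section Arithmetic.
Variable R : realType.

(** In this and the next facts the hypotheses are multiplied together by hand, after which the
    claims are linear in the monomials. *)
Fact coord_p_contradiction (k e y es ea ya K : R) :
  0 < e -> 0 <= k -> 0 < ea ->
  y * ya <= 2 * k * (e + y) -> k * e <= K * (es * (e * ea)) ->
  4 * K * es <= 16^-1 -> ea <= ya -> e < y -> 0 <= y -> False.
Proof.
move=> e0 k0 ea0 A B C D lt y0.
have y0' : 0 < y by lra.
have A2 : y * ya <= 4 * k * y by have := ler_wpM2l k0 (ltW lt); lra.
have A3 : ya <= 4 * k by rewrite -(ler_pM2l y0'); lra.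
have A4 := ler_wpM2r (ltW e0) A3.
have A5 : ya * e <= (4 * K * es) * ea * e by lra.
have A6 : ya <= (4 * K * es) * ea by rewrite -(ler_pM2r e0).
have := ler_wpM2r (ltW ea0) C; lra.
Qed.

Fact coord_p_arith (k e y es ea ya K F t4 : R) :
  0 < F -> 0 <= ea -> 0 <= k ->
  ya <= 2 * k * (e + y) -> k * e <= K * (es * ea) -> y <= e ->
  4 * K * es * F <= t4 * F -> ya <= t4 * ea.
Proof.
move=> f0 ea0 k0 A B C D.
have D' : 4 * K * es <= t4 by rewrite -(ler_pM2r f0).
have A' := ler_wpM2l k0 C.
have := ler_wpM2r ea0 D'; lra.
Qed.

Fact orbit_growth_arith (P yn xn Yy Pu e1 e2 k al d : R) :
  k * P * d <= e1 * (yn - xn) -> Pu - yn <= Pu * e2 * (Yy * P) -> 0 <= P ->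
  al <= e1 * k -> e2 * (e1 * e1) <= 2 -> 0 <= e1 -> 0 <= e2 -> 0 <= d ->
  0 <= Pu -> 0 <= k -> 0 <= yn - xn -> 0 <= Yy -> Yy <= 1 -> Pu <= 1 ->
  0 <= al -> al * (Pu - yn) * d <= 2 * (yn - xn).
Proof.
move=> J K P0 alk E4 e10 e20 xy0 Pu0 k0 d0 Y0 Y1 P1 al0.
have h1 : Pu * e2 * (Yy * P) <= e2 * P.
  have a1 : Yy * P <= P by rewrite ler_piMl.
  have a2 : Pu * e2 <= e2 by rewrite ler_piMl.
  by apply: ler_pM => //; rewrite mulr_ge0.
have h2 : Pu - yn <= e2 * P by lra.
have h3 := ler_wpM2r xy0 (ler_wpM2l al0 h2).
have h4 : al * (e2 * P) * d <= e1 * k * (e2 * P) * d.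
  by apply: ler_wpM2r => //; apply: ler_wpM2r => //; rewrite mulr_ge0.
have h5 := ler_wpM2l (mulr_ge0 e10 e20) J.
have h6 := ler_wpM2r d0 E4.
lra.
Qed.

Fact return_width_arith (w e E2b Eub P y s1 d al TT : R) :
  w <= Eub * P * d -> y * P <= E2b * s1 -> 2^-1 <= y -> s1 <= 2 * e ->
  Eub <= E2b * al -> d <= 2 * TT -> 0 <= d -> 0 <= E2b -> E2b * E2b <= 2 ->
  0 <= P -> 0 <= al -> 0 <= e -> 0 <= TT -> w <= 16 * (al * e * TT).
Proof.
move=> U V Yc S k J d0 E0 E4 P0 al0 e0 T0.
have h1 : P <= 4 * E2b * e.
  have := ler_wpM2r P0 Yc; have := ler_wpM2l E0 S; lra.
have h2 := ler_wpM2r (mulr_ge0 P0 d0) k.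
have Eal : 0 <= E2b * al * d by rewrite !mulr_ge0.
have h3 := ler_wpM2l Eal h1.
have aed : 0 <= al * e * d by rewrite !mulr_ge0.
have h4 := ler_wpM2r aed E4.
have h5 := ler_wpM2l (mulr_ge0 al0 e0) J.
lra.
Qed.

Fact left_width_arith (y ea z Z K k Ea d : R) :
  k * d <= Ea * z -> y <= 8 * d -> 0 <= ea -> 0 < Z -> 8 * Z <= K ->
  Ea <= Z * ea * k -> 0 <= d -> 0 <= z -> 0 < Ea -> y <= 8 * K * (ea * z).
Proof.
move=> U B e0 Z0 kK k2 d0 z0 Ea0.
have h1 := ler_wpM2r d0 k2.
have h2 := ler_wpM2l (mulr_ge0 (ltW Z0) e0) U.
have h3 : d <= Z * ea * z by rewrite -(ler_pM2l Ea0); lra.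
have h4 := ler_wpM2r (mulr_ge0 e0 z0) kK.
have h5 := mulr_ge0 (mulr_ge0 (ltW Z0) e0) z0.
lra.
Qed.

Fact left_width_le_arith (ea z k d y M K : R) :
  ea * z <= ea * (k * d) -> ea * k * d <= M * d -> M * d <= M * (2 * y) ->
  8 * M * y <= K * y -> 0 <= M * y -> ea * z <= K * y.
Proof. move=> *; lra. Qed.

End Arithmetic.

(** * Size of the return interval *)

Section Estimates.
Variables (R : realType) (alpha sigma c u v E t : R) (Phi Psi : R -> R).
Variables (a b : nat) (p q : R).
Hypothesis alpha_gt1 : 1 < alpha.
Hypothesis c01 : 0 < c < 1.
Hypothesis u01 : 0 < u <= 1.
Hypothesis v01 : 0 < v <= 1.
Hypothesis E1 : 1 <= E.
Hypothesis Phih : homeo01 Phi.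
Hypothesis Phib : bilipschitz01 E Phi.
Hypothesis Psih : homeo01 Psi.
Hypothesis Psib : bilipschitz01 E Psi.
Local Notation gl := (left_map alpha c u Phi).
Local Notation gr := (right_map alpha c v Psi).
Local Notation Y := (left_coord c).
Local Notation T := (right_coord c).
Hypothesis rd : renorm_data gl gr c a b p q.
Hypothesis sigma01 : 0 < sigma < 1.
Hypothesis a_bounds : alpha + sigma <= a%:R + 1 <= 2 * alpha.
Hypothesis b_ge2 : (2 <= b)%N.
Hypothesis E4b : E ^+ (4 * b) <= 2.
Hypothesis t01 : 0 < t <= 1 / 16.
Hypothesis tE : 1 + t <= E.
Hypothesis eps_t : 1 - c <= t / 4.
Hypothesis eps_sigma : 4 * 8 `^ (2 * alpha) * (1 - c) `^ sigma * 4 `^ alpha <= t `^ alpha.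
Hypothesis eps_b : 24 * alpha / (alpha ^+ b * (1 - c)) <= (t / 4) `^ alpha.
Hypothesis eps_inv : 1 - c <= t * ((1 - c) / 16) `^ alpha^-1.
Hypothesis half : gr c <= 2^-1.

Let E_le2 : E <= 2.
Proof.
apply: le_trans E4b; rewrite -[leLHS]expr1; apply: ler_weXn2l => //.
by rewrite muln_gt0 (ltnW b_ge2).
Qed.

Let EX_le2 n : (n <= 4 * b)%N -> E ^+ n <= 2.
Proof. by move=> nb; apply: le_trans E4b; exact: ler_weXn2l. Qed.

Let v_ge : 4^-1 <= v.
Proof.
have A := right_drop alpha_gt1 c01 v01 Psih Psib.
have h := half; have E2 := E_le2; have vv := v01.
have : E * v <= 2 * v by apply: ler_wpM2r; lra.
lra.
Qed.

Let rpc := rd_p rd.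
Let rqc := rd_q rd.

(** The bounds [alpha + sigma <= a + 1] and [a <= 2 alpha] bring the contraction over [a] steps near
    1 below the order [(1 - c) ^ alpha], with a factor [(1 - c) ^ sigma] to spare. *)
Lemma pow_a_le : (8 * (1 - c)) ^+ a * (1 - c) <=
  8 `^ (2 * alpha) * ((1 - c) `^ sigma * (1 - c) `^ alpha).
Proof.
have al1 := alpha_gt1; have ab := a_bounds; have cc := c01; have ss := sigma01.
rewrite exprMn -!powR_mulrn; [|lra|lra].
rewrite -mulrA; apply: ler_pM; try exact: powR_ge0.
- by rewrite mulr_ge0 ?powR_ge0//; lra.
- by apply: ler_powR; lra.
rewrite -[X in _ * X](powRr1 (a := 1 - c)); last by lra.
rewrite -!powRD; try (by apply/implyP => _; apply/lt0r_neq0; rewrite subr_gt0; case/andP: c01).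
by apply: ger_powR; lra.
Qed.

Lemma small_factor : 4 * 8 `^ (2 * alpha) * (1 - c) `^ sigma <= 16^-1.
Proof.
have al1 := alpha_gt1; have tt := t01.
have k0 : 0 <= 4 * 8 `^ (2 * alpha) * (1 - c) `^ sigma by rewrite !mulr_ge0 ?powR_ge0.
have f1 : 1 <= (4 : R) `^ alpha.
  by have := @ler_powRr R alpha 1 4 ltac:(lra) ltac:(lra) ltac:(lra); rewrite powR1.
have h1 := ler_wpM2l k0 f1.
have h2 : t `^ alpha <= t by apply: powR_le_self; lra.
have := eps_sigma; lra.
Qed.

(** The orbit of [gl p] moves away from the fixed point 1 for [a] steps; each of them contributes
    [E (1 - c) / v <= 8 (1 - c)], by [E <= 2] and [v >= 1/4]. *)
Lemma gap_gl_p : 1 - gl p <= (8 * (1 - c)) ^+ a * (1 - p).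
Proof.
have pc := rpc; have cc := c01; have vv := v_ge; have E2 := E_le2; have El := E1.
have gp1 : gl p <= 1 by apply: gl_le1 => //; lra.
have o := right_orbit_within alpha_gt1 c01 v01 Psih rd (lexx _) gp1.
have := orbit_gap alpha_gt1 c01 v01 E1 Psih Psib o; rewrite (rd_fix_l rd) => H.
apply: (le_trans H); apply: ler_wpM2r; first by lra.
have v0 : 0 < v by lra.
apply: lerXn2r; rewrite ?nnegrE.
- by rewrite divr_ge0 ?mulr_ge0; lra.
- by lra.
rewrite ler_pdivrMr//.
have : E * (1 - c) <= 2 * (1 - c) by apply: ler_wpM2r; lra.
have : 4^-1 * (8 * (1 - c)) <= v * (8 * (1 - c)) by apply: ler_wpM2r; lra.
lra.
Qed.

Lemma gap_p : 1 - p <= (1 - c) + Y p.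
Proof.
have pc := rpc; have cc := c01.
have -> : 1 - p = (1 - c) + c * Y p by rewrite /left_coord; field; lra.
have /andP[Y0 Y1] : 0 <= Y p <= 1 by apply: left_Y => //; lra.
by rewrite lerD2l ler_piMl//; lra.
Qed.

Let Yp01 : 0 <= Y p <= 1.
Proof. by have pc := rpc; apply: left_Y => //; lra. Qed.

Lemma coord_p_pow : Y p `^ alpha <= 2 * (8 * (1 - c)) ^+ a * ((1 - c) + Y p).
Proof.
have pc := rpc; have cc := c01.
have pc' : 0 <= p <= c by lra.
have A := left_gap alpha_gt1 c01 u01 E1 Phih Phib pc'.
have B := gap_gl_p; have C := gap_p; have E2 := E_le2; have El := E1.
have gp1 : gl p <= 1 by apply: gl_le1.
have k0 : 0 <= (8 * (1 - c)) ^+ a by apply: exprn_ge0; lra.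
have D : E * (1 - gl p) <= 2 * (1 - gl p) by apply: ler_wpM2r; lra.
have F := ler_wpM2l k0 C.
by rewrite -mulrA; apply: (le_trans A); apply: (le_trans D); apply: ler_wpM2l => //; apply: le_trans B F.
Qed.

(** Otherwise [1 - p] would be at most [2 * Y p], and a factor [Y p] would cancel in [coord_p_pow],
    forcing [Y p ^ (alpha - 1)] below [(1 - c) ^ (alpha - 1)]. *)
Lemma coord_p_le_eps : Y p <= 1 - c.
Proof.
have al1 := alpha_gt1; have cc := c01; have /andP[Y0 _] := Yp01.
rewrite leNgt; apply/negP => lt.
have A := coord_p_pow; have B := pow_a_le; have C := small_factor.
have D : (1 - c) `^ (alpha - 1) <= Y p `^ (alpha - 1) by apply: ler_powRr; lra.
have e0 : 0 <= 1 - c by lra.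
have k0 : 0 <= (8 * (1 - c)) ^+ a by apply: exprn_ge0; lra.
have s0 := powR_ge0 (1 - c) sigma.
have e8 : 0 <= (8 : R) `^ (2 * alpha) by exact: powR_ge0.
have p0 : 0 < (1 - c) `^ (alpha - 1) by apply: powR_gt0; lra.
rewrite -(powR_mulB1 alpha_gt1 Y0) in A; rewrite -(powR_mulB1 alpha_gt1 e0) in B.
have eps0 : 0 < 1 - c by lra.
exact: (coord_p_contradiction eps0 k0 p0 A B C D lt Y0).
Qed.

(** With [Y p <= 1 - c] known, [coord_p_pow] gives [Y p ^ alpha] of order
    [(1 - c) ^ (alpha + sigma)]; the spare power [sigma] yields the factor [t / 4]. *)
Lemma coord_p_le : Y p <= t / 4 * (1 - c).
Proof.
have al1 := alpha_gt1; have cc := c01; have tt := t01; have /andP[Y0 _] := Yp01.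
have F0 : 0 <= t / 4 * (1 - c) by rewrite !mulr_ge0; lra.
rewrite leNgt; apply/negP => lt.
have := @gt0_ltr_powR R alpha ltac:(lra) (t / 4 * (1 - c)) (Y p).
rewrite !nnegrE => /(_ F0 Y0 lt); apply/negP; rewrite -leNgt.
have t4 : (t / 4) `^ alpha * 4 `^ alpha = t `^ alpha.
  by rewrite -powRM; [rewrite divfK|lra|lra].
rewrite powRM; [|lra|lra].
have f0 : 0 < (4 : R) `^ alpha by apply: powR_gt0.
have A := coord_p_pow; have B := pow_a_le; have C := coord_p_le_eps; have D := eps_sigma.
have k0 : 0 <= (8 * (1 - c)) ^+ a by apply: exprn_ge0; lra.
have ea0 := powR_ge0 (1 - c) alpha.
have e0 : 0 <= 1 - c by lra.
rewrite -t4 in D.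
exact: (coord_p_arith f0 ea0 k0 A B C D).
Qed.

Lemma gl_p_ge : 1 - gl p <= (1 - c) / 4.
Proof.
have A := gap_gl_p; have B := gap_p; have C := coord_p_le_eps.
have cc := c01; have et := eps_t; have tt := t01.
have pc := rpc.
have k : (8 * (1 - c)) ^+ a <= 8^-1.
  have e8 : 0 <= 8 * (1 - c) <= 1 by lra.
  case: (a) (rd_a0 rd) => // n _.
  apply: (@le_trans _ _ (8 * (1 - c))); last by lra.
  by rewrite exprS ler_piMr ?exprn_ile1//; lra.
have P0 : 0 <= 1 - p by lra.
have := ler_wpM2r P0 k; lra.
Qed.

Lemma Phi_u_ge : 1 - (1 - c) / 4 <= Phi u.
Proof.
have pc := rpc; have A := gl_p_ge; rewrite -(left_atc alpha_gt1 Phi c01 u01).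
have : gl p <= gl c.
  by apply: (increasing_onW (left_increasing alpha_gt1 c01 u01 Phih)); lra.
lra.
Qed.

Let Phu := gl_c_gt alpha_gt1 c01 u01 Phih rd.
Let Phu1 := Phi_u_le1 alpha_gt1 c01 u01 Phih.

Lemma u_ge : c <= E * u.
Proof.
have [_ P0 _] := Phih; have uu := u01; have rq := rqc; have P := Phu.
have [_ A] := @Phib 0 u (lexx _) ltac:(lra) ltac:(lra).
by rewrite P0 !subr0 in A; lra.
Qed.

(** The multiplier along 0 is about [alpha] per step. The right end [y] gives the smallest slope,
    and the derivative product there is at least of the order of the final gap, by [orbit_drop]. *)
Lemma orbit_growth n x y : (n < b)%N -> x <= y -> orbit_within 0 c gl n.+1 x ->
  orbit_within 0 c gl n.+1 y ->
  alpha ^+ n.+1 * (Phi u - iter n.+1 gl y) * (y - x) <=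
  2 * (iter n.+1 gl y - iter n.+1 gl x).
Proof.
move=> nb xy ox oy.
have cc := c01; have El := E1; have al1 := alpha_gt1; have rq := rqc.
have P := Phu; have P1 := Phu1.
have cu : c <= Phi u by lra.
have [I _ J] := orbit_interval alpha_gt1 c01 u01 E1 Phih Phib xy ox oy.
have K := orbit_drop alpha_gt1 c01 u01 E1 Phih Phib cu oy.
have y0 := orbit_within0 oy.
have /andP[Y0 Y1] := left_Y c01 y0.
have P0 := orbit_prod_ge0 alpha c u Phi n.+1 y.
have al : alpha ^+ n.+1 <= E ^+ n.+1 * (u * alpha / c) ^+ n.+1.
  rewrite -exprMn; apply: lerXn2r; rewrite ?nnegrE.
  - by lra.
  - by rewrite !mulr_ge0 ?invr_ge0; have := u01; lra.
  rewrite mulrA ler_pdivlMr; last by lra.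
  have := u_ge; have a0 : 0 <= alpha by lra.
  by move=> /(ler_wpM2r a0); lra.
(* Two factors [E] per step come from [orbit_drop], one from the chain rule and one from
   [c <= E * u]: hence the form of [E4b]. *)
have E4 : E ^+ (2 * n.+1) * (E ^+ n.+1 * E ^+ n.+1) <= 2.
  by rewrite -!exprD; apply: EX_le2; move: nb; clear; lia.
have e1 : 0 <= E ^+ n.+1 by apply: exprn_ge0; lra.
have e2 : 0 <= E ^+ (2 * n.+1) by apply: exprn_ge0; lra.
have xy0 : 0 <= y - x by lra.
have Pu0 : 0 <= Phi u by lra.
have k0 : 0 <= (u * alpha / c) ^+ n.+1.
  by apply: exprn_ge0; rewrite !mulr_ge0 ?invr_ge0; have := u01; lra.
have dx0 : 0 <= iter n.+1 gl y - iter n.+1 gl x by rewrite subr_ge0.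
have al0 : 0 <= alpha ^+ n.+1 by apply: exprn_ge0; lra.
exact: (orbit_growth_arith J K P0 al E4 e1 e2 xy0 Pu0 k0 dx0 Y0 Y1 P1 al0).
Qed.

Let rdb : (0 < b)%N. Proof. exact: ltnW b_ge2. Qed.
Let o_c := orbit_c alpha_gt1 c01 u01 v01 Phih Psih rd.
Let o_q := orbit_q alpha_gt1 c01 u01 v01 Phih Psih rd.
Let gcq := gr_c_lt_gr_q alpha_gt1 c01 v01 Psih rd.

Lemma gr_c_ge0 : 0 <= gr c.
Proof. by have cc := c01; apply: gr_ge0 => //; lra. Qed.

(** Comparison with the fixed point 0 over [b - 1] steps: there the orbit of [q] is still below [p],
    hence at a distance of order [1 - c] from the critical value. The remaining step costs the
    factor [alpha]. *)
Lemma gr_q_le : alpha ^+ b * (1 - c) * gr q <= 3 * alpha.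
Proof.
have bE : b = b.-2.+2 by move: b_ge2; case: (b) => // -[].
have A := gr_c_ge0; have q0 : 0 <= gr q by apply: ltW; apply: le_lt_trans A gcq.
have o0 : orbit_within 0 c gl b.-2.+1 0.
  by move=> i ib; rewrite iter_fix ?left_at0// lexx; case/andP: c01 => /ltW.
have oq' : orbit_within 0 c gl b.-2.+1 (gr q).
  by move=> i ib; apply: o_q; rewrite bE; apply: ltnW.
have nb : (b.-2 < b)%N by rewrite [X in (_ < X)%N]bE ltnS leqnSn.
have G := orbit_growth nb q0 o0 oq'.
have fix0 : iter b.-2.+1 gl 0 = 0 by rewrite iter_fix ?left_at0.
rewrite fix0 !subr0 in G.
have lp : iter b.-2.+1 gl (gr q) < p.
  by apply: (rd_out_r rd); rewrite [X in (_ < X)%N]bE.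
have P := Phi_u_ge; have pc := rpc; have al1 := alpha_gt1; have cc := c01.
have al0 : 0 <= alpha ^+ b.-2.+1 by apply: exprn_ge0; lra.
have -> : alpha ^+ b = alpha * alpha ^+ b.-2.+1 by rewrite -exprS -bE.
have a0 : 0 <= alpha by lra.
have D : 3 / 4 * (1 - c) <= Phi u - iter b.-2.+1 gl (gr q) by lra.
have D2 := ler_wpM2r q0 (ler_wpM2l al0 D).
have D3 : alpha ^+ b.-2.+1 * (3 / 4 * (1 - c)) * gr q <= 2 by lra.
have := ler_wpM2l a0 D3; lra.
Qed.

Let qc1 : c <= q <= 1. Proof. by have rq := rqc; lra. Qed.
Let Tq0 : 0 <= T q. Proof. by have /andP[] := right_T c01 qc1. Qed.

Lemma coord_q_pow_le : T q `^ alpha <= 8 * gr q.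
Proof.
have [A _] := right_jump alpha_gt1 c01 v01 E1 Psib qc1.
have gc := gr_c_ge0; have gcq' := gcq; have vv := v_ge; have E2 := E_le2.
have T0 := powR_ge0 (T q) alpha.
have : E * (gr q - gr c) <= 2 * (gr q - gr c) by apply: ler_wpM2r; lra.
have : 4^-1 * T q `^ alpha <= v * T q `^ alpha by apply: ler_wpM2r.
lra.
Qed.

Lemma gr_q_small : 8 * gr q <= (t / 4) `^ alpha.
Proof.
apply: le_trans eps_b; have al1 := alpha_gt1; have cc := c01.
have k0 : 0 < alpha ^+ b * (1 - c) by rewrite mulr_gt0 ?exprn_gt0//; lra.
by rewrite ler_pdivlMr//; have := gr_q_le; lra.
Qed.

Lemma gr_q_le64 : gr q <= 1 / 64.
Proof.
have A := gr_q_small; have tt := t01.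
have := @powR_le_self R alpha alpha_gt1 (t / 4) ltac:(lra) ltac:(lra); lra.
Qed.

Lemma coord_q_le : T q <= t / 4.
Proof.
have A := gr_q_small; have B := coord_q_pow_le; have tt := t01.
have al1 := alpha_gt1.
rewrite leNgt; apply/negP => lt.
have := @gt0_ltr_powR R alpha ltac:(lra) (t / 4) (T q).
rewrite !nnegrE => /(_ _ Tq0 lt); lra.
Qed.

Lemma q_le : q - c <= t / 4 * (1 - c).
Proof.
have -> : q - c = T q * (1 - c) by rewrite /right_coord divfK//; apply/lt0r_neq0; case/andP: c01; rewrite subr_gt0.
by apply: ler_wpM2r; [have cc := c01; lra | exact: coord_q_le].
Qed.

(** This is [orbit_growth] from [gr c] to [gr q] over [b] steps: their distance is comparable to
    [T q ^ alpha], and [q] is at a distance of order [1 - c] from the critical value. *)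
Lemma return_width_ge : alpha ^+ b * (1 - c) * T q `^ alpha <=
  32 * (q - iter b gl (gr c)).
Proof.
have bE : b = b.-1.+1 by rewrite prednK.
have nb : (b.-1 < b)%N by rewrite [X in (_ < X)%N]bE.
have oc' := o_c; have oq' := o_q; rewrite bE in oc' oq'.
have G := orbit_growth nb (ltW gcq) oc' oq'.
rewrite -bE (rd_fix_r rd) in G.
have P := Phi_u_ge; have cc := c01; have tt := t01; have Q := q_le.
have [A _] := right_jump alpha_gt1 c01 v01 E1 Psib qc1.
have vv := v_ge; have E2 := E_le2; have gcq' := gcq; have al1 := alpha_gt1.
have T0 := powR_ge0 (T q) alpha.
have D : T q `^ alpha <= 8 * (gr q - gr c).
  have : E * (gr q - gr c) <= 2 * (gr q - gr c) by apply: ler_wpM2r; lra.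
  have : 4^-1 * T q `^ alpha <= v * T q `^ alpha by apply: ler_wpM2r.
  lra.
have Q' : t / 4 * (1 - c) <= 1 / 4 * (1 - c) by apply: ler_wpM2r; lra.
have F : 2^-1 * (1 - c) <= Phi u - q by lra.
have d0 : 0 <= gr q - gr c by lra.
have al0 : 0 <= alpha ^+ b by apply: exprn_ge0; lra.
have F' := ler_wpM2r d0 (ler_wpM2l al0 F).
have e0 : 0 <= alpha ^+ b * (1 - c) by rewrite mulr_ge0//; lra.
have D' := ler_wpM2l e0 D.
move: G F' D'; lra.
Qed.

(** After [b] steps the orbit of [gr c] is below [c], at a distance of order [1 - c] from the
    critical value. So its earlier points have coordinates at least of order
    [(1 - c) ^ (1 / alpha)], much larger than [1 - c]. *)
Lemma orbit_c_coord_ge i : (i < b)%N -> 1 - c <= t * Y (iter i gl (gr c)).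
Proof.
move=> ib; have bE : b = b.-1.+1 by rewrite prednK.
have al1 := alpha_gt1; have cc := c01; have tt := t01; have rq := rqc; have PP := Phu.
have cu : c <= Phi u by lra.
have oc' := o_c; rewrite bE in oc'.
(* Here [E ^ 2 * M ^ alpha <= (1 - c) / 4], below the final gap of at least [3 (1 - c) / 4]. *)
set M := ((1 - c) / 16) `^ alpha^-1.
have M0 : 0 <= M by exact: powR_ge0.
have MM : M `^ alpha = (1 - c) / 16.
  rewrite -powRrM mulVf ?powRr1//; first by lra.
  by rewrite gt_eqF//; lra.
have e2 : E ^+ 2 <= 4.
  have E2 := E_le2; have El := E1.
  have := ler_pM (le_trans ler01 El) (le_trans ler01 El) E2 E2; rewrite -expr2; lra.
have ei : 1 - c <= t * M := eps_inv.
have tM : t * M <= M by rewrite ler_piMl//; lra.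
have h2 : E ^+ 2 * M `^ alpha <= M.
  rewrite MM; have : E ^+ 2 * ((1 - c) / 16) <= 4 * ((1 - c) / 16) by apply: ler_wpM2r; lra.
  lra.
have h1 : E ^+ 2 * Phi u * M `^ alpha <= Phi u - iter b.-1.+1 gl (gr c).
  rewrite -bE MM; have /andP[_ sc] := rd_nontriv_r rd; have P := Phi_u_ge.
  have P1 := Phu1.
  have P0 : 0 <= Phi u by lra.
  have ee := ler_pM (sqr_ge0 E) P0 e2 P1.
  have e16 : 0 <= (1 - c) / 16 by lra.
  have := ler_wpM2r e16 ee; lra.
have H := orbit_coord_ge alpha_gt1 c01 u01 E1 Phih Phib cu M0 oc' h1 h2.
apply: (le_trans ei); apply: ler_wpM2l; first by lra.
by apply: H; rewrite -bE.
Qed.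

(** Counterpart of [return_width_ge], by [orbit_prod_le] at [gr c], whose hypothesis is provided by
    [orbit_c_coord_ge]. *)
Lemma return_width_le : q - iter b gl (gr c) <=
  16 * (alpha ^+ b * (1 - c) * T q `^ alpha).
Proof.
have al1 := alpha_gt1; have cc := c01; have tt := t01; have El := E1; have tEl := tE.
have uu := u01; have vv := v01; have E2 := E_le2; have et := eps_t.
have k : (E * (u * alpha / c)) ^+ b <= E ^+ (2 * b) * alpha ^+ b.
  rewrite exprM -exprMn; apply: lerXn2r; rewrite ?nnegrE.
  - by rewrite !mulr_ge0 ?invr_ge0; lra.
  - by apply: mulr_ge0; [exact: sqr_ge0 | lra].
  rewrite mulrA ler_pdivrMr; last by lra.
  have Ec : 1 <= E * c.
    have : (1 + t) * c <= E * c by apply: ler_wpM2r; lra.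
    have : (1 + t) * (1 - t / 4) <= (1 + t) * c by apply: ler_wpM2l; lra.
    have : t * t <= t * 1 by apply: ler_wpM2l; lra.
    lra.
  have Ea : 0 <= E * alpha by rewrite mulr_ge0; lra.
  have h1 : E * (u * alpha) <= E * alpha by have := ler_wpM2l Ea (proj2 (andP uu)); lra.
  have := ler_wpM2l Ea Ec; rewrite expr2; lra.
have bE : b = b.-1.+1 by rewrite prednK.
have [_ U _] := orbit_interval alpha_gt1 c01 u01 E1 Phih Phib (ltW gcq) o_c o_q.
rewrite (rd_fix_r rd) in U.
have oc' := o_c; rewrite bE in oc'.
have gap i : (0 < i < b.-1.+1)%N -> 1 - c <= (E - 1) * Y (iter i gl (gr c)).
  rewrite -bE => /andP[_ ib]; apply: (le_trans (orbit_c_coord_ge ib)).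
  by apply: ler_wpM2r; [have /andP[] := left_Y c01 (o_c ib) | lra].
have V := orbit_prod_le alpha_gt1 c01 u01 E1 Phih Phib oc' gap; rewrite -bE in V.
have /andP[ps _] := rd_nontriv_r rd.
have Yc : 2^-1 <= Y (gr c).
  rewrite /left_coord ler_pdivlMr; last by lra.
  by have := gr_q_le64; have := gcq; lra.
have W := gap_p; have X := coord_p_le_eps.
have s1 : 1 - iter b gl (gr c) <= 2 * (1 - c) by lra.
have [_ J] := right_jump alpha_gt1 c01 v01 E1 Psib qc1.
have T0 := powR_ge0 (T q) alpha.
have J2 : gr q - gr c <= 2 * T q `^ alpha.
  apply: (le_trans J); rewrite mulrA; apply: ler_wpM2r => //.
  have : E * v <= E by rewrite ler_piMr; lra.
  lra.
have d0 : 0 <= gr q - gr c by have := gcq; lra.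
have e2b : 0 <= E ^+ (2 * b) by apply: exprn_ge0; lra.
have E4 : E ^+ (2 * b) * E ^+ (2 * b) <= 2.
  by rewrite -exprD; apply: EX_le2; clear; lia.
have P0 := orbit_prod_ge0 alpha c u Phi b (gr c).
have al0 : 0 <= alpha ^+ b by apply: exprn_ge0; lra.
have e0 : 0 <= 1 - c by lra.
exact: (return_width_arith U V Yc s1 k J2 d0 e2b E4 P0 al0 e0 T0).
Qed.

Lemma gl_jump : Y p `^ alpha <= 8 * (gl c - gl p) /\ gl c - gl p <= 2 * Y p `^ alpha.
Proof.
have pc := rpc; have cc := c01; have tt := t01; have et := eps_t; have uu := u01.
have pc' : 0 <= p <= c by lra.
have [A B] := left_jump alpha_gt1 c01 u01 E1 Phib pc'.
have E2 := E_le2; have El := E1; have y0 := powR_ge0 (Y p) alpha.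
have C := u_ge.
have Eu : E * u <= 2 * u by apply: ler_wpM2r; lra.
have u4 : 4^-1 <= u by lra.
have g0 : 0 <= gl c - gl p.
  by rewrite subr_ge0; apply: (increasing_onW (left_increasing alpha_gt1 c01 u01 Phih)); lra.
split.
  have : E * (gl c - gl p) <= 2 * (gl c - gl p) by apply: ler_wpM2r; lra.
  have : 4^-1 * Y p `^ alpha <= u * Y p `^ alpha by apply: ler_wpM2r.
  lra.
apply: (le_trans B); rewrite mulrA; apply: ler_wpM2r => //.
have : E * u <= E by rewrite ler_piMr; lra.
lra.
Qed.

Let h : R := 2^-1 `^ (alpha - 1).
Let h01 : 0 < h <= 1.
Proof.
rewrite /h powR_gt0//=; have al1 := alpha_gt1.
have := @ler_powRr R (alpha - 1) 2^-1 1 ltac:(lra) ltac:(lra) ltac:(lra).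
by rewrite powR1.
Qed.

(** It dominates [8 * X ^+ a] for the factors [X] met over the [a] steps near 1, because
    [a <= 2 alpha]. It depends on [alpha] only. *)
Definition return_constant : R := 8 * (16 * alpha / h) `^ (2 * alpha).

Lemma expn_le_constant X : 0 <= X -> X <= 16 * alpha / h ->
  8 * X ^+ a <= return_constant.
Proof.
move=> X0 Xh; rewrite /return_constant ler_pM2l//.
have hh := h01; have al1 := alpha_gt1; have ab := a_bounds.
have k1 : 1 <= 16 * alpha / h by rewrite ler_pdivlMr; lra.
apply: (@le_trans _ _ ((16 * alpha / h) ^+ a)); first by apply: lerXn2r; rewrite ?nnegrE//; lra.
by rewrite -powR_mulrn; [apply: ler_powR; lra | lra].
Qed.

Let o_gp : orbit_within c 1 gr a (gl p).
Proof.
have pc := rpc; have gp1 : gl p <= 1 by apply: gl_le1 => //; lra.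
exact: (right_orbit_within alpha_gt1 c01 v01 Psih rd).
Qed.

Let gpc : gl p <= gl c.
Proof.
have pc := rpc.
by apply: (increasing_onW (left_increasing alpha_gt1 c01 u01 Phih)); lra.
Qed.

Let o_gc : orbit_within c 1 gr a (gl c).
Proof.
have cc := c01; have gc1 : gl c <= 1 by apply: gl_le1 => //; lra.
exact: (right_orbit_within alpha_gt1 c01 v01 Psih rd).
Qed.

(** Each of the [a] steps near 1 has slope comparable to [1 / (1 - c)], and [gl c - gl p] is
    comparable to [Y p ^ alpha]. *)
Lemma left_width_le : (1 - c) ^+ a * (iter a gr (gl c) - p) <=
  return_constant * Y p `^ alpha.
Proof.
have al1 := alpha_gt1; have cc := c01; have hh := h01; have E2 := E_le2; have vv := v01; have El := E1.
have [_ U] := right_orbit_interval alpha_gt1 c01 v01 E1 Psih Psib gpc o_gp o_gc.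
rewrite (rd_fix_l rd) in U.
have [_ B] := gl_jump.
have e0 : 0 <= (1 - c) ^+ a by apply: exprn_ge0; lra.
have k : 8 * (2 * alpha) ^+ a <= return_constant.
  apply: expn_le_constant; first by lra.
  rewrite ler_pdivlMr; last by lra.
  have : 2 * alpha * h <= 2 * alpha by rewrite ler_piMr; lra.
  lra.
have k2 : (1 - c) ^+ a * (E * (v * alpha / (1 - c))) ^+ a <= (2 * alpha) ^+ a.
  rewrite -exprMn; apply: lerXn2r; rewrite ?nnegrE.
  - by rewrite !mulr_ge0 ?invr_ge0; lra.
  - by lra.
  have -> : (1 - c) * (E * (v * alpha / (1 - c))) = E * v * alpha by field; lra.
  apply: ler_wpM2r; first by lra.
  have : E * v <= E by rewrite ler_piMr; lra.
  lra.
have g0 : 0 <= gl c - gl p by have := gpc; lra.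
have y0 := powR_ge0 (Y p) alpha.
have A1 := ler_wpM2l e0 U.
have A2 := ler_wpM2r g0 k2.
have p0 : 0 <= (2 * alpha) ^+ a by apply: exprn_ge0; lra.
have A3 := ler_wpM2l p0 B.
have A4 := ler_wpM2r y0 k.
have A5 := mulr_ge0 p0 y0.
exact: (left_width_le_arith A1 A2 A3 A4 A5).
Qed.

(** The image of such a point is at [p] or beyond, so the point is within a multiple of
    [(1 - c) ^ 2] of 1, which is short compared with [1 - c]. *)
Lemma right_orbit_half i : (i < a)%N -> 2^-1 <= T (iter i gr (gl p)).
Proof.
move=> ia; have xc := o_gp ia.
have A := right_gap alpha_gt1 c01 v01 E1 Psih Psib xc.
have px : p <= gr (iter i gr (gl p)).
  rewrite -iterS; move: ia; rewrite leq_eqVlt => /predU1P[->|ia].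
    by rewrite (rd_fix_l rd).
  by have := rd_out_l rd ia; have := rpc; have := rqc; lra.
have W := gap_p; have X := coord_p_le_eps; have vv := v_ge; have E2 := E_le2.
have cc := c01; have et := eps_t; have tt := t01.
rewrite /right_coord ler_pdivlMr; last by lra.
move: A px xc; move: (iter i gr (gl p)) => x A px xc.
have B : v * (1 - x) <= 4 * (1 - c) * (1 - c).
  apply: (le_trans A).
  have : E * (1 - c) <= 2 * (1 - c) by apply: ler_wpM2r; lra.
  move=> C; have e0 : 0 <= 1 - gr x.
    rewrite subr_ge0 -[leRHS](right_at1 alpha v c01 Psih).
    by apply: (increasing_onW (right_increasing alpha_gt1 c01 v01 Psih)); lra.
  have := ler_wpM2r e0 C.
  have e1 : 0 <= 2 * (1 - c) by lra.
  have D : 1 - gr x <= 2 * (1 - c) by lra.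
  have := ler_wpM2l e1 D; lra.
have x1 : 0 <= 1 - x by lra.
have C := ler_wpM2r x1 vv.
have e1 : 0 <= 1 - c by lra.
have D : 1 - c <= 1 / 64 by lra.
have := ler_wpM2r e1 D; lra.
Qed.

Lemma left_width_ge : Y p `^ alpha <=
  8 * return_constant * ((1 - c) ^+ a * (iter a gr (gl c) - p)).
Proof.
have al1 := alpha_gt1; have cc := c01; have hh := h01; have E2 := E_le2; have vv := v01.
have v4 := v_ge; have El := E1.
have U := right_orbit_interval_ge alpha_gt1 c01 v01 E1 Psih Psib gpc o_gp o_gc right_orbit_half.
rewrite (rd_fix_l rd) in U.
have [B _] := gl_jump.
have e0 : 0 <= (1 - c) ^+ a by apply: exprn_ge0; lra.
have Z0 : 0 < (8 / (alpha * h)) ^+ a.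
  by apply: exprn_gt0; rewrite divr_gt0 ?mulr_gt0//; lra.
have k : 8 * (8 / (alpha * h)) ^+ a <= return_constant.
  apply: expn_le_constant; first by rewrite divr_ge0 ?mulr_ge0; lra.
  rewrite ler_pdivlMr; last by lra.
  have -> : 8 / (alpha * h) * h = 8 / alpha by field; rewrite !gt_eqF//; lra.
  by rewrite ler_pdivrMr; [nra | lra].
have k2 : E ^+ a <= (8 / (alpha * h)) ^+ a * (1 - c) ^+ a * (v * alpha / (1 - c) * h) ^+ a.
  rewrite -!exprMn; apply: lerXn2r; rewrite ?nnegrE.
  - by lra.
  - by rewrite !mulr_ge0 ?invr_ge0 ?mulr_ge0//; lra.
  have -> : 8 / (alpha * h) * (1 - c) * (v * alpha / (1 - c) * h) = 8 * v.
    by field; rewrite !gt_eqF//; lra.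
  by lra.
have g0 : 0 <= gl c - gl p by have := gpc; lra.
have z0 : 0 <= iter a gr (gl c) - p.
  by have /andP[] := rd_nontriv_l rd; have := rpc; lra.
have E0 : 0 < E ^+ a by apply: exprn_gt0; lra.
exact: (left_width_arith U B e0 Z0 k k2 g0 z0 E0).
Qed.

(** [T q / Y p] is [(q - c) / (c - p)] times [c / (1 - c)], so that it determines the next [eps].
    Combining the estimates of the two return widths determines it up to a constant. *)
Lemma return_ratio_le :
  T q `^ alpha * (alpha ^+ b * (1 - c)) * ((1 - c) ^+ a * (iter a gr (gl c) - p)) <=
  (128 * return_constant) * (Y p `^ alpha * (q - iter b gl (gr c))).
Proof.
have A := return_width_ge; have B := left_width_le.
have al1 := alpha_gt1; have cc := c01.
have T0 := powR_ge0 (T q) alpha; have Y0 := powR_ge0 (Y p) alpha.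
have z0 : 0 <= (1 - c) ^+ a * (iter a gr (gl c) - p).
  have /andP[] := rd_nontriv_l rd; have := rpc => pc *.
  by rewrite mulr_ge0 ?exprn_ge0; lra.
have s0 : 0 <= alpha ^+ b * (1 - c) * T q `^ alpha.
  by rewrite !mulr_ge0 ?exprn_ge0; lra.
have := ler_pM s0 z0 A B; have := le_trans s0 A; have := le_trans z0 B.
move=> b1 b2; have := mulr_ge0 b2 b1; lra.
Qed.

Lemma return_ratio_ge :
  Y p `^ alpha * (q - iter b gl (gr c)) <=
  (128 * return_constant) *
  (T q `^ alpha * (alpha ^+ b * (1 - c)) * ((1 - c) ^+ a * (iter a gr (gl c) - p))).
Proof.
have A := return_width_le; have B := left_width_ge.
have Y0 := powR_ge0 (Y p) alpha.
have s0 : 0 <= q - iter b gl (gr c).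
  by have /andP[_] := rd_nontriv_r rd; have := rqc; lra.
by have := ler_pM Y0 s0 B A; congr (_ <= _); ring.
Qed.

End Estimates.

(** * Renormalization of the branches *)

Section Renormalization.
Variables (R : realType) (alpha : R).
Hypothesis alpha_gt1 : 1 < alpha.

Lemma crx_ext (f g : R -> R) (a b : R) : (forall x, a <= x <= b -> f x = g x) ->
  expands_cross_ratio g a b -> expands_cross_ratio f a b.
Proof.
move=> fg cg x1 x2 x3 x4 ax1 x12 x23 x34 x4b.
by rewrite !fg; [exact: cg|lra|lra|lra|lra].
Qed.

Lemma iter_increasing (h : R -> R) (a b m0 m1 : R) n : increasing_on h a b ->
  orbit_within a b h n m0 -> orbit_within a b h n m1 ->
  increasing_on (iter n h) m0 m1.
Proof.
move=> hi; elim: n m0 m1 => [|n IH] m0 m1 o0 o1; first by move=> x y _ xy _.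
have /andP[m0a m0b] := orbit_within0 o0; have /andP[m1a m1b] := orbit_within0 o1.
move=> x y mx xy ym; rewrite !iterSr.
apply: (IH _ _ (orbit_withinS o0) (orbit_withinS o1)).
- by apply: (increasing_onW hi); lra.
- by apply: hi; lra.
- by apply: (increasing_onW hi); lra.
Qed.

Lemma iter_crx (h : R -> R) (a b m0 m1 : R) n : increasing_on h a b ->
  expands_cross_ratio h a b ->
  orbit_within a b h n m0 -> orbit_within a b h n m1 ->
  expands_cross_ratio (iter n h) m0 m1.
Proof.
move=> hi hc; elim: n m0 m1 => [|n IH] m0 m1 o0 o1.
  by apply: (@crx_ext _ (fun x => 0 + 1 * x)); [move=> x _; rewrite /=; ring | exact: crx_affine].
have /andP[m0a m0b] := orbit_within0 o0; have /andP[m1a m1b] := orbit_within0 o1.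
apply: (@crx_ext _ (fun x => iter n h (h x))); first by move=> x _; rewrite iterSr.
have hi' : increasing_on h m0 m1 by apply: increasing_on_sub hi.
apply: (crx_comp hi' _ (lexx (h m0)) (lexx (h m1))).
- exact: iter_increasing hi (orbit_withinS o0) (orbit_withinS o1).
- by apply: crx_sub hc.
- exact: IH (orbit_withinS o0) (orbit_withinS o1).
Qed.

Lemma iter_lt_inv (h : R -> R) (a b x y : R) n : increasing_on h a b ->
  orbit_within a b h n x -> orbit_within a b h n y ->
  iter n h x < iter n h y -> x < y.
Proof.
move=> hi ox oy xy; rewrite ltNge; apply/negP => yx.
have := increasing_onW (iter_increasing hi oy ox) (lexx _) yx (lexx _).
by rewrite leNgt xy.
Qed.

Lemma iter_le_inv (h : R -> R) (a b x y : R) n : increasing_on h a b ->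
  orbit_within a b h n x -> orbit_within a b h n y ->
  iter n h x <= iter n h y -> x <= y.
Proof.
move=> hi ox oy xy; rewrite leNgt; apply/negP => yx.
have := iter_increasing hi oy ox (lexx _) yx (lexx _).
by rewrite ltNge xy.
Qed.

Lemma crx_rescale (f S : R -> R) (m k m' k' a b : R) : 0 < k ->
  increasing_on f (m + k * a) (m + k * b) ->
  expands_cross_ratio f (m + k * a) (m + k * b) ->
  increasing_on S (f (m + k * a)) (f (m + k * b)) ->
  expands_cross_ratio S (f (m + k * a)) (f (m + k * b)) ->
  expands_cross_ratio (fun x => (S (f (m + k * x)) - m') / k') a b.
Proof.
move=> k0 fi fc Si Sc; apply: crx_affine_post.
have ii : increasing_on (fun x => m + k * x) a b by exact: increasing_affine.
have fS := increasing_on_comp fi Si (lexx _) (lexx _).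
have cfS := crx_comp fi Si (lexx _) (lexx _) fc Sc.
exact: (crx_comp ii fS (lexx _) (lexx _) (@crx_affine _ m k a b) cfS).
Qed.

(** At every level [phi] is a rescaled restriction of the diffeomorphism of the given map, so its
    distortion bound [D] is never lost. All that iteration produces goes into [A], and its bound [K]
    is replaced by a new one at each step. *)
Definition tame_factor K D (A phi : R -> R) :=
  [/\ homeo01 A, bilipschitz01 K A, expands_cross_ratio A 0 1, homeo01 phi &
      distortion_le D phi].

Lemma bilipschitz_lipschitz K (f : R -> R) : bilipschitz01 K f ->
  upper_lipschitz K f 0 1.
Proof. by move=> fb x y x0 xy y1; have [] := fb _ _ x0 xy y1. Qed.

(** [S] stands for the iterates after the first step and is defined on [[m0, m1]], beyond the piece
    over [[p, q]]. Koebe's principle is applied to [S] composed with [A], so that the new constant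
    [1 + tau] comes from the space around [[p, q]] and not from [K]. *)
Lemma tame_factor_restrict K D tau (A phi S : R -> R) (m0 m1 w0 w1 p q : R) :
  tame_factor K D A phi -> 0 <= tau ->
  0 <= m0 -> m1 <= 1 -> increasing_on S m0 m1 -> expands_cross_ratio S m0 m1 ->
  0 <= w0 -> w0 < w1 -> w1 <= 1 ->
  m0 < A (phi w0) -> A (phi w1) < m1 ->
  S (A (phi w0)) = p -> S (A (phi w1)) = q ->
  q - p <= tau * (p - S m0) -> q - p <= tau * (S m1 - q) ->
  exists A' phi', tame_factor (1 + tau) D A' phi' /\
    forall x, A' (phi' x) = (S (A (phi (w0 + (w1 - w0) * x))) - p) / (q - p).
Proof.
move=> [[Ai A0 A1] Ab Ac ph phd] tau0 m00 m11 Si Sc w00 w01 w11 mz0 zm1 Sp Sq sp1 sp2.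
have [phi_i phi0 phi1] := ph.
have pw : phi w0 < phi w1 by apply: phi_i.
have pw0 : 0 <= phi w0 by rewrite -phi0; apply: (increasing_onW phi_i); lra.
have pw1 : phi w1 <= 1 by rewrite -phi1; apply: (increasing_onW phi_i); lra.
have Azz : A (phi w0) < A (phi w1) by apply: Ai.
have Al := bilipschitz_lipschitz Ab.
have [a0 a0r Aa0] : exists2 x, 0 <= x <= 1 & A x = m0.
  by apply: (lipschitz_surj ltr01 Ai Al); rewrite A0 A1; lra.
have [a1 a1r Aa1] : exists2 x, 0 <= x <= 1 & A x = m1.
  by apply: (lipschitz_surj ltr01 Ai Al); rewrite A0 A1; lra.
have l0 : a0 < phi w0 by rewrite -(increasing_on_lt Ai) ?Aa0//; lra.
have l1 : phi w1 < a1 by rewrite -(increasing_on_lt Ai) ?Aa1//; lra.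
pose F s := S (A s).
have Ai' : increasing_on A a0 a1 by apply: increasing_on_sub Ai; lra.
have Fi : increasing_on F a0 a1.
  by apply: (increasing_on_comp Ai' Si); rewrite ?Aa0 ?Aa1.
have Fc : expands_cross_ratio F a0 a1.
  apply: (crx_comp Ai' Si _ _ _ Sc); rewrite ?Aa0 ?Aa1//.
  by apply: crx_sub Ac; lra.
have pq : p < q by rewrite -Sp -Sq; apply: Si; lra.
have Koe x y := @Koebe R F a0 a1 tau (phi w0) (phi w1) x y tau0 Fi Fc l0 pw l1.
have FE : F (phi w1) - F (phi w0) = q - p by rewrite /F Sp Sq.
rewrite /F Sp Sq Aa0 Aa1 in Koe.
set d := phi w1 - phi w0.
have d0 : 0 < d by rewrite /d; lra.
have qp0 : 0 < q - p by lra.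
exists (fun x => (F (phi w0 + d * x) - p) / (q - p)),
  (fun x => (phi (w0 + (w1 - w0) * x) - phi w0) / (phi w1 - phi w0)).
have dE : phi w0 + d * 1 = phi w1 by rewrite /d; ring.
have ai : increasing_on (fun x => phi w0 + d * x) 0 1 by exact: increasing_affine.
have [rh rd'] := distortion_restrict w00 w01 w11 ph phd.
split; last first.
  by move=> x; congr ((S (A _) - p) / _); rewrite /d; field; lra.
split=> //.
- split.
  + apply: increasing_affine_post => //.
    by apply: (increasing_on_comp ai Fi); rewrite ?mulr0 ?addr0 ?dE; exact: ltW.
  + by rewrite mulr0 addr0 /F Sp subrr mul0r.
  + by rewrite dE /F Sq divff// gt_eqF.
- move=> x y x0 xy y1.
  have h0 : 0 <= d * x by rewrite mulr_ge0//; lra.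
  have h1 : d * x <= d * y by apply: ler_wpM2l => //; lra.
  have h2 : d * y <= d by rewrite ler_piMr//; lra.
  have [] := Koe (phi w0 + d * x) (phi w0 + d * y) sp1 sp2 ltac:(lra) ltac:(lra) ltac:(rewrite /d in h2 *; lra).
  rewrite -/(F _) -/(F _) -/d.
  have -> : phi w0 + d * y - (phi w0 + d * x) = d * (y - x) by ring.
  move: (F _) (F _) => Fx Fy k1 k2.
  have -> : (Fy - p) / (q - p) - (Fx - p) / (q - p) = (Fy - Fx) / (q - p) by field; lra.
  have dn : d != 0 by rewrite gt_eqF.
  split.
    rewrite mulrA ler_pdivlMr// -(ler_pM2l d0); lra.
  by rewrite ler_pdivrMr// -(ler_pM2l d0); lra.
- apply: crx_affine_post.
  apply: (crx_comp ai Fi); rewrite ?mulr0 ?addr0 ?dE//; try exact: ltW.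
  exact: crx_affine.
Qed.

Record branches := Branches {
  bc : R; bu : R; bv : R;
  bA : R -> R; bphi : R -> R; bB : R -> R; bpsi : R -> R }.

Definition lbr br := left_map alpha (bc br) (bu br) (fun x => bA br (bphi br x)).
Definition rbr br := right_map alpha (bc br) (bv br) (fun x => bB br (bpsi br x)).

Record tame K D br : Prop := {
  tame_c : 0 < bc br < 1;
  tame_u : 0 < bu br <= 1;
  tame_v : 0 < bv br <= 1;
  tame_l : tame_factor K D (bA br) (bphi br);
  tame_r : tame_factor K D (bB br) (bpsi br);
  tame_cl : expands_cross_ratio (lbr br) 0 (bc br);
  tame_cr : expands_cross_ratio (rbr br) (bc br) 1 }.

Lemma homeo01_comp (f g : R -> R) : homeo01 f -> homeo01 g ->
  homeo01 (fun x => f (g x)).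
Proof.
move=> [fi f0 f1] [gi g0 g1]; split; rewrite ?g0 ?g1//.
by apply: (increasing_on_comp gi fi); rewrite ?g0 ?g1.
Qed.

Lemma tame_factor_homeo K D A phi : tame_factor K D A phi ->
  homeo01 (fun x => A (phi x)).
Proof. by move=> [Ah _ _ ph _]; exact: homeo01_comp. Qed.

Lemma tame_factor_bilipschitz K D A phi : 0 <= K -> 0 <= D ->
  tame_factor K D A phi -> bilipschitz01 (K * D) (fun x => A (phi x)).
Proof.
move=> K0 D0 [Ah Ab _ ph phd]; apply: bilipschitz_comp => //.
exact: distortion_bilipschitz.
Qed.

Section Renorm.
Variables (K D tau : R) (br : branches) (a b : nat) (p q : R).
Hypothesis K1 : 1 <= K.
Hypothesis D1 : 1 <= D.
Hypothesis tau0 : 0 <= tau.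
Hypothesis tbr : tame K D br.
Local Notation c := (bc br).
Local Notation u := (bu br).
Local Notation v := (bv br).
Local Notation gl := (lbr br).
Local Notation gr := (rbr br).
Hypothesis rd : renorm_data gl gr c a b p q.
Hypothesis space_ll : q - p <= tau * (p - gr c).
Hypothesis space_lr : q - p <= tau * (1 - q).
Hypothesis space_rl : q - p <= tau * p.
Hypothesis space_rr : q - p <= tau * (gl c - q).

Let c01 := tame_c tbr.
Let u01 := tame_u tbr.
Let v01 := tame_v tbr.
Let Phih := tame_factor_homeo (tame_l tbr).
Let Psih := tame_factor_homeo (tame_r tbr).
Let E1 : 1 <= K * D. Proof. by rewrite -[leLHS]mulr1; apply: ler_pM. Qed.
Let K0 : 0 <= K. Proof. exact: le_trans K1. Qed.
Let D0 : 0 <= D. Proof. exact: le_trans D1. Qed.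
Let Phib := tame_factor_bilipschitz K0 D0 (tame_l tbr).
Let Psib := tame_factor_bilipschitz K0 D0 (tame_r tbr).
Let gli : increasing_on gl 0 c := left_increasing alpha_gt1 c01 u01 Phih.
Let gri : increasing_on gr c 1 := right_increasing alpha_gt1 c01 v01 Psih.
Let gll := left_lipschitz alpha_gt1 c01 u01 E1 Phib.
Let grl := right_lipschitz alpha_gt1 c01 v01 E1 Psib.
Let gl0 : gl 0 = 0 := left_at0 alpha u c01 Phih.
Let gr1 : gr 1 = 1 := right_at1 alpha v c01 Psih.
Let pc := rd_p rd.
Let qc := rd_q rd.

Let gcc : gr c < p.
Proof.
have := gr_c_lt_gr_q alpha_gt1 c01 v01 Psih rd; have := gr_q_lt_p rd; have := pc.
by rewrite -/(rbr br) => *; lra.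
Qed.

Let glcq : q < gl c.
Proof.
by have := gl_c_gt alpha_gt1 c01 u01 Phih rd; rewrite -(left_atc alpha_gt1 _ c01 u01).
Qed.

(** Any number of steps is possible, since [gr] maps [[c, 1]] onto [[gr c, 1]], which contains
    [[c, 1]]. *)
Lemma right_preimage n y : gr c <= y <= 1 ->
  exists x, [/\ c <= x <= 1, orbit_within c 1 gr n.+1 x & iter n.+1 gr x = y].
Proof.
have cc := c01; have gc := gcc; have pp := pc.
have c1 : c < 1 by lra.
elim: n y => [|n IH] y yr.
  have [x xr gx] : exists2 x, c <= x <= 1 & gr x = y.
    by apply: (lipschitz_surj c1 gri grl); rewrite gr1.
  by exists x; split => // -[].
have [x1 [x1r ox1 gx1]] := IH y yr.
have [x xr gx] : exists2 x, c <= x <= 1 & gr x = x1.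
  by apply: (lipschitz_surj c1 gri grl); rewrite gr1; lra.
exists x; split => //; last by rewrite iterSr gx.
by case=> [_ //|i ni]; rewrite iterSr gx; apply: ox1.
Qed.

Lemma left_preimage n y : 0 <= y <= gl c ->
  exists x, [/\ 0 <= x <= c, orbit_within 0 c gl n.+1 x & iter n.+1 gl x = y].
Proof.
have cc := c01; have gc := glcq; have qq := qc.
have c1 : 0 < c by lra.
elim: n y => [|n IH] y yr.
  have [x xr gx] : exists2 x, 0 <= x <= c & gl x = y.
    by apply: (lipschitz_surj c1 gli gll); rewrite gl0.
  by exists x; split => // -[].
have [x1 [x1r ox1 gx1]] := IH y yr.
have [x xr gx] : exists2 x, 0 <= x <= c & gl x = x1.
  by apply: (lipschitz_surj c1 gli gll); rewrite gl0; lra.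
exists x; split => //; last by rewrite iterSr gx.
by case=> [_ //|i ni]; rewrite iterSr gx; apply: ox1.
Qed.

Let cp0 : 0 < c - p. Proof. by have := pc; lra. Qed.
Let qp0 : 0 < q - p. Proof. by have := pc; have := qc; lra. Qed.

Lemma left_renorm : exists u' A' phi', [/\ 0 < u' <= 1,
  tame_factor (1 + tau) D A' phi' &
  forall x, 0 <= x <= (c - p) / (q - p) ->
    left_map alpha ((c - p) / (q - p)) u' (fun x => A' (phi' x)) x =
    (iter a gr (gl (p + (q - p) * x)) - p) / (q - p)].
Proof.
have cc := c01; have gc := gcc; have pp := pc; have qq := qc; have uu := u01; have vv := v01.
have aE : a = a.-1.+1 by rewrite prednK// (rd_a0 rd).
have gcr0 : 0 <= gr c by apply: (gr_ge0 alpha_gt1 c01 v01 Psih); lra.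
(* The [a] iterates of [gr] extend to [[m0, 1]], with image [[gr c, 1]]: this is the space around
   [[p, q]]. As [right_preimage n] treats [n.+1] iterates, it is applied to [a.-1]. *)
have [m0 [m0r om0 Sm0]] := @right_preimage a.-1 (gr c) ltac:(lra).
have [z1 [z1r oz1 Sz1]] := @right_preimage a.-1 q ltac:(lra).
rewrite -aE in om0 Sm0 oz1 Sz1.
have o1 : orbit_within c 1 gr a 1.
  by move=> i _; rewrite iter_fix// lexx andbT; lra.
have Si := iter_increasing gri om0 o1.
have Sc := iter_crx gri (tame_cr tbr) om0 o1.
have pr : 0 <= p <= c by lra.
have glp1 : gl p <= 1 by apply: (gl_le1 alpha_gt1 c01 u01 Phih).
have glp0 : c <= gl p by have := rd_out_l rd (rd_a0 rd); rewrite /=; lra.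
have ogp : orbit_within c 1 gr a (gl p).
  exact: (right_orbit_within alpha_gt1 c01 v01 Psih rd (lexx _) glp1).
have S1 : iter a gr 1 = 1 by rewrite iter_fix.
have Sp := rd_fix_l rd.
have mg : m0 < gl p by apply: (iter_lt_inv gri om0 ogp); rewrite Sp Sm0; lra.
have gz : gl p < z1 by apply: (iter_lt_inv gri ogp oz1); rewrite Sp Sz1; lra.
have z11 : z1 < 1 by apply: (iter_lt_inv gri oz1 o1); rewrite S1 Sz1; lra.
have [w1 w1r Pw1] : exists2 w, 0 <= w <= 1 & bA br (bphi br w) = z1.
  have [Pi P0 P1] := Phih.
  apply: (lipschitz_surj ltr01 Pi (bilipschitz_lipschitz Phib)).
  by rewrite P0 P1; lra.
have [Pi P0 P1] := Phih.
pose w0 := left_chart alpha c u p.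
have w0r : 0 <= w0 <= u by apply: left_Q01.
have Pw0 : bA br (bphi br w0) = gl p by [].
have w0r1 : 0 <= w0 <= 1 by lra.
have w01 : w0 < w1.
  by rewrite -(increasing_on_lt Pi w0r1 w1r); have := gz; rewrite -Pw0 -Pw1.
(* The critical value returns to at most [q]; this is what makes the new [u'] at most 1. *)
have uw1 : u <= w1.
  have ur : 0 <= u <= 1 by lra.
  have glE : bA br (bphi br u) = gl c by rewrite /lbr left_atc.
  rewrite -(increasing_on_le Pi ur w1r) glE Pw1.
  have glc1 : gl c <= 1 by apply: (gl_le1 alpha_gt1 c01 u01 Phih); lra.
  have ogc : orbit_within c 1 gr a (gl c).
    apply: (right_orbit_within alpha_gt1 c01 v01 Psih rd) => //.
    by apply: (increasing_onW gli); lra.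
  by apply: (iter_le_inv gri ogc oz1); rewrite Sz1; case/andP: (rd_nontriv_l rd).
have m00 : 0 <= m0 by lra.
have w00 : 0 <= w0 by lra.
have w11 : w1 <= 1 by lra.
have [A' [phi' [tf AE]]] : exists A' phi', tame_factor (1 + tau) D A' phi' /\
    forall x, A' (phi' x) =
      (iter a gr (bA br (bphi br (w0 + (w1 - w0) * x))) - p) / (q - p).
  apply: (tame_factor_restrict (tame_l tbr) tau0 m00 (lexx 1) Si Sc w00 w01 w11);
    by rewrite ?Pw0 ?Pw1 ?Sm0 ?S1.
have n1 : c - p != 0 by rewrite gt_eqF.
have n2 : q - p != 0 by rewrite gt_eqF.
have n3 : c != 0 by rewrite gt_eqF//; case/andP: c01.
have Yp0 : 0 < left_coord c p by rewrite divr_gt0; lra.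
have Ypa : 0 < left_coord c p `^ alpha by exact: powR_gt0.
have w0E : u - w0 = u * left_coord c p `^ alpha by rewrite /w0 /left_chart; ring.
(* The power law is homogeneous in the distance to [c], so passing from [[p, q]] to [[0, 1]] only
   changes its coefficient: the chart takes [[p, c]] to an interval of length
   [u * left_coord c p ^ alpha], measured in units of [w1 - w0]. *)
exists (u * left_coord c p `^ alpha / (w1 - w0)), A', phi'; split => //.
- rewrite divr_gt0 ?mulr_gt0//=; try lra.
  by rewrite ler_pdivrMr; lra.
- move=> x xr; rewrite /left_map AE.
  have hx : 0 <= p + (q - p) * x <= c.
    move: xr => /andP[x0]; rewrite ler_pdivlMr// => x1.
    by have := mulr_ge0 (ltW qp0) x0; lra.
  congr ((iter a gr _ - p) / _); rewrite /lbr /left_map; congr (bA br (bphi br _)).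
  have Yx0 : 0 <= left_coord c (p + (q - p) * x) by have /andP[] := left_Y c01 hx.
  rewrite /left_chart.
  have -> : left_coord ((c - p) / (q - p)) x = left_coord c (p + (q - p) * x) / left_coord c p.
    by rewrite /left_coord; field; rewrite n1 n2 n3.
  rewrite powRM ?invr_ge0 ?(ltW Yp0)//.
  have -> : (left_coord c p)^-1 `^ alpha = (left_coord c p `^ alpha)^-1.
    apply: (mulfI (lt0r_neq0 Ypa)); rewrite mulfV ?gt_eqF// -powRM ?invr_ge0 ?(ltW Yp0)//.
    by rewrite mulfV ?powR1// gt_eqF.
  have ww : w1 - w0 != 0 by rewrite gt_eqF// subr_gt0.
  have Pn : left_coord c p `^ alpha != 0 by rewrite gt_eqF.
  move: (left_coord c p `^ alpha) (left_coord c (p + (q - p) * x) `^ alpha) (w1 - w0) Pn ww w0E => P Z W Pn ww w0E.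
  have -> : W * (u * P / W * (1 - Z / P)) = u * P - u * Z by field; rewrite Pn ww.
  by rewrite -w0E; ring.
Qed.

Let qc0 : 0 < q - c. Proof. by have := qc; lra. Qed.

Lemma right_renorm : exists v' B' psi', [/\ 0 < v' <= 1,
  tame_factor (1 + tau) D B' psi' &
  forall x, (c - p) / (q - p) <= x <= 1 ->
    right_map alpha ((c - p) / (q - p)) v' (fun x => B' (psi' x)) x =
    (iter b gl (gr (p + (q - p) * x)) - p) / (q - p)].
Proof.
have cc := c01; have gc := gcc; have pp := pc; have qq := qc; have vv := v01.
have glc := glcq.
have bE : b = b.-1.+1 by rewrite prednK// (rd_b0 rd).
have [m1 [m1r om1 Sm1]] := @left_preimage b.-1 (gl c) ltac:(lra).
have [z0 [z0r oz0 Sz0]] := @left_preimage b.-1 p ltac:(lra).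
rewrite -bE in om1 Sm1 oz0 Sz0.
have o0 : orbit_within 0 c gl b 0.
  by move=> i _; rewrite iter_fix// lexx /=; lra.
have Si := iter_increasing gli o0 om1.
have Sc := iter_crx gli (tame_cl tbr) o0 om1.
have qr : c <= q <= 1 by lra.
have ogq : orbit_within 0 c gl b (gr q) := orbit_q alpha_gt1 c01 u01 v01 Phih Psih rd.
have ogc : orbit_within 0 c gl b (gr c) := orbit_c alpha_gt1 c01 u01 v01 Phih Psih rd.
have S0 : iter b gl 0 = 0 by rewrite iter_fix.
have Sq := rd_fix_r rd.
have gm : gr q < m1 by apply: (iter_lt_inv gli ogq om1); rewrite Sq Sm1.
have zg : z0 < gr q by apply: (iter_lt_inv gli oz0 ogq); rewrite Sz0 Sq; lra.
have z00 : 0 < z0 by apply: (iter_lt_inv gli o0 oz0); rewrite S0 Sz0; lra.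
have zc : z0 <= gr c.
  by apply: (iter_le_inv gli oz0 ogc); rewrite Sz0; case/andP: (rd_nontriv_r rd).
have [Pi P0 P1] := Psih.
have [w0 w0r Pw0] : exists2 w, 0 <= w <= 1 & bB br (bpsi br w) = z0.
  apply: (lipschitz_surj ltr01 Pi (bilipschitz_lipschitz Psib)).
  by rewrite P0 P1; lra.
pose w1 := right_chart alpha c v q.
have w1r : 1 - v <= w1 <= 1 by apply: right_Q01.
have Pw1 : bB br (bpsi br w1) = gr q by [].
have w1r1 : 0 <= w1 <= 1 by lra.
have w01 : w0 < w1.
  by rewrite -(increasing_on_lt Pi w0r w1r1); have := zg; rewrite -Pw0 -Pw1.
have vw0 : w0 <= 1 - v.
  have vr : 0 <= 1 - v <= 1 by lra.
  have grE : bB br (bpsi br (1 - v)) = gr c by rewrite /rbr right_atc.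
  by rewrite -(increasing_on_le Pi w0r vr) grE Pw0.
have w00 : 0 <= w0 by lra.
have w11 : w1 <= 1 by lra.
have m11 : m1 <= 1 by lra.
have [B' [psi' [tf BE]]] : exists A' phi', tame_factor (1 + tau) D A' phi' /\
    forall x, A' (phi' x) =
      (iter b gl (bB br (bpsi br (w0 + (w1 - w0) * x))) - p) / (q - p).
  apply: (tame_factor_restrict (tame_r tbr) tau0 (lexx 0) m11 Si Sc w00 w01 w11);
    by rewrite ?Pw0 ?Pw1 ?Sm1 ?S0 ?subr0.
have n1 : q - c != 0 by rewrite gt_eqF.
have n2 : q - p != 0 by rewrite gt_eqF.
have n3 : 1 - c != 0 by rewrite gt_eqF// subr_gt0; case/andP: c01.
have Yp0 : 0 < right_coord c q by rewrite divr_gt0; lra.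
have Ypa : 0 < right_coord c q `^ alpha by exact: powR_gt0.
have w1E : w1 - (1 - v) = v * right_coord c q `^ alpha by rewrite /w1 /right_chart; ring.
exists (v * right_coord c q `^ alpha / (w1 - w0)), B', psi'; split => //.
- rewrite divr_gt0 ?mulr_gt0//=; try lra.
  by rewrite ler_pdivrMr; lra.
- move=> x xr; rewrite /right_map BE.
  have hx : c <= p + (q - p) * x <= 1.
    move: xr => /andP[+ x1]; rewrite ler_pdivrMr// => x0.
    by have := ler_wpM2l (ltW qp0) x1; lra.
  congr ((iter b gl _ - p) / _); rewrite /rbr /right_map; congr (bB br (bpsi br _)).
  have Yx0 : 0 <= right_coord c (p + (q - p) * x) by have /andP[] := right_T c01 hx.
  rewrite /right_chart.
  have -> : right_coord ((c - p) / (q - p)) x = right_coord c (p + (q - p) * x) / right_coord c q.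
    have d1 : q - p - (c - p) != 0 by rewrite (_ : _ - _ = q - c)//; ring.
    by rewrite /right_coord; field; rewrite ?n1 ?n2 ?n3 ?d1.
  rewrite powRM ?invr_ge0 ?(ltW Yp0)//.
  have -> : (right_coord c q)^-1 `^ alpha = (right_coord c q `^ alpha)^-1.
    apply: (mulfI (lt0r_neq0 Ypa)); rewrite mulfV ?gt_eqF// -powRM ?invr_ge0 ?(ltW Yp0)//.
    by rewrite mulfV ?powR1// gt_eqF.
  have ww : w1 - w0 != 0 by rewrite gt_eqF// subr_gt0.
  have Pn : right_coord c q `^ alpha != 0 by rewrite gt_eqF.
  move: (right_coord c q `^ alpha) (right_coord c (p + (q - p) * x) `^ alpha) Pn w1E => P Z Pn w1E.
  have -> : (w1 - w0) * (1 - v * P / (w1 - w0) * (1 - Z / P)) =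
     w1 - w0 - (v * P - v * Z) by field; rewrite Pn ww.
  by rewrite -w1E; ring.
Qed.

(** The new branches expand cross ratios because they are compositions of the old ones; the factors
    found above provide the other conditions. *)
Lemma tame_renorm : exists br', [/\ tame (1 + tau) D br',
  bc br' = (c - p) / (q - p),
  (forall x, 0 <= x <= bc br' ->
     lbr br' x = (iter a gr (gl (p + (q - p) * x)) - p) / (q - p)) &
  (forall x, bc br' <= x <= 1 ->
     rbr br' x = (iter b gl (gr (p + (q - p) * x)) - p) / (q - p))].
Proof.
have cc := c01; have pp := pc; have qq := qc.
have [u' [A' [phi' [u'01 tl lE]]]] := left_renorm.
have [v' [B' [psi' [v'01 tr rE]]]] := right_renorm.
have c'01 : 0 < (c - p) / (q - p) < 1.
  by rewrite divr_gt0//= ltr_pdivrMr//; lra.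
have cE : p + (q - p) * ((c - p) / (q - p)) = c by field; rewrite gt_eqF.
have pE : p + (q - p) * 0 = p by rewrite mulr0 addr0.
have qE : p + (q - p) * 1 = q by rewrite mulr1 addrC subrK.
have pr : 0 <= p <= c by lra.
have qr : c <= q <= 1 by lra.
have o1 : orbit_within c 1 gr a (gl p).
  apply: (right_orbit_within alpha_gt1 c01 v01 Psih rd) => //.
  exact: (gl_le1 alpha_gt1 c01 u01 Phih).
have o2 : orbit_within c 1 gr a (gl c).
  apply: (right_orbit_within alpha_gt1 c01 v01 Psih rd).
    by apply: (increasing_onW gli); lra.
  by apply: (gl_le1 alpha_gt1 c01 u01 Phih); lra.
have o3 := orbit_c alpha_gt1 c01 u01 v01 Phih Psih rd.
have o4 := orbit_q alpha_gt1 c01 u01 v01 Phih Psih rd.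
exists (Branches ((c - p) / (q - p)) u' v' A' phi' B' psi'); split => //.
split => //=.
- apply: (crx_ext lE); apply: crx_rescale => //; rewrite ?pE ?cE.
  + by apply: increasing_on_sub gli; lra.
  + by apply: crx_sub (tame_cl tbr); lra.
  + exact: iter_increasing gri o1 o2.
  + exact: iter_crx gri (tame_cr tbr) o1 o2.
- apply: (crx_ext rE); apply: crx_rescale => //; rewrite ?qE ?cE.
  + by apply: increasing_on_sub gri; lra.
  + by apply: crx_sub (tame_cr tbr); lra.
  + exact: iter_increasing gli o3 o4.
  + exact: iter_crx gli (tame_cl tbr) o3 o4.
Qed.

End Renorm.
End Renormalization.

(** * Inequalities for fixed points and for the recursion of eps *)

Section RatioArithmetic.
Variable R : realType.

(** As [x < F (1 - Y)], it is enough that [F (1 - Y) <= G]. Where [E ^ 2 * s <= 1] the drop from [F]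
    is at most [F * Y]. Elsewhere convexity of the power law gives
    [al * s * F (1 - Y) <= E ^ 2 * G], and [E ^ 4 <= al] absorbs the errors. *)
Fact left_branch_gt_arith (al c E F u Y s G x : R) :
  0 < c -> c < F -> 0 < x -> x = c * (1 - Y) -> 0 <= Y -> 0 <= s -> 1 <= E ->
  E ^+ 4 <= al -> u * (1 - Y * s) <= E * G -> F <= E * u ->
  F - G <= E ^+ 2 * F * (Y * s) -> al * s * (1 - Y) <= 1 - Y * s -> x < G.
Proof.
move=> c0 cF x0 xE Y0 s0 E1 E4 A B D C.
have Y1 : 0 < 1 - Y by rewrite -(pmulr_rgt0 _ c0) -xE.
have F0 : 0 < F by exact: lt_trans cF.
have E0 : 0 <= E by exact: le_trans E1.
have al0 : 0 < al by apply: lt_le_trans E4; rewrite exprn_gt0// (lt_le_trans _ E1).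
apply: (@lt_le_trans _ _ (F * (1 - Y))); first by rewrite xE ltr_pM2r.
have [h|h] := leP (E ^+ 2 * s) 1.
  have : F * Y * (E ^+ 2 * s) <= F * Y * 1 by apply: ler_wpM2l => //; rewrite mulr_ge0// ltW.
  by lra.
have Ys : 0 <= 1 - Y * s by apply: le_trans C; rewrite !mulr_ge0// ltW.
have H1 : F * (1 - Y * s) <= E * u * (1 - Y * s) by exact: ler_wpM2r.
have H2 : E * (u * (1 - Y * s)) <= E * (E * G) by exact: ler_wpM2l.
have H3 : F * (al * s * (1 - Y)) <= E ^+ 2 * G.
  by have := ler_wpM2l (ltW F0) C; rewrite expr2; lra.
have H4 := ler_wpM2l (sqr_ge0 E) H3.
have G0 : 0 <= G.
  rewrite leNgt; apply/negP => Gn.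
  have : 0 <= F * (al * s * (1 - Y)) by rewrite !mulr_ge0// ltW.
  have : E ^+ 2 * G < 0 by rewrite pmulr_rlt0// exprn_gt0// (lt_le_trans _ E1).
  by lra.
have H5 := ler_wpM2r G0 E4.
have H6 : al * (F * (1 - Y)) * 1 <= al * (F * (1 - Y)) * (E ^+ 2 * s).
  by apply: ler_wpM2l; [rewrite !mulr_ge0// ltW|exact: ltW].
rewrite -(ler_pM2l al0); apply: (le_trans _ H5).
have E4E : E ^+ 4 = E ^+ 2 * E ^+ 2 by rewrite -exprD.
move: H4 H6; rewrite E4E.
by move: (E ^+ 2) => e2; lra.
Qed.

Fact right_branch_lt_arith (c E v G g x : R) :
  x < 1 -> 0 < 1 - c -> 1 - c <= 64^-1 -> 1 <= E -> E <= 2 ->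
  v * (1 - x) <= E * (1 - c) * (1 - g) -> 1 - G <= E * v -> G <= 2^-1 -> g < x.
Proof.
move=> x1 c0 c64 E1 E2 A B h.
have v0 : 0 <= v.
    have E0 : 0 < E by lra.
  by rewrite leNgt -(pmulr_rlt0 _ E0) -leNgt; lra.
have v4 : 4^-1 <= v by have := ler_wpM2r v0 E2; lra.
have H1 := ler_wpM2r (ltW (_ : 0 < 1 - x)) v4.
have {}H1 : 4^-1 * (1 - x) <= v * (1 - x) by apply: H1; lra.
have Ec : 0 < E * (1 - c) by rewrite mulr_gt0//; lra.
have g1 : 0 < 1 - g by rewrite -(pmulr_rgt0 _ Ec); lra.
have Ec' : E * (1 - c) <= 2 * 64^-1 by apply: ler_pM; lra.
by have := ler_wpM2r (ltW g1) Ec'; lra.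
Qed.

Fact next_ratio_le_arith (TT Ae ea qp Gl K Y Gr X e rr cc two : R) :
  TT * Ae * (ea * (qp * Gl)) <= K * (Y * (qp * (1 - Gr))) ->
  X * (Ae * ea) = e -> rr * cc * Y = e * TT ->
  0 < qp -> 0 < X -> 0 < Y -> 1 <= cc * two -> 0 <= rr -> 0 <= two -> 0 <= Gl ->
  rr * Gl <= K * two * (X * (1 - Gr)).
Proof.
move=> A e1 e2 qp0 X0 Y0 c2 r0 t0 G0.
have A1 : TT * Ae * ea * Gl <= K * Y * (1 - Gr) by rewrite -(ler_pM2l qp0); lra.
have A2 := ler_wpM2l (ltW X0) A1.
have A3 : rr * cc * Y * Gl <= X * (K * Y * (1 - Gr)).
  by rewrite e2 -e1; lra.
have A4 : rr * cc * Gl <= X * K * (1 - Gr) by rewrite -(ler_pM2l Y0); lra.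
have A5 := ler_wpM2l t0 A4.
have A6 := ler_wpM2l (mulr_ge0 r0 G0) c2.
lra.
Qed.

Fact next_ratio_ge_arith (TT Ae ea qp Gl K Y Gr X e rr cc : R) :
  Y * (qp * (1 - Gr)) <= K * (TT * Ae * (ea * (qp * Gl))) ->
  X * (Ae * ea) = e -> rr * cc * Y = e * TT ->
  0 < qp -> 0 < X -> 0 < Y -> cc <= 1 -> 0 <= rr -> 0 <= Gl -> 0 <= K ->
  X * (1 - Gr) <= K * (rr * Gl).
Proof.
move=> A e1 e2 qp0 X0 Y0 c1 r0 G0 K0.
have A1 : Y * (1 - Gr) <= K * (TT * Ae * ea * Gl) by rewrite -(ler_pM2l qp0); lra.
have A2 := ler_wpM2l (ltW X0) A1.
have A3 : X * (Y * (1 - Gr)) <= K * (rr * cc * Y * Gl) by rewrite e2 -e1; lra.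
have A4 : X * (1 - Gr) <= K * (rr * cc * Gl) by rewrite -(ler_pM2l Y0); lra.
have A5 := ler_wpM2l (mulr_ge0 (mulr_ge0 K0 r0) G0) c1.
lra.
Qed.

End RatioArithmetic.

(** * Invariance of the bounds on eps under renormalization *)

Section Invariance.
Variables (R : realType) (alpha sigma beta : R).
Hypothesis alpha_gt1 : 1 < alpha.
Hypothesis sigma01 : 0 < sigma < 1.
Hypothesis beta_pos : 0 < beta < (sigma / alpha) ^+ 2.

Let K6 : R := 128 * return_constant alpha.

(** The second summand is the constant in [next_eps_le]; the first makes the sum exceed 1. *)
Definition scale_bound : R := 1 + (2 `^ (1 + alpha) * K6) `^ alpha^-1.
Local Notation theta := scale_bound.

Definition delta_of (b0 : nat) : R := (1 / b0%:R) ^+ 2.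
Definition distortion_of (b0 : nat) : R := (1 + delta_of b0) * expR (delta_of b0).
Definition eps_min (b0 : nat) : R := alpha `^ (- (b0%:R / alpha)).
Definition eps_max (b0 : nat) : R := theta * alpha `^ (- (b0%:R * sigma / alpha ^+ 2)).
(** The left side of the smallness condition in [critical_value_le_half], made uniform over
    [b0 <= b <= 2 * b0]. *)
Definition superexp (b0 : nat) : R :=
  (4 * alpha) ^+ (2 * b0) * 2 *
    (4 * 2^-1 `^ (((1 + alpha) / 2) ^+ b0.-1)) `^ (alpha - 1).

(** All the conditions on [b0]. Most of them compare [delta_of], polynomial in [b0], with
    exponential bounds on [eps], or these with [superexp], which decays doubly exponentially. *)
Record large (b0 : nat) : Prop := {
  large_2 : (2 <= b0)%N;
  large_delta : delta_of b0 <= 1 / 16;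
  large_E : distortion_of b0 ^+ (8 * b0) <= 2;
  large_E2 : distortion_of b0 ^+ 2 * 2^-1 `^ ((alpha - 1) / 2) <= 1;
  large_E4 : distortion_of b0 ^+ 4 <= alpha;
  large_max : eps_max b0 <= delta_of b0 / 4;
  large_sigma : 4 * 8 `^ (2 * alpha) * eps_max b0 `^ sigma * 4 `^ alpha <=
    delta_of b0 `^ alpha;
  large_inv : eps_max b0 `^ (1 - alpha^-1) <= delta_of b0 * 16^-1 `^ alpha^-1;
  large_min : 24 * alpha / (alpha ^+ b0 * eps_min b0) <= (delta_of b0 / 4) `^ alpha;
  large_super : superexp b0 < eps_min b0 `^ alpha;
  large_super' : superexp b0 <
    (alpha `^ (- (2 * b0)%:R) / (K6 * 2 `^ alpha)) `^ (alpha / (alpha - 1));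
  large_half : K6 * 2 `^ alpha * alpha `^ (- (b0%:R * sigma / alpha)) < 2^-1;
  large_beta : theta `^ sigma * (K6 * 2 `^ (alpha + 1)) <= alpha `^ (beta * b0%:R) }.

Definition combinatorics_bound (b0 a b : nat) :=
  alpha + sigma <= a%:R + 1 <= 2 * alpha - sigma /\
  (b0 <= b)%N /\ b%:R <= (1 + (sigma / alpha) ^+ 2 - beta) * b0%:R.

Let a0 : 0 < alpha. Proof. exact: lt_trans ltr01 _. Qed.
Let an0 : alpha != 0. Proof. exact: lt0r_neq0. Qed.
Let am0 : alpha - 1 != 0. Proof. by rewrite gt_eqF// subr_gt0. Qed.

Lemma return_constant_ge8 : 8 <= return_constant alpha.
Proof.
have al1 := alpha_gt1.
rewrite /return_constant ler_peMr//.
have h0 : 0 < (2^-1 : R) `^ (alpha - 1) by rewrite powR_gt0 ?invr_gt0.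
have h1 : (2^-1 : R) `^ (alpha - 1) <= 1.
  have := @ler_powRr R (alpha - 1) 2^-1 1 ltac:(lra) ltac:(lra) ltac:(lra).
  by rewrite powR1.
have k : 1 <= 16 * alpha / 2^-1 `^ (alpha - 1) by rewrite ler_pdivlMr//; lra.
have := @ler_powRr R (2 * alpha) 1 (16 * alpha / 2^-1 `^ (alpha - 1)) ltac:(lra) ltac:(lra) k.
by rewrite powR1.
Qed.

Let K6_gt0 : 0 < K6.
Proof. by rewrite mulr_gt0// (lt_le_trans _ return_constant_ge8). Qed.

Lemma b_le2 b0 a b : combinatorics_bound b0 a b -> (b <= 2 * b0)%N.
Proof.
move=> [_ [_ bb]]; rewrite -(ler_nat R) natrM; apply: (le_trans bb).
apply: ler_wpM2r; first exact: ler0n.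
have al1 := alpha_gt1; have ss := sigma01; have be := beta_pos.
have sa0 : 0 <= sigma / alpha by rewrite divr_ge0; lra.
have sa1 : sigma / alpha <= 1 by rewrite ler_pdivrMr; lra.
have : (sigma / alpha) ^+ 2 <= 1 by exact: exprn_ile1.
lra.
Qed.

Lemma delta_gt0 b0 : large b0 -> 0 < delta_of b0.
Proof.
by move=> L; rewrite exprn_gt0// divr_gt0// ltr0n (leq_trans _ (large_2 L)).
Qed.

Lemma distortion_ge b0 : large b0 -> 1 + delta_of b0 <= distortion_of b0.
Proof.
move=> L; have t0 := delta_gt0 L.
rewrite ler_peMr ?addr_ge0 ?(ltW t0)//.
by rewrite -expR0 ler_expR ltW.
Qed.

Lemma distortion_ge1 b0 : large b0 -> 1 <= distortion_of b0.
Proof.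
by move=> L; apply: le_trans (distortion_ge L); rewrite lerDl ltW// delta_gt0.
Qed.

Lemma distortion_le2 b0 : large b0 -> distortion_of b0 <= 2.
Proof.
move=> L; apply: le_trans (large_E L); rewrite -[leLHS]expr1.
by apply: ler_weXn2l; [exact: distortion_ge1|rewrite muln_gt0 (leq_trans _ (large_2 L))].
Qed.

Section CriticalValue.
Variables (b0 a b : nat) (br : branches R) (p q : R).
Hypothesis L : large b0.
Local Notation t := (delta_of b0).
Local Notation E := (distortion_of b0).
Local Notation c := (bc br).
Local Notation gl := (lbr alpha br).
Local Notation gr := (rbr alpha br).
Local Notation Y := (left_coord c).
Local Notation T := (right_coord c).
Hypothesis tbr : tame alpha (1 + t) (expR t) br.
Hypothesis ab : combinatorics_bound b0 a b.
Hypothesis rd : renorm_data gl gr c a b p q.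

Let c01 := tame_c tbr.
Let u01 := tame_u tbr.
Let v01 := tame_v tbr.
Let Phih := tame_factor_homeo (tame_l tbr).
Let Psih := tame_factor_homeo (tame_r tbr).
Let t0 : 0 < t := delta_gt0 L.
Let K1 : 1 <= 1 + t. Proof. by rewrite lerDl ltW. Qed.
Let D1 : 1 <= expR t. Proof. by rewrite -expR0 ler_expR ltW. Qed.
Let tE : 1 + t <= E := distortion_ge L.
Let E1 : 1 <= E := distortion_ge1 L.
Let E2 : E <= 2 := distortion_le2 L.
Let Phib : bilipschitz01 E (fun x => bA br (bphi br x)).
Proof.
exact: (tame_factor_bilipschitz (le_trans ler01 K1) (le_trans ler01 D1) (tame_l tbr)).
Qed.
Let Psib : bilipschitz01 E (fun x => bB br (bpsi br x)).
Proof.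
exact: (tame_factor_bilipschitz (le_trans ler01 K1) (le_trans ler01 D1) (tame_r tbr)).
Qed.
Let b0b : (b0 <= b)%N. Proof. by case: ab => _ []. Qed.

Lemma superexp_bound :
  (4 * alpha) ^+ b * 2 * (4 * 2^-1 `^ (((1 + alpha) / 2) ^+ b.-1)) `^ (alpha - 1)
  <= superexp b0.
Proof.
have al1 := alpha_gt1.
rewrite /superexp; apply: ler_pM.
- by rewrite mulr_ge0// exprn_ge0//; lra.
- exact: powR_ge0.
- by apply: ler_wpM2r => //; apply: ler_weXn2l; [lra|exact: b_le2 ab].
- apply: ler_powRr; [lra|by rewrite mulr_ge0// powR_ge0|].
  apply: ler_wpM2l => //; apply: ger_powR; first lra.
  by apply: ler_weXn2l; [lra|rewrite -!subn1; exact: leq_sub2r].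
Qed.

(** The lower bound [m] is left open because two are used: [eps_min] at a level already controlled,
    and a cruder one in [next_half]. *)
Lemma half_of_lower (m : R) : superexp b0 < m -> m <= (1 - c) `^ alpha ->
  gr c <= 2^-1.
Proof.
move=> sm mc.
apply: (critical_value_le_half alpha_gt1 c01 u01 v01 E1 Phih Phib Psih Psib rd E2 (large_E2 L)).
by apply: le_lt_trans superexp_bound _; exact: lt_le_trans mc.
Qed.

End CriticalValue.

Section Step.
Variables (b0 a b : nat) (br : branches R) (p q : R).
Hypothesis L : large b0.
Local Notation t := (delta_of b0).
Local Notation E := (distortion_of b0).
Local Notation c := (bc br).
Local Notation gl := (lbr alpha br).
Local Notation gr := (rbr alpha br).
Local Notation Y := (left_coord c).
Local Notation T := (right_coord c).
Hypothesis tbr : tame alpha (1 + t) (expR t) br.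
Hypothesis ab : combinatorics_bound b0 a b.
Hypothesis rd : renorm_data gl gr c a b p q.

Let c01 := tame_c tbr.
Let u01 := tame_u tbr.
Let v01 := tame_v tbr.
Let Phih := tame_factor_homeo (tame_l tbr).
Let Psih := tame_factor_homeo (tame_r tbr).
Let t0 : 0 < t := delta_gt0 L.
Let K1 : 1 <= 1 + t. Proof. by rewrite lerDl ltW. Qed.
Let D1 : 1 <= expR t. Proof. by rewrite -expR0 ler_expR ltW. Qed.
Let tE : 1 + t <= E := distortion_ge L.
Let E1 : 1 <= E := distortion_ge1 L.
Let E2 : E <= 2 := distortion_le2 L.
Let Phib : bilipschitz01 E (fun x => bA br (bphi br x)).
Proof.
exact: (tame_factor_bilipschitz (le_trans ler01 K1) (le_trans ler01 D1) (tame_l tbr)).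
Qed.
Let Psib : bilipschitz01 E (fun x => bB br (bpsi br x)).
Proof.
exact: (tame_factor_bilipschitz (le_trans ler01 K1) (le_trans ler01 D1) (tame_r tbr)).
Qed.
Let b0b : (b0 <= b)%N. Proof. by case: ab => _ []. Qed.

Hypothesis eps_ge : eps_min b0 <= 1 - c.
Hypothesis eps_le : 1 - c <= eps_max b0.

Let half : gr c <= 2^-1.
Proof.
apply: (half_of_lower L tbr ab rd (large_super L)); apply: ler_powRr => //; first exact: ltW.
exact: powR_ge0.
Qed.

Let e0 : 0 < 1 - c. Proof. by case/andP: c01; rewrite subr_gt0. Qed.

Let sigma_cond : 4 * 8 `^ (2 * alpha) * (1 - c) `^ sigma * 4 `^ alpha <= t `^ alpha.
Proof.
apply: le_trans (large_sigma L); apply: ler_wpM2r; first exact: powR_ge0.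
apply: ler_wpM2l; first by rewrite mulr_ge0 ?powR_ge0.
by apply: ler_powRr => //; [case/andP: sigma01 => /ltW|exact: ltW].
Qed.

Let b_cond : 24 * alpha / (alpha ^+ b * (1 - c)) <= (t / 4) `^ alpha.
Proof.
apply: le_trans (large_min L); have al1 := alpha_gt1.
have m0 : 0 < eps_min b0 by apply: powR_gt0.
apply: ler_wpM2l; first by rewrite mulr_ge0// ltW.
rewrite lef_pV2 ?posrE ?mulr_gt0 ?exprn_gt0//.
apply: ler_pM => //; [exact/exprn_ge0/ltW | exact: ltW |].
by apply: ler_weXn2l; [exact: ltW|].
Qed.

Let inv_cond : 1 - c <= t * ((1 - c) / 16) `^ alpha^-1.
Proof.
have al1 := alpha_gt1.
have ai : 0 < alpha^-1 by rewrite invr_gt0.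
have ai1 : alpha^-1 < 1 by rewrite invf_lt1.
have eE : 1 - c = (1 - c) `^ alpha^-1 * (1 - c) `^ (1 - alpha^-1).
  rewrite -powRD; last by apply/implyP => _; rewrite gt_eqF.
  have -> : alpha^-1 + (1 - alpha^-1) = 1 by ring.
  by rewrite powRr1// ltW.
have -> : t * ((1 - c) / 16) `^ alpha^-1 = (1 - c) `^ alpha^-1 * (t * 16^-1 `^ alpha^-1).
  by rewrite powRM ?invr_ge0// 1?ltW// mulrCA.
apply: (@le_trans _ _ ((1 - c) `^ alpha^-1 * (1 - c) `^ (1 - alpha^-1))).
  by rewrite -eE.
apply: ler_wpM2l; first exact: powR_ge0.
apply: le_trans (large_inv L); apply: ler_powRr => //; [by rewrite subr_ge0 ltW|exact: ltW].
Qed.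

Let a_cond : alpha + sigma <= a%:R + 1 <= 2 * alpha.
Proof. by have [H _] := ab; have ss := sigma01; lra. Qed.
Let b2 : (2 <= b)%N. Proof. exact: leq_trans (large_2 L) b0b. Qed.
Let E4b : E ^+ (4 * b) <= 2.
Proof.
apply: le_trans (large_E L); apply: ler_weXn2l => //.
by rewrite (_ : 8 = 4 * 2)%N// -mulnA leq_mul2l; exact: b_le2 ab.
Qed.
Let t01 : 0 < t <= 1 / 16. Proof. by rewrite t0/=; exact: large_delta. Qed.
Let eps_t : 1 - c <= t / 4. Proof. exact: le_trans eps_le (large_max L). Qed.

Let al1 := alpha_gt1.
Let Yp_le := coord_p_le al1 c01 u01 v01 E1 Phih Phib Psih Psib rd
  sigma01 a_cond b2 E4b t01 sigma_cond half.
Let q_c_le := q_le al1 c01 u01 v01 E1 Phih Phib Psih Psib rd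
  sigma01 a_cond b2 E4b t01 eps_t sigma_cond b_cond half.
Let gr_q_le := gr_q_le64 al1 c01 u01 v01 E1 Phih Phib Psih Psib rd
  sigma01 a_cond b2 E4b t01 eps_t sigma_cond b_cond half.
Let Phi_ge := Phi_u_ge al1 c01 u01 v01 E1 Phih Phib Psih Psib rd
  sigma01 a_cond b2 E4b t01 eps_t sigma_cond half.
Let ratio_le := return_ratio_le al1 c01 u01 v01 E1 Phih Phib Psih Psib rd
  sigma01 a_cond b2 E4b t01 eps_t sigma_cond b_cond half.
Let ratio_ge := return_ratio_ge al1 c01 u01 v01 E1 Phih Phib Psih Psib rd
  sigma01 a_cond b2 E4b t01 tE eps_t sigma_cond b_cond inv_cond half.

(** It lets the avoiding set near 0 be exhausted by pulling back under the left branch. *)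
Lemma left_branch_gt x : 0 < x <= p -> x < gl x.
Proof.
have pc := rd_p rd; have cc := c01; have e := e0; have uu := u01 => xr.
have xc : 0 <= x <= c by lra.
have /andP[Y0 Y1] := left_Y c01 xc.
have F1 : c < bA br (bphi br (bu br)) by have := Phi_ge; lra.
have xE : x = c * (1 - Y x) by rewrite /left_coord; field; lra.
have /andP[q0 qu] := left_Q01 al1 c01 u01 xc.
have [_ P0 _] := Phih.
have [A _] := Phib (lexx 0) q0 (le_trans qu (proj2 (andP uu))).
have [_ B] := Phib (lexx 0) (ltW (proj1 (andP uu))) (proj2 (andP uu)).
rewrite P0 !subr0 in A B.
have D := left_drop alpha_gt1 c01 u01 E1 Phih Phib xc.
have {}A : bu br * (1 - Y x `^ alpha) <= E * gl x := A.
rewrite -/(lbr alpha br x) in D.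
have yE : Y x `^ alpha = Y x * Y x `^ (alpha - 1) by rewrite -powR_mulB1.
have /andP[C _] := powRB_bounds alpha_gt1 Y0 Y1.
rewrite powR1 yE in C; rewrite yE in D A.
apply: (left_branch_gt_arith _ F1 (proj1 (andP xr)) xE Y0 (powR_ge0 _ _) E1 (large_E4 L) A B D C).
by case/andP: cc.
Qed.

Lemma right_branch_lt x : c <= x < 1 -> gr x < x.
Proof.
have cc := c01; have t1 := t01; have e4 := eps_t => xr.
have A := right_gap alpha_gt1 c01 v01 E1 Psih Psib (x := x) ltac:(lra).
have B := right_drop alpha_gt1 c01 v01 Psih Psib.
by apply: (right_branch_lt_arith _ e0 _ E1 E2 A B half); lra.
Qed.

Lemma p_gap_le : c - p <= t / 4 * (1 - c).
Proof.
have pc := rd_p rd; have cc := c01.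
have -> : c - p = c * Y p by rewrite /left_coord; field; lra.
have Y0 : 0 <= Y p by rewrite divr_ge0; lra.
by apply: le_trans Yp_le; rewrite ler_piMl//; lra.
Qed.

Lemma return_interval_le : q - p <= t * ((1 - c) / 2).
Proof. by have A := p_gap_le; have B := q_c_le; lra. Qed.

Lemma return_interval_half : q - p <= 2^-1.
Proof.
have A := return_interval_le; have tt := t01; have et := eps_t; have ee := e0.
have : t * ((1 - c) / 2) <= 1 * ((1 - c) / 2) by apply: ler_wpM2r; lra.
lra.
Qed.

(** The images of the extended branches exceed [[p, q]] by at least [(1 - c) / 2] on both sides, and
    [q - p] is at most [t] times this: Koebe's principle reproduces the constant [1 + t]. *)
Lemma step_renorm : exists br', [/\ tame alpha (1 + t) (expR t) br',
  bc br' = (c - p) / (q - p),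
  (forall x, 0 <= x <= bc br' ->
     lbr alpha br' x = (iter a gr (gl (p + (q - p) * x)) - p) / (q - p)) &
  (forall x, bc br' <= x <= 1 ->
     rbr alpha br' x = (iter b gl (gr (p + (q - p) * x)) - p) / (q - p))].
Proof.
have A := p_gap_le; have B := q_c_le; have C := gr_q_le; have D := Phi_ge.
have I := return_interval_le.
have G := gr_c_lt_gr_q al1 c01 v01 Psih rd.
have tt := t01; have et := eps_t; have ee := e0; have pc := rd_p rd; have qc := rd_q rd.
have glc : gl c = bA br (bphi br (bu br)) by rewrite /lbr left_atc.
have t4 : t / 4 * (1 - c) <= 1 / 4 * (1 - c) by apply: ler_wpM2r; lra.
have sp x : (1 - c) / 2 <= x -> q - p <= t * x.
  by move=> xe; apply: (le_trans I); apply: ler_wpM2l; lra.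
have GC : gr c <= 1 / 64 by apply: (le_trans (ltW G)); exact: C.
apply: (tame_renorm al1 K1 D1 _ tbr rd).
- by lra.
- by apply: sp; lra.
- by apply: sp; lra.
- by apply: sp; lra.
- by apply: sp; rewrite glc; lra.
Qed.

Section NextLevel.
Variables (br' : branches R) (a' b' : nat) (p' q' : R).
Hypothesis tbr' : tame alpha (1 + t) (expR t) br'.
Hypothesis bcE : bc br' = (c - p) / (q - p).
Hypothesis lbrE : forall x, 0 <= x <= bc br' ->
  lbr alpha br' x = (iter a gr (gl (p + (q - p) * x)) - p) / (q - p).
Hypothesis rbrE : forall x, bc br' <= x <= 1 ->
  rbr alpha br' x = (iter b gl (gr (p + (q - p) * x)) - p) / (q - p).
Hypothesis rd' : renorm_data (lbr alpha br') (rbr alpha br') (bc br') a' b' p' q'.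
Local Notation c' := (bc br').
Local Notation Gl := (lbr alpha br' c').
Local Notation Gr := (rbr alpha br' c').

Let qp0 : 0 < q - p.
Proof. by have pc := rd_p rd; have qc := rd_q rd; lra. Qed.

Let hc : p + (q - p) * c' = c.
Proof. by rewrite bcE; field; rewrite gt_eqF. Qed.

Let GlE : iter a gr (gl c) - p = (q - p) * Gl.
Proof.
have cc := tame_c tbr'; have cr : 0 <= c' <= c' by rewrite lexx andbT; lra.
rewrite lbrE// hc.
by rewrite mulrC divfK// gt_eqF.
Qed.

Let GrE : q - iter b gl (gr c) = (q - p) * (1 - Gr).
Proof.
have cc := tame_c tbr'; have cr : c' <= c' <= 1 by rewrite lexx /=; lra.
rewrite rbrE// hc.
by field; rewrite gt_eqF.
Qed.

Lemma next_Gl : c' < Gl <= 1.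
Proof.
have cc := tame_c tbr'; have uu := tame_u tbr'; have Ph := tame_factor_homeo (tame_l tbr').
have cr : 0 <= c' <= c' by rewrite lexx andbT ltW//; case/andP: cc.
have -> : Gl <= 1 by exact: (gl_le1 al1 cc uu Ph cr).
rewrite andbT; have H := gl_c_gt al1 cc uu Ph rd'; have /andP[qc _] := rd_q rd'.
by apply: (lt_trans qc); rewrite /lbr left_atc.
Qed.

Lemma next_Gr : Gr < c'.
Proof.
have cc := tame_c tbr'; have uu := tame_u tbr'; have vv := tame_v tbr'.
have Ph := tame_factor_homeo (tame_r tbr').
have A := gr_c_lt_gr_q al1 cc vv Ph rd'; have B := gr_q_lt_p rd'; have C := rd_p rd'.
by apply: (lt_trans A); apply: (lt_trans B); case/andP: C.
Qed.

(** The main term of [eps' ^ alpha] in the recursion, with [eps = 1 - c]. *)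
Definition growth_factor : R := (1 - c) `^ (alpha - (a%:R + 1)) * alpha `^ (- b%:R).
Local Notation r := ((1 - c') / c').

Let growth_eq : growth_factor * (alpha ^+ b * (1 - c) * (1 - c) ^+ a) = (1 - c) `^ alpha.
Proof.
have eA : (1 - c) `^ a%:R = (1 - c) ^+ a by rewrite powR_mulrn// ltW.
have eB : alpha `^ b%:R = alpha ^+ b by rewrite powR_mulrn// ltW.
have en : 1 - c != 0 by rewrite gt_eqF.
have P1 : alpha `^ (- b%:R) * alpha ^+ b = 1.
  by rewrite -eB -powRD ?addNr ?powRr0// an0 implybT.
have P2 : (1 - c) `^ (alpha - (a%:R + 1)) * ((1 - c) ^+ a * (1 - c)) = (1 - c) `^ alpha.
  rewrite -eA -[in X in _ * (_ * X)](@powRr1 _ (1 - c)) ?ltW// -!powRD ?en ?implybT//.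
  by congr (_ `^ _); ring.
rewrite -P2 /growth_factor.
transitivity ((1 - c) `^ (alpha - (a%:R + 1)) * ((1 - c) ^+ a * (1 - c)) *
  (alpha `^ (- b%:R) * alpha ^+ b)); first by ring.
by rewrite P1 mulr1.
Qed.

Let r_pow : r `^ alpha * c `^ alpha * Y p `^ alpha = (1 - c) `^ alpha * T q `^ alpha.
Proof.
have pc := rd_p rd; have qc := rd_q rd; have cc := c01.
have Y0 : 0 <= Y p by rewrite divr_ge0; lra.
have T0 : 0 <= T q by rewrite divr_ge0; lra.
have pn : 0 < c - p by lra.
have rE : r = (q - c) / (c - p) by rewrite bcE; field; rewrite !gt_eqF.
have r0 : 0 <= r by rewrite rE divr_ge0//; lra.
rewrite -!powRM//; try lra; last by rewrite mulr_ge0//; lra.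
congr (_ `^ _); rewrite rE /left_coord /right_coord; field.
by rewrite (gt_eqF pn) (gt_eqF e0) gt_eqF//; case/andP: cc.
Qed.

Let X0 : 0 < growth_factor. Proof. by rewrite mulr_gt0// powR_gt0. Qed.
Let Yp0 : 0 < Y p `^ alpha.
Proof. by have pc := rd_p rd; rewrite powR_gt0// divr_gt0; lra. Qed.

(** [r] equals [(q - c) / (c - p)], and [Gl] and [1 - Gr] are the return widths in units of [q - p]:
    this is [return_ratio_le] rescaled. *)
Lemma next_ratio_le : r `^ alpha * Gl <= K6 * 2 `^ alpha * (growth_factor * (1 - Gr)).
Proof.
have A := ratio_le; have e1 := growth_eq; have e2 := r_pow.
rewrite GlE GrE in A.
have /andP[G0 _] := next_Gl; have cc' := tame_c tbr'; have G1 : 0 <= Gl by lra.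
have c2 : 1 <= c `^ alpha * 2 `^ alpha.
  rewrite -powRM//; last by have := c01; lra.
  have := @ler_powRr R alpha 1 (c * 2) (ltW a0) ler01; rewrite powR1; apply.
  by have := eps_t; have := t01; lra.
have r0 := powR_ge0 r alpha; have z0 : 0 <= (2 : R) `^ alpha by exact: powR_ge0.
exact: (next_ratio_le_arith A e1 e2 qp0 X0 Yp0 c2 r0 z0 G1).
Qed.

Lemma next_ratio_ge : growth_factor * (1 - Gr) <= K6 * (r `^ alpha * Gl).
Proof.
have A := ratio_ge; have e1 := growth_eq; have e2 := r_pow.
rewrite GlE GrE in A.
have /andP[G0 _] := next_Gl; have cc' := tame_c tbr'; have G1 : 0 <= Gl by lra.
have c1 : c `^ alpha <= 1 by have /andP[] := pow01 al1 (ltW (proj1 (andP c01))) (ltW (proj2 (andP c01))).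
have r0 := powR_ge0 r alpha.
exact: (next_ratio_ge_arith A e1 e2 qp0 X0 Yp0 c1 r0 G1 (ltW K6_gt0)).
Qed.

Let ab_a : alpha + sigma <= a%:R + 1 <= 2 * alpha - sigma. Proof. by case: ab. Qed.
Let e1 : 1 - c <= 1. Proof. by have := c01; lra. Qed.

(** The exponent of [1 - c] is negative and at least [sigma - alpha], so the extreme case is
    [eps_min] with this exponent: [(b0 / alpha) (alpha - sigma) - b0 = - b0 sigma / alpha]. *)
Lemma growth_factor_le : growth_factor <= alpha `^ (- (b0%:R * sigma / alpha)).
Proof.
have aa := ab_a; have ss := sigma01.
have -> : - (b0%:R * sigma / alpha) = b0%:R / alpha * (alpha - sigma) + - b0%:R.
  by field; rewrite an0.
rewrite powRD; last by rewrite an0 implybT.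
apply: ler_pM; try exact: powR_ge0; last first.
  by apply: ler_powR; rewrite ?lerN2 ?ler_nat// ltW.
have m0 : 0 < eps_min b0 by apply: powR_gt0.
have nb : 0 <= b0%:R / alpha by rewrite divr_ge0 ?ler0n// ltW.
apply: (@le_trans _ _ (eps_min b0 `^ (alpha - (a%:R + 1)))).
  rewrite -(opprK (alpha - _)) !(powRN _ (- _)) lef_pV2 ?posrE ?powR_gt0//.
  apply: ler_powRr => //; [by lra|exact: ltW].
rewrite -powRrM; apply: ler_powR; first exact: ltW.
rewrite mulNr -mulrN; apply: ler_wpM2l => //; lra.
Qed.

Lemma growth_factor_ge_rough : alpha `^ (- (2 * b0)%:R) <= growth_factor.
Proof.
have aa := ab_a; have ss := sigma01.
rewrite -[leLHS]mul1r; apply: ler_pM => //; first exact: powR_ge0.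
  rewrite -[leLHS](powRr0 (1 - c)); apply: ger_powR; first by rewrite e0 e1.
  by lra.
by apply: ler_powR; rewrite ?(ltW al1)// lerN2 ler_nat; exact: b_le2 ab.
Qed.

(** The extreme case is [eps_max] with exponent [- sigma] and the largest [b]. The factor
    [scale_bound ^ sigma] cancels that of [eps_max], and the term [(sigma / alpha) ^ 2] in the bound
    on [b] is matched exactly, leaving the margin [beta]. *)
Lemma growth_factor_ge :
  alpha `^ (beta * b0%:R) * alpha `^ (- b0%:R) <= scale_bound `^ sigma * growth_factor.
Proof.
have aa := ab_a; have ss := sigma01; have [_ [_ bb]] := ab.
have th0 : 0 < theta.
  by rewrite /theta ltr_wpDr ?powR_ge0.
have ep0 : 0 < eps_max b0 by rewrite mulr_gt0 ?powR_gt0.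
have H1 : eps_max b0 `^ (- sigma) <= (1 - c) `^ (alpha - (a%:R + 1)).
  apply: (@le_trans _ _ ((1 - c) `^ (- sigma))).
    rewrite !powRN lef_pV2 ?posrE ?powR_gt0//.
    by apply: ler_powRr => //; [lra|exact: ltW].
  by apply: ger_powR; [rewrite e0 e1|lra].
have s2 : (sigma / alpha) ^+ 2 = sigma * sigma / alpha ^+ 2 by field; rewrite an0.
have H2 : alpha `^ (- ((1 + (sigma / alpha) ^+ 2 - beta) * b0%:R)) <= alpha `^ (- b%:R).
  by apply: ler_powR; rewrite ?(ltW al1)// lerN2.
have H3 : scale_bound `^ sigma * eps_max b0 `^ (- sigma) =
    alpha `^ (b0%:R * sigma / alpha ^+ 2 * sigma).
  rewrite /eps_max powRM ?powR_ge0 ?(ltW th0)// mulrA -powRD; last first.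
    by rewrite (gt_eqF th0) implybT.
  by rewrite subrr powRr0 mul1r -powRrM mulrNN.
have H4 : alpha `^ (beta * b0%:R) * alpha `^ (- b0%:R) =
   alpha `^ (b0%:R * sigma / alpha ^+ 2 * sigma) *
     alpha `^ (- ((1 + (sigma / alpha) ^+ 2 - beta) * b0%:R)).
  rewrite -!powRD ?an0 ?implybT//; congr (_ `^ _).
  by rewrite s2; field; rewrite an0.
rewrite H4 -H3 -mulrA; apply: ler_wpM2l; first exact: powR_ge0.
by apply: ler_pM => //; exact: powR_ge0.
Qed.

Hypothesis ab' : combinatorics_bound b0 a' b'.

(** If [c' <= 1/2] then [r >= 1], and as [Gl > c'] the product [r ^ alpha * Gl] is at least
    [1 - c' >= 1/2], against [large_half]. The bound [Gl > c'] comes from the renormalization data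
    of the next map. *)
Lemma next_c_gt_half : 2^-1 < c'.
Proof.
rewrite ltNge; apply/negP => ch.
have cc' := tame_c tbr'; have /andP[G0 G1] := next_Gl; have Gr1 := next_Gr.
have r1 : 1 <= r by rewrite ler_pdivlMr; lra.
have rr : r <= r `^ alpha by apply: le1r_powR => //; exact: ltW.
have rG : 2^-1 <= r `^ alpha * Gl.
  have : r * c' <= r `^ alpha * Gl by apply: ler_pM; lra.
  have -> : r * c' = 1 - c' by rewrite divfK// gt_eqF//; case/andP: cc'.
  lra.
have A := next_ratio_le; have B := growth_factor_le; have C := large_half L.
have Gr0 : 0 <= Gr.
  apply: (gr_ge0 al1 cc' (tame_v tbr') (tame_factor_homeo (tame_r tbr'))).
  by rewrite lexx /= ltW//; case/andP: cc'.
have k0 : 0 <= K6 * 2 `^ alpha by rewrite mulr_ge0 ?powR_ge0// ltW.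
have D := ler_wpM2l k0 B.
have F : growth_factor * (1 - Gr) <= growth_factor by rewrite ler_piMr; have := X0; lra.
have := ler_wpM2l k0 F; lra.
Qed.

(** As [Gl > 1/2] and [1 - Gr <= 1], [next_ratio_le] bounds [(1 - c') ^ alpha] by a constant times
    the bound in [growth_factor_le]; [scale_bound] contains the root of this constant. *)
Lemma next_eps_le : 1 - c' <= eps_max b0.
Proof.
have ch := next_c_gt_half; have cc' := tame_c tbr'; have /andP[G0 G1] := next_Gl.
have Gr0 : 0 <= Gr.
  apply: (gr_ge0 al1 cc' (tame_v tbr') (tame_factor_homeo (tame_r tbr'))).
  by rewrite lexx /= ltW//; case/andP: cc'.
have A := next_ratio_le; have B := growth_factor_le.
have er : 1 - c' <= r by rewrite ler_pdivlMr ?ler_piMr; lra.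
have ea : (1 - c') `^ alpha <= r `^ alpha by apply: ler_powRr; rewrite ?(ltW a0)//; lra.
have k0 : 0 <= K6 * 2 `^ alpha by rewrite mulr_ge0 ?powR_ge0// ltW.
have F : growth_factor * (1 - Gr) <= growth_factor by rewrite ler_piMr; have := X0; lra.
have F2 := ler_wpM2l k0 F; have F3 := ler_wpM2l k0 B.
have r0 := powR_ge0 r alpha.
have F4 := ler_wpM2l r0 (ltW (lt_trans ch G0)).
have two : (2 : R) `^ (1 + alpha) = 2 * 2 `^ alpha.
  by rewrite powRD ?powRr1// pnatr_eq0 implybT.
have H : (1 - c') `^ alpha <=
    2 `^ (1 + alpha) * K6 * alpha `^ (- (b0%:R * sigma / alpha)) by rewrite two; lra.
have e'0 : 0 <= 1 - c' by lra.
have -> : 1 - c' = ((1 - c') `^ alpha) `^ alpha^-1 by rewrite -powRrM mulfV ?powRr1.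
apply: (@le_trans _ _ ((2 `^ (1 + alpha) * K6 * alpha `^ (- (b0%:R * sigma / alpha))) `^ alpha^-1)).
  by apply: ler_powRr; rewrite ?invr_ge0 ?powR_ge0 ?(ltW a0).
rewrite powRM ?mulr_ge0 ?powR_ge0 ?(ltW K6_gt0)//.
rewrite -powRrM /eps_max /scale_bound.
have -> : - (b0%:R * sigma / alpha) / alpha = - (b0%:R * sigma / alpha ^+ 2).
  by field; rewrite an0.
by apply: ler_wpM2r; [exact: powR_ge0|rewrite lerDr].
Qed.

Let r_le : r `^ alpha * Gl <= 2 `^ alpha * (1 - c') `^ alpha.
Proof.
have ch := next_c_gt_half; have cc' := tame_c tbr'; have /andP[G0 G1] := next_Gl.
have e'0 : 0 <= 1 - c' by lra.
rewrite -powRM//; apply: (@le_trans _ _ (r `^ alpha)).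
  by rewrite ler_piMr ?powR_ge0.
apply: ler_powRr; first exact: ltW.
  by rewrite divr_ge0//; lra.
rewrite ler_pdivrMr; last by lra.
have : (1 - c') * 2^-1 <= (1 - c') * c' by apply: ler_wpM2l; lra.
lra.
Qed.

(** The sharp bound on [1 - c'] relies on this one, so a crude bound is derived first: [Gr < c']
    bounds [1 - Gr] below by [1 - c'], and one power of [1 - c'] cancels in [next_ratio_ge]. *)
Lemma next_half : Gr <= 2^-1.
Proof.
have ch := next_c_gt_half; have cc' := tame_c tbr'; have Gr1 := next_Gr.
have e'0 : 0 < 1 - c' by lra.
apply: (half_of_lower L tbr' ab' rd' (large_super' L)).
have A := next_ratio_ge; have B := growth_factor_ge_rough; have C := r_le.
have k0 : 0 < K6 * 2 `^ alpha by rewrite mulr_gt0 ?powR_gt0.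
have D : alpha `^ (- (2 * b0)%:R) / (K6 * 2 `^ alpha) <= (1 - c') `^ (alpha - 1).
  rewrite ler_pdivrMr// -(ler_pM2r e'0).
  have F1 : growth_factor * (1 - c') <= growth_factor * (1 - Gr).
    by apply: ler_wpM2l; [exact: ltW|lra].
  have F2 := ler_wpM2l (ltW K6_gt0) C.
  have F3 := ler_wpM2r (ltW e'0) B.
  have F4 := powR_mulB1 al1 (ltW e'0).
  have F5 : (1 - c') `^ (alpha - 1) * (K6 * 2 `^ alpha) * (1 - c') =
     K6 * (2 `^ alpha * (1 - c') `^ alpha) by rewrite -F4; ring.
  by rewrite F5; lra.
have D0 : 0 <= alpha `^ (- (2 * b0)%:R) / (K6 * 2 `^ alpha).
  by rewrite divr_ge0 ?powR_ge0// ltW.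
have ex : 0 <= alpha / (alpha - 1) by rewrite divr_ge0// ?subr_ge0 ltW.
have := ler_powRr ex D0 D; rewrite -(powRrM (1 - c')).
by have -> : (alpha - 1) * (alpha / (alpha - 1)) = alpha by field; rewrite am0.
Qed.

(** Here [1 - Gr >= 1/2] by [next_half]. The remaining constants are absorbed by
    [alpha ^ (beta * b0)], by [large_beta]. *)
Lemma next_eps_ge : eps_min b0 <= 1 - c'.
Proof.
have ch := next_c_gt_half; have cc' := tame_c tbr'; have h := next_half.
have A := next_ratio_ge; have B := growth_factor_ge; have C := r_le.
have D := large_beta L.
have e'0 : 0 <= 1 - c' by lra.
have th0 : 0 <= scale_bound `^ sigma by exact: powR_ge0.
have al0 : 0 < alpha `^ (- b0%:R) by apply: powR_gt0.
have ba0 : 0 < alpha `^ (beta * b0%:R) by apply: powR_gt0.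
have F1 : growth_factor <= 2 * K6 * (2 `^ alpha * (1 - c') `^ alpha).
  have := ler_wpM2l (ltW K6_gt0) C.
  have := ler_wpM2l (ltW X0) h; lra.
have F2 := ler_wpM2l th0 F1.
have two : (2 : R) `^ (alpha + 1) = 2 * 2 `^ alpha.
  by rewrite addrC powRD ?powRr1// pnatr_eq0 implybT.
rewrite two in D.
have F3 := ler_wpM2r (powR_ge0 (1 - c') alpha) D.
have F4 : alpha `^ (- b0%:R) <= (1 - c') `^ alpha.
  by rewrite -(ler_pM2l ba0); lra.
have -> : 1 - c' = ((1 - c') `^ alpha) `^ alpha^-1 by rewrite -powRrM mulfV ?powRr1.
rewrite /eps_min -mulNr powRrM.
by apply: ler_powRr; rewrite ?invr_ge0 ?(ltW a0)// ltW.
Qed.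

End NextLevel.
End Step.
End Invariance.

(** * Large numbers of iterates *)

Section Asymptotics.
Variables (R : realType) (alpha sigma beta : R).
Hypothesis alpha_gt1 : 1 < alpha.
Hypothesis sigma01 : 0 < sigma < 1.
Hypothesis beta_pos : 0 < beta < (sigma / alpha) ^+ 2.

(** From [expR (m n) >= m n] raised to the power [k + 1], where [l = m (k + 1)]. *)
Lemma polynomial_le_expR k (C l : R) : 0 < l ->
  \forall n \near \oo, C * n%:R ^+ k <= expR (l * n%:R).
Proof.
move=> l0; pose m := l / k.+1%:R; have m0 : 0 < m by rewrite divr_gt0.
near=> n.
have n0 : 0 <= n%:R :> R by [].
have nC : C / m ^+ k.+1 <= n%:R by near: n; exact: nbhs_infty_ger.
have -> : l * n%:R = m * n%:R * k.+1%:R by rewrite /m mulrAC divfK// pnatr_eq0.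
rewrite expRM_natr.
apply: (@le_trans _ _ ((m * n%:R) ^+ k.+1)).
  rewrite exprMn (exprS n%:R) mulrA; apply: ler_wpM2r; first exact: exprn_ge0.
  by rewrite mulrC -ler_pdivrMr ?exprn_gt0.
apply: lerXn2r; rewrite ?nnegrE; [by rewrite mulr_ge0// ltW|exact: expR_ge0|].
by apply: (le_trans _ (expR_ge1Dx _)); rewrite lerDr.
Unshelve. all: by end_near. Qed.

Lemma delta_powR_ge (n k : nat) (s : R) : (0 < n)%N -> 2 * s <= k%:R ->
  (n%:R ^+ k)^-1 <= delta_of R n `^ s.
Proof.
move=> n0 sk; have nr : 1 <= n%:R :> R by rewrite ler1n.
have np : 0 < n%:R :> R by rewrite ltr0n.
have -> : delta_of R n = n%:R `^ (- 2).
  by rewrite /delta_of div1r exprVn -powR_invn ?ler0n//.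
rewrite -powRrM -powR_mulrn ?ler0n// -powRN; apply: ler_powR => //.
by rewrite mulNr lerN2.
Qed.

Lemma exp_decay_le_delta (A l s : R) : 0 < l ->
  \forall n \near \oo, A * expR (- (l * n%:R)) <= delta_of R n `^ s.
Proof.
move=> l0; pose k := (Num.truncn (2 * s)).+1.
have sk : 2 * s <= k%:R by rewrite ltW// truncnS_gt.
near=> n.
have n0 : (0 < n)%N by near: n; exact: nbhs_infty_gt.
have np : 0 < n%:R ^+ k :> R by rewrite exprn_gt0// ltr0n.
apply: le_trans (delta_powR_ge n0 sk).
rewrite expRN ler_pdivrMr ?expR_gt0// mulrC ler_pdivlMr//.
by near: n; exact: polynomial_le_expR.
Unshelve. all: by end_near. Qed.

Let a0 : 0 < alpha. Proof. exact: lt_trans ltr01 _. Qed.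
Let an0 : alpha != 0. Proof. exact: lt0r_neq0. Qed.
Let am0 : 0 < alpha - 1. Proof. by rewrite subr_gt0. Qed.
Let la0 : 0 < ln alpha. Proof. exact: ln_gt0. Qed.
Let aE x : alpha `^ x = expR (x * ln alpha).
Proof. by rewrite /powR (negPf an0). Qed.

Lemma delta_small (eta : R) : 0 < eta -> \forall n \near \oo, delta_of R n <= eta.
Proof.
move=> eta0; near=> n.
have n0 : (0 < n)%N by near: n; exact: nbhs_infty_gt.
have nr : 0 < n%:R :> R by rewrite ltr0n.
have n1 : 1 <= n%:R :> R by rewrite ler1n.
have ne : eta^-1 <= n%:R by near: n; exact: nbhs_infty_ger.
rewrite /delta_of div1r expr2; apply: (@le_trans _ _ n%:R^-1).
  by rewrite ler_piMr ?invr_ge0 ?ler0n// invf_le1.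
by rewrite -[leRHS]invrK lef_pV2 ?posrE ?invr_gt0.
Unshelve. all: by end_near. Qed.

Lemma distortion_le_expR n : distortion_of R n <= expR (2 * delta_of R n).
Proof.
have t0 : 0 <= delta_of R n by exact: sqr_ge0.
have -> : 2 * delta_of R n = delta_of R n + delta_of R n by ring.
by rewrite expRD ler_wpM2r ?expR_ge0// expR_ge1Dx.
Qed.

Lemma expR_le_inv (x : R) : x < 1 -> expR x <= (1 - x)^-1.
Proof.
move=> x1; rewrite -[leLHS]invrK -expRN lef_pV2 ?posrE ?expR_gt0 ?subr_gt0//.
exact: expR_ge1Dx.
Qed.

Lemma distortion_ge0 n : 0 <= distortion_of R n.
Proof. by rewrite mulr_ge0 ?expR_ge0// addr_ge0// sqr_ge0. Qed.

Lemma near_large_E : \forall n \near \oo, distortion_of R n ^+ (8 * n) <= 2.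
Proof.
near=> n.
have n0 : (32 <= n)%N by near: n; exact: nbhs_infty_ge.
have nr : 0 < n%:R :> R by rewrite ltr0n (leq_trans _ n0).
apply: (@le_trans _ _ (expR (2 * delta_of R n) ^+ (8 * n))).
  by apply: lerXn2r; rewrite ?nnegrE ?expR_ge0 ?distortion_ge0 ?distortion_le_expR.
rewrite -expRM_natr natrM.
(* Here [delta_of] has to be of smaller order than [1 / n]: the total error over [8 n] steps then
   tends to 0. *)
have -> : 2 * delta_of R n * (8 * n%:R) = 16 / n%:R.
  by rewrite /delta_of; field; rewrite gt_eqF.
apply: (@le_trans _ _ (expR 2^-1)).
  rewrite ler_expR ler_pdivrMr//.
  have : 32%:R <= n%:R :> R by rewrite ler_nat.
  by lra.
have h : (2^-1 : R) < 1 by lra.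
apply: (le_trans (expR_le_inv h)).
have -> : 1 - 2^-1 = 2^-1 :> R by lra.
by rewrite invrK.
Unshelve. all: by end_near. Qed.

Lemma near_distortion_exp k (M : R) : 1 < M -> \forall n \near \oo,
  distortion_of R n ^+ k <= M.
Proof.
move=> M1; have Mi : M^-1 < 1 by rewrite invf_lt1//; lra.
near=> n.
have tk : delta_of R n <= (1 - M^-1) / (2 * k%:R + 1).
  by near: n; apply: delta_small; rewrite divr_gt0 ?subr_gt0// ltr_wpDl ?mulr_ge0.
apply: (@le_trans _ _ (expR (2 * delta_of R n) ^+ k)).
  by apply: lerXn2r; rewrite ?nnegrE ?expR_ge0 ?distortion_ge0 ?distortion_le_expR.
rewrite -expRM_natr.
have h : 2 * delta_of R n * k%:R <= 1 - M^-1.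
  have k0 : 0 <= k%:R :> R by [].
  move: tk; rewrite ler_pdivlMr; last by lra.
  have t0 : 0 <= delta_of R n by exact: sqr_ge0.
  by lra.
have M0 : 0 < M^-1 by rewrite invr_gt0; lra.
apply: (le_trans (expR_le_inv (_ : _ < 1))); first by lra.
by rewrite -[leRHS]invrK lef_pV2 ?posrE//; lra.
Unshelve. all: by end_near. Qed.

Lemma near_large_E2 : \forall n \near \oo,
  distortion_of R n ^+ 2 * 2^-1 `^ ((alpha - 1) / 2) <= 1.
Proof.
pose k : R := 2^-1 `^ ((alpha - 1) / 2).
have k0 : 0 < k by rewrite powR_gt0 ?invr_gt0.
have k1 : k < 1.
  have e0 : 0 < (alpha - 1) / 2 by rewrite divr_gt0.
  have := @gt0_ltr_powR R _ e0 2^-1 1; rewrite !nnegrE powR1; apply; lra.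
near=> n; rewrite -/k -ler_pdivlMr// div1r.
by near: n; apply: near_distortion_exp; rewrite invf_gt1.
Unshelve. all: by end_near. Qed.

(** [superexp] is [expR (B n + A0 - F g ^ (n - 1))] with [g > 1], and the last term dominates all
    linear ones. *)
Lemma superexp_small (M M0 : R) :
  \forall n \near \oo, superexp alpha n < expR (- (M * n%:R) - M0).
Proof.
pose g : R := (1 + alpha) / 2.
have g1 : 1 < g by rewrite /g; have := alpha_gt1; lra.
have lg : 0 < ln g by exact: ln_gt0.
have l2 : 0 < ln (2 : R) by apply: ln_gt0; lra.
pose F := (alpha - 1) * ln 2; have F0 : 0 < F by rewrite mulr_gt0.
pose B := 2 * ln (4 * alpha); pose A0 := ln 2 + (alpha - 1) * ln 4.
(* With this [C], the bound [C n <= g ^ n] says that [F g ^ (n - 1)] is at least the linear terms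
   plus [n]. *)
pose C := g / F * (B + M + `|A0 + M0| + 1).
near=> n.
have n0 : (0 < n)%N by near: n; exact: nbhs_infty_gt.
have n1 : 1 <= n%:R :> R by rewrite ler1n.
have H : C * n%:R ^+ 1 <= expR (ln g * n%:R) by near: n; exact: polynomial_le_expR.
have gn : g ^+ n.-1 = expR (ln g * n%:R) / g.
  rewrite expRM_natr lnK ?posrE; last by lra.
  by rewrite -{2}(prednK n0) exprS mulrC mulKf// gt_eqF//; lra.
have sE : superexp alpha n = expR (B * n%:R + A0 - F * g ^+ n.-1).
  rewrite /superexp -/g powRM ?powR_ge0// -powRrM.
  have -> : (4 * alpha) ^+ (2 * n) = expR (B * n%:R).
    rewrite /B mulrAC -natrM expRM_natl lnK// posrE mulr_gt0//.
  have -> : (4 : R) `^ (alpha - 1) = expR ((alpha - 1) * ln 4).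
    by rewrite /powR gt_eqF.
  have -> : (2^-1 : R) `^ (g ^+ n.-1 * (alpha - 1)) = expR (- (F * g ^+ n.-1)).
    rewrite /powR gt_eqF ?invr_gt0// lnV ?posrE//; congr expR; rewrite /F; ring.
  by rewrite -{1}(@lnK R 2) ?posrE// -!expRD; congr expR; rewrite /A0; ring.
rewrite sE ltr_expR gn.
have E0 : C * n%:R * (F / g) <= expR (ln g * n%:R) * (F / g).
  by apply: ler_wpM2r; [rewrite divr_ge0; lra|rewrite -[n%:R]expr1].
have E1 : C * n%:R * (F / g) = (B + M + `|A0 + M0| + 1) * n%:R.
  by rewrite /C; field; rewrite !gt_eqF//; lra.
have E2 : A0 + M0 <= `|A0 + M0| * n%:R.
  by apply: (le_trans (ler_norm _)); rewrite ler_peMr.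
have E3 : F * (expR (ln g * n%:R) / g) = expR (ln g * n%:R) * (F / g) by ring.
by rewrite E3; lra.
Unshelve. all: by end_near. Qed.

Lemma near_large : \forall n \near \oo, large alpha sigma beta n.
Proof.
have al1 := alpha_gt1; have ss := sigma01; have bb := beta_pos.
pose th := scale_bound alpha; pose K := 128 * return_constant alpha.
have th0 : 0 < th by rewrite /th ltr_wpDr ?powR_ge0.
have K0 : 0 < K by rewrite mulr_gt0// (lt_le_trans _ (return_constant_ge8 _)).
pose l1 := sigma / alpha ^+ 2 * ln alpha.
have l10 : 0 < l1 by rewrite mulr_gt0 ?divr_gt0 ?exprn_gt0//; lra.
have maxE n : eps_max alpha sigma n = th * expR (- (l1 * n%:R)).
  by rewrite /eps_max aE /l1; congr (_ * expR _); ring.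
have expP (x y : R) : expR x `^ y = expR (y * x).
  by rewrite /powR gt_eqF ?expR_gt0// expRK.
have maxP n s : eps_max alpha sigma n `^ s = th `^ s * expR (- (s * l1 * n%:R)).
  rewrite maxE powRM ?expR_ge0 ?(ltW th0)// expP; congr (_ * expR _); ring.
have ai1 : 0 < 1 - alpha^-1 by rewrite subr_gt0 invf_lt1.
have d1 n : 0 <= delta_of R n by exact: sqr_ge0.
near=> n; split.
- by near: n; exact: nbhs_infty_ge.
- by near: n; apply: delta_small; lra.
- by near: n; exact: near_large_E.
- by near: n; exact: near_large_E2.
- by near: n; exact: near_distortion_exp.
- have : 4 * th * expR (- (l1 * n%:R)) <= delta_of R n `^ 1.
    by near: n; exact: exp_decay_le_delta.
  by rewrite powRr1// maxE; lra.
- rewrite maxP.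
  have : 4 * 8 `^ (2 * alpha) * th `^ sigma * 4 `^ alpha *
      expR (- (sigma * l1 * n%:R)) <= delta_of R n `^ alpha.
    by near: n; apply: exp_decay_le_delta; rewrite mulr_gt0//; lra.
  by apply: le_trans; rewrite le_eqVlt; apply/orP; left; apply/eqP; ring.
- rewrite maxP.
  have c0 : 0 < (16^-1 : R) `^ alpha^-1 by rewrite powR_gt0 ?invr_gt0.
  have : th `^ (1 - alpha^-1) / 16^-1 `^ alpha^-1 *
      expR (- ((1 - alpha^-1) * l1 * n%:R)) <= delta_of R n `^ 1.
    by near: n; apply: exp_decay_le_delta; rewrite mulr_gt0.
  rewrite powRr1// -(ler_pM2r c0); apply: le_trans.
  by rewrite le_eqVlt; apply/orP; left; apply/eqP; field; rewrite gt_eqF.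
- have c0 : 0 < (4 : R) `^ alpha by rewrite powR_gt0.
  have : 24 * alpha * 4 `^ alpha * expR (- ((1 - alpha^-1) * ln alpha * n%:R)) <=
      delta_of R n `^ alpha.
    by near: n; apply: exp_decay_le_delta; rewrite mulr_gt0.
  have -> : (delta_of R n / 4) `^ alpha = delta_of R n `^ alpha / 4 `^ alpha.
    apply: (mulIf (lt0r_neq0 c0)); rewrite divfK ?gt_eqF// -powRM ?divr_ge0//.
    by rewrite divfK.
  rewrite ler_pdivlMr//; apply: le_trans.
  rewrite /eps_min -powR_mulrn; last exact: ltW.
  rewrite -powRD ?an0 ?implybT// aE -expRN le_eqVlt; apply/orP; left; apply/eqP.
  rewrite mulrAC; congr (_ * expR _); field.
  by rewrite an0.
- rewrite /eps_min -powRrM aE.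
  have -> : - (n%:R / alpha) * alpha * ln alpha = - (ln alpha * n%:R) - 0.
    by field; rewrite an0.
  by near: n; exact: superexp_small.
- set e := alpha / (alpha - 1).
  have k0 : 0 < K * 2 `^ alpha by rewrite mulr_gt0 ?powR_gt0.
  have -> : (alpha `^ (- (2 * n)%:R) / (K * 2 `^ alpha)) `^ e =
    expR (- (2 * e * ln alpha * n%:R) - e * ln (K * 2 `^ alpha)).
    rewrite aE -[X in _ / X](lnK k0) -expRN -expRD expP; congr expR.
    by rewrite natrM; ring.
  by near: n; exact: superexp_small.
- rewrite aE.
  have : 4 * (K * 2 `^ alpha) * expR (- (sigma / alpha * ln alpha * n%:R)) <=
      delta_of R n `^ 0.
    near: n; apply: exp_decay_le_delta; rewrite mulr_gt0 ?divr_gt0//; lra.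
  rewrite powRr0 -/K.
  have -> : - (n%:R * sigma / alpha) * ln alpha = - (sigma / alpha * ln alpha * n%:R) by ring.
  by have := expR_gt0 (- (sigma / alpha * ln alpha * n%:R)); lra.
- have : th `^ sigma * (K * 2 `^ (alpha + 1)) * n%:R ^+ 0 <= expR (beta * ln alpha * n%:R).
    near: n; apply: polynomial_le_expR; rewrite mulr_gt0//; lra.
  rewrite expr0 mulr1 aE -/th -/K.
  by have -> : beta * n%:R * ln alpha = beta * ln alpha * n%:R by ring.
Unshelve. all: by end_near. Qed.

End Asymptotics.

(** * Derivatives of the diffeomorphisms and cross ratios of the given branches *)

Section LevelZero.
Variable R : realType.
Implicit Types (g h : R -> R) (A : set R) (x l s t : R).

Lemma within_nbhs A (F : set_system R) : Filter F -> F A -> within A F = F.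
Proof.
move=> FF FA; apply/funext => P; apply/propext; split.
  by move=> FP; apply: filterS2 FA FP => y Ay; apply.
exact: filterS.
Qed.

Lemma within_dnbhs A x : nbhs x A -> within A x^' = x^'.
Proof. by move=> xA; apply: within_nbhs; exact: nbhs_dnbhs. Qed.

(** The slope function of Caratheodory's criterion is the difference quotient completed by [l] at
    [x]. *)
Lemma is_derive_diff_quot g x l : diff_quot g x y @[y --> x^'] --> l <->
  is_derive x 1 g l.
Proof.
rewrite is_derive1_caratheodory; split.
  move=> gl; exists (fun z => if z == x then l else diff_quot g x z); split.
  - move=> z; case: eqVneq => [->|zx]; first by rewrite !subrr mulr0.
    by rewrite /diff_quot divfK// subr_eq0.
  - apply/continuous_withinNx; rewrite eqxx.
    apply: cvg_trans gl; apply: near_eq_cvg; near=> z.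
    by rewrite ifN//; near: z; exact: nbhs_dnbhs_neq.
  - by rewrite eqxx.
move=> [h [hE /continuous_withinNx hc <-]].
apply: cvg_trans hc; apply: near_eq_cvg; near=> z.
have zx : z != x by near: z; exact: nbhs_dnbhs_neq.
by rewrite /diff_quot hE mulfK// subr_eq0.
Unshelve. all: by end_near. Qed.

Lemma derivable_in_is_derive A g x : nbhs x A -> derivable_in A g x ->
  is_derive x 1 g (deriv_in A g x).
Proof.
move=> xA; rewrite /derivable_in /deriv_in (within_dnbhs xA) => gl.
exact/is_derive_diff_quot.
Qed.

Lemma deriv_inE A g x l : nbhs x A -> is_derive x 1 g l -> deriv_in A g x = l.
Proof.
move=> xA /is_derive_diff_quot gl; rewrite /deriv_in within_dnbhs//.
exact: cvg_lim.
Qed.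

Lemma is_derive_eq_on g h s t x l : s < x < t ->
  (forall y, s < y < t -> g y = h y) -> is_derive x 1 h l -> is_derive x 1 g l.
Proof.
move=> xst gh hl; apply: near_eq_is_derive hl.
near=> y; apply/esym/gh; near: y; exact: (near_in_itvoo (x := x)).
Unshelve. all: by end_near. Qed.

Section Diffeo.
Variables (k : nat) (phi : R -> R).
Hypothesis k0 : (0 < k)%N.
Hypothesis dphi : diffeo01 k phi.

Lemma diffeo01_homeo : homeo01 phi.
Proof.
case: dphi => inc [phi' [im im' K K' _]].
have i0 : (0 : R) \in `[0, 1] by rewrite in_itv/= lexx ler01.
have i1 : (1 : R) \in `[0, 1] by rewrite in_itv/= lexx ler01.
have inc' : increasing_on phi 0 1.
  by move=> x y x0 xy y1; apply: inc => //; rewrite in_itv/=; lra.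
split => //.
  have := im' 0 i0; have := im 0 i0; rewrite !in_itv/= => /andP[a _] /andP[b1 b2].
  apply/eqP; rewrite eq_le a andbT -[leRHS](K' 0 i0).
  exact: increasing_onW inc' (lexx _) b1 b2.
have := im' 1 i1; have := im 1 i1; rewrite !in_itv/= => /andP[_ a] /andP[b1 b2].
apply/eqP; rewrite eq_le a /= -[leLHS](K' 1 i1).
exact: increasing_onW inc' b1 b2 (lexx _).
Qed.

Local Notation dn i := (nderiv_in `[0, 1]%classic i phi).

Lemma nbhs_unit_itv x : 0 < x < 1 -> nbhs x `[0, 1]%classic.
Proof.
move=> x01; apply: (filterS (P := `]0, 1[%classic)).
  by move=> y; rewrite /= !in_itv/= => /andP[/ltW-> /ltW->].
by apply: near_in_itvoo; rewrite in_itv.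
Qed.

Lemma diffeo01_is_derive i x : (i < k)%N -> 0 < x < 1 ->
  is_derive x 1 (dn i) (dn i.+1 x).
Proof.
move=> ik x01; case: dphi => _ [phi' [_ _ _ _ [[D _] _]]].
apply: derivable_in_is_derive; first exact: nbhs_unit_itv.
by apply: D => //; rewrite /= in_itv/= !ltW//; case/andP: x01.
Qed.

(** Monotonicity only gives a nonnegative derivative; it does not vanish because the inverse is
    differentiable too, by the chain rule for their composition. *)
Lemma diffeo01_deriv_gt0 x : 0 < x < 1 -> 0 < dn 1 x.
Proof.
move=> x01; have [pi p0 p1] := diffeo01_homeo.
have y01 : 0 < phi x < 1.
  have lo : phi 0 < phi x by apply: pi; lra.
  have hi : phi x < phi 1 by apply: pi; lra.
  by rewrite p0 in lo; rewrite p1 in hi; rewrite lo hi.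
have dx := diffeo01_is_derive k0 x01.
case: dphi => _ [phi' [_ _ K _ [_ [D' _]]]].
have dy : is_derive (phi x) 1 phi' (deriv_in `[0, 1]%classic phi' (phi x)).
  apply: derivable_in_is_derive; first exact: nbhs_unit_itv.
  by apply: (D' 0%N) => //; rewrite /= in_itv/= !ltW//; case/andP: y01.
have dc := der_comp dy dx.
have di : is_derive x 1 (fun z => phi' (phi z)) (1 : R).
  apply: (is_derive_eq_on x01 _ (derI x)) => y y01'.
  by apply: K; rewrite in_itv/= !ltW//; case/andP: y01'.
have E : deriv_in `[0, 1]%classic phi' (phi x) * dn 1 x = 1.
  by rewrite -(@derive_val _ _ _ _ _ _ _ dc) (@derive_val _ _ _ _ _ _ _ di).
have n0 : dn 1 x != 0.
  by apply: contra_eq_neq E => ->; rewrite mulr0 eq_sym oner_neq0.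
rewrite lt_def n0 /=.
move/is_derive_diff_quot : dx => dx.
apply: (cvgr_to_ge dx); near=> y.
have yx : y != x by near: y; exact: nbhs_dnbhs_neq.
have y01' : 0 < y < 1.
  by near: y; apply: nbhs_dnbhs; exact: (near_in_itvoo (x := x)).
rewrite /diff_quot; have [lt|gt|eq] := ltgtP x y.
- by rewrite divr_ge0 ?subr_ge0 ?(ltW lt)// ltW// pi//; lra.
- by rewrite -mulrNN -invrN !opprB divr_ge0 ?subr_ge0 ?(ltW gt)// ltW// pi//; lra.
- by rewrite eq eqxx in yx.
Unshelve. all: by end_near. Qed.

(** By the mean value theorem difference quotients are interior derivatives, whose ratios are
    bounded through [Dist]. *)
Lemma diffeo01_distortion (d : R) : (Dist phi <= d%:E)%E ->
  distortion_le (expR d) phi.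
Proof.
move=> Dd; have [pi p0 p1] := diffeo01_homeo.
have ratio x y : 0 < x < 1 -> 0 < y < 1 -> dn 1 x <= expR d * dn 1 y.
  move=> x01 y01; have dx := diffeo01_deriv_gt0 x01; have dy := diffeo01_deriv_gt0 y01.
  rewrite -ler_pdivrMr// -[leLHS]lnK ?posrE ?divr_gt0// ler_expR -lee_fin.
  apply: le_trans Dd; apply: ereal_sup_ubound; exists x, y.
  by rewrite !in_itv/= !ltW//; case/andP: x01 => //; case/andP: y01.
have mv x y : 0 <= x -> x < y -> y <= 1 ->
    exists2 z, 0 < z < 1 & phi y - phi x = dn 1 z * (y - x).
  move=> x0 xy y1; have [z||z zxy ->] := @MVT R phi (dn 1) x y xy.
  - rewrite in_itv/= => zxy; have z01 : 0 < z < 1 by lra.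
    exact: (diffeo01_is_derive k0 z01).
  - case: dphi => _ [phi' [_ _ _ _ [[_ C] _]]].
    have := C 0%N (ltnW k0); apply: continuous_subspaceW => z /=.
    by rewrite !in_itv/=; lra.
  - by exists z => //; move: zxy; rewrite in_itv/=; lra.
move=> x y z w x0; rewrite le_eqVlt => /predU1P[->|xy] y1 z0.
  by rewrite !subrr mul0r !mulr0.
rewrite le_eqVlt => /predU1P[->|zw] w1; first by rewrite !subrr mul0r !mulr0.
have [r1 r101 ->] := mv _ _ x0 xy y1; have [r2 r201 ->] := mv _ _ z0 zw w1.
have yx : 0 <= (y - x) * (w - z) by apply: mulr_ge0; lra.
have := ler_wpM2r yx (ratio _ _ r101 r201); lra.
Qed.

Section Chart.
Variables (alpha K l m n s t : R) (F : lorenz R).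
Hypothesis alpha0 : 0 < alpha.
Hypothesis k3 : (3 <= k)%N.
Hypothesis lm0 : 0 < l * m.
(** Common form of the two charts: [l] and [m] are both negative on the left and both positive on
    the right, so [l * m > 0] in either case. *)
Let q x := K + l * (m * x + n) `^ alpha.
Let q1 x := l * m * alpha * (m * x + n) `^ (alpha - 1).
Let q2 x := l * m ^+ 2 * alpha * (alpha - 1) * (m * x + n) `^ (alpha - 1 - 1).
Let q3 x := l * m ^+ 3 * alpha * (alpha - 1) * (alpha - 1 - 1) *
  (m * x + n) `^ (alpha - 1 - 1 - 1).
Hypothesis base0 : forall x, s < x < t -> 0 < m * x + n.
Hypothesis q01 : forall x, s < x < t -> 0 < q x < 1.
Hypothesis st_dom : forall x, s < x < t -> ldom F x.
Hypothesis lfunE : forall x, s < x < t -> lfun alpha F x = phi (q x).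
Hypothesis SF : forall x, ldom F x -> schwarzian alpha F x < 0.

Let dbase x : is_derive x 1 (fun z => m * z + n) m.
Proof. by apply: der_eq (derD (derM (derC m x) (derI x)) (derC n x)) _; ring. Qed.

Let dq x : s < x < t -> is_derive x 1 q (q1 x).
Proof.
move=> /base0 b0.
apply: der_eq (derD (derC K x) (derM (derC l x) (der_pow (g := fun z => m * z + n) alpha b0 (dbase x)))) _.
by rewrite /q1; ring.
Qed.

Let dq1 x : s < x < t -> is_derive x 1 q1 (q2 x).
Proof.
move=> /base0 b0.
apply: der_eq (derM (derC _ x) (der_pow (g := fun z => m * z + n) (alpha - 1) b0 (dbase x))) _.
by rewrite /q2; ring.
Qed.

Let dq2 x : s < x < t -> is_derive x 1 q2 (q3 x).
Proof.
move=> /base0 b0.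
apply: der_eq (derM (derC _ x) (der_pow (g := fun z => m * z + n) (alpha - 1 - 1) b0 (dbase x))) _.
by rewrite /q3; ring.
Qed.

Let d1 := dn 1.
Let d2 := dn 2.
Let d3 := dn 3.
Let f1 x := d1 (q x) * q1 x.
Let f2 x := d2 (q x) * q1 x * q1 x + d1 (q x) * q2 x.
Let f3 x := d3 (q x) * q1 x ^+ 3 + 3 * d2 (q x) * q1 x * q2 x + d1 (q x) * q3 x.

Let ddn i x : (i < 3)%N -> s < x < t -> is_derive (q x) 1 (dn i) (dn i.+1 (q x)).
Proof. by move=> i3 /q01 qx; apply: diffeo01_is_derive => //; exact: leq_trans k3. Qed.

Let df x : s < x < t -> is_derive x 1 (fun x => phi (q x)) (f1 x).
Proof. by move=> xst; exact: (der_comp (ddn (i := 0) isT xst) (dq xst)). Qed.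

Let df1 x : s < x < t -> is_derive x 1 f1 (f2 x).
Proof.
move=> xst; have dd1 := der_comp (ddn (i := 1) isT xst) (dq xst).
by apply: der_eq (derM dd1 (dq1 xst)) _; rewrite /f2 /d1 /d2; ring.
Qed.

Let df2 x : s < x < t -> is_derive x 1 f2 (f3 x).
Proof.
move=> xst; have dd1 := der_comp (ddn (i := 1) isT xst) (dq xst).
have dd2 := der_comp (ddn (i := 2) isT xst) (dq xst).
apply: der_eq (derD (derM (derM dd2 (dq1 xst)) (dq1 xst)) (derM dd1 (dq2 xst))) _.
by rewrite /f3 /d1 /d2 /d3; ring.
Qed.

Let f1_gt0 x : s < x < t -> 0 < f1 x.
Proof.
move=> xst; rewrite mulr_gt0 ?diffeo01_deriv_gt0 ?q01//.
by rewrite mulr_gt0 ?powR_gt0 ?base0// mulr_gt0.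
Qed.

Let nbhs_ldom x : s < x < t -> nbhs x (ldom F).
Proof.
move=> xst; apply: (filterS (P := `]s, t[%classic)).
  by move=> y; rewrite /= in_itv/=; exact: st_dom.
exact: (near_in_itvoo (x := x)).
Qed.

(** The derivatives in [schwarzian] are relative to the domain of [F]; inside the branch they agree
    with those of [phi (q x)] computed by the chain rule. *)
Lemma crx_chart a b : s < a -> b < t ->
  expands_cross_ratio (fun x => phi (q x)) a b.
Proof.
have D1 x : s < x < t -> deriv_in (ldom F) (lfun alpha F) x = f1 x.
  move=> xst; apply: deriv_inE; first exact: nbhs_ldom.
  exact: is_derive_eq_on xst lfunE (df xst).
have D2 x : s < x < t -> deriv_in (ldom F) (deriv_in (ldom F) (lfun alpha F)) x = f2 x.
  move=> xst; apply: deriv_inE; first exact: nbhs_ldom.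
  exact: is_derive_eq_on xst D1 (df1 xst).
have D3 x : s < x < t -> deriv_in (ldom F) (deriv_in (ldom F)
    (deriv_in (ldom F) (lfun alpha F))) x = f3 x.
  move=> xst; apply: deriv_inE; first exact: nbhs_ldom.
  exact: is_derive_eq_on xst D2 (df2 xst).
apply: (expands_cross_ratio_interior df df1 df2 f1_gt0) => x xst.
by have := SF (st_dom xst); rewrite /schwarzian /nderiv_in /= D1// D2// D3.
Qed.

End Chart.
End Diffeo.
End LevelZero.

(** * Level zero: the branches of the given map *)

Section LevelZero.
Variables (R : realType) (alpha : R).
Hypothesis alpha_gt1 : 1 < alpha.
Implicit Types (F G : lorenz R) (br : branches R) (x y : R).

Let a0 : 0 < alpha. Proof. exact: lt_trans ltr01 _. Qed.

(** The critical point is left out: there [lfun] takes by convention the value of the right branch,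
    whereas both branches of [br] extend to it. *)
Definition models br F :=
  [/\ lc F = bc br, 
      forall x, 0 <= x < bc br -> lfun alpha F x = lbr alpha br x &
      forall x, bc br < x <= 1 -> lfun alpha F x = rbr alpha br x].

Lemma lfun_left F x : x < lc F ->
  lfun alpha F x = left_map alpha (lc F) (lu F) (lphi F) x.
Proof. by move=> xc; rewrite /lfun /lorenzQ xc. Qed.

Lemma lfun_right F x : lc F < x ->
  lfun alpha F x = right_map alpha (lc F) (lv F) (lpsi F) x.
Proof.
move=> xc; rewrite /lfun /lorenzQ ltNge (ltW xc) /= /right_map /right_chart.
by congr (lpsi F _); rewrite /right_coord; ring.
Qed.

Lemma left_limit (K : R) (f S : R -> R) (s c : R) : s < c ->
  increasing_on S s c -> upper_lipschitz K S s c ->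
  (forall x, s < x < c -> f x = S x) -> f x @[x --> c^'-] --> S c.
Proof.
move=> sc Si Sl fS; have K0 := upper_lipschitz_gt0 sc Si Sl.
apply/cvgrPdist_le => /= d d0; near=> x.
have xc : x < c by near: x; exact: nbhs_left_lt.
have sx : s < x by near: x; exact: nbhs_left_gt.
have xd : c - d / K < x by near: x; apply: nbhs_left_gt; rewrite ltrBlDr ltrDl divr_gt0.
have dx : c - x < d / K by lra.
rewrite fS ?sx// ger0_norm; last by rewrite subr_ge0; apply: (increasing_onW Si); lra.
apply: le_trans (Sl _ _ (ltW sx) (ltW xc) (lexx _)) _.
by rewrite mulrC -ler_pdivlMr// ltW.
Unshelve. all: by end_near. Qed.

Lemma right_limit (K : R) (f S : R -> R) (c t : R) : c < t ->
  increasing_on S c t -> upper_lipschitz K S c t ->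
  (forall x, c < x < t -> f x = S x) -> f x @[x --> c^'+] --> S c.
Proof.
move=> ct Si Sl fS; have K0 := upper_lipschitz_gt0 ct Si Sl.
apply/cvgrPdist_le => /= d d0; near=> x.
have cx : c < x by near: x; exact: nbhs_right_gt.
have xt : x < t by near: x; exact: nbhs_right_lt.
have xd : x < c + d / K by near: x; apply: nbhs_right_lt; rewrite ltrDl divr_gt0.
have dx : x - c < d / K by lra.
rewrite fS ?cx// distrC ger0_norm; last by rewrite subr_ge0; apply: (increasing_onW Si); lra.
apply: le_trans (Sl _ _ (lexx _) (ltW cx) (ltW xt)) _.
by rewrite mulrC -ler_pdivlMr// ltW.
Unshelve. all: by end_near. Qed.

(** For [u = 0] the left branch would vanish, so that [c1m = 0 < c]. *)
Lemma nontrivial_lu_gt0 k F : lorenz_class k F -> nontrivial alpha F -> 0 < lu F.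
Proof.
move=> [/andP[u0 _] _ /andP[c0 c1] dp _] /andP[_ nt].
rewrite lt_def u0 andbT; apply/negP => /eqP uE.
have [_ p0 _] := diffeo01_homeo dp.
have H : lfun alpha F x @[x --> (lc F)^'-] --> (0 : R).
  apply/cvgrPdist_le => /= d d0; near=> x.
  rewrite lfun_left; last by near: x; exact: nbhs_left_lt.
  by rewrite /left_map /left_chart uE mul0r p0 subrr normr0 ltW.
by have := lt_trans c0 nt; rewrite /c1m (cvg_lim _ H)// ltxx.
Unshelve. all: by end_near. Qed.

Lemma nontrivial_lv_gt0 k F : lorenz_class k F -> nontrivial alpha F -> 0 < lv F.
Proof.
move=> [_ /andP[v0 _] /andP[c0 c1] _ dp] /andP[nt _].
rewrite lt_def v0 andbT; apply/negP => /eqP vE.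
have [_ _ p1] := diffeo01_homeo dp.
have H : lfun alpha F x @[x --> (lc F)^'+] --> (1 : R).
  apply/cvgrPdist_le => /= d d0; near=> x.
  rewrite lfun_right; last by near: x; exact: nbhs_right_gt.
  by rewrite /right_map /right_chart vE mul0r subr0 p1 subrr normr0 ltW.
by have := lt_trans nt c1; rewrite /c1p (cvg_lim _ H)// ltxx.
Unshelve. all: by end_near. Qed.

(** No iteration has taken place at this level, so the factors [A] and [B] are identities. *)
Lemma tame_level0 b0 (sigma beta theta : R) F : large alpha sigma beta b0 ->
  lorenzS alpha F -> setK alpha sigma theta b0 F ->
  exists br, tame alpha (1 + delta_of R b0) (expR (delta_of R b0)) br /\ models br F.
Proof.
move=> L [cl3 nt SF] [_ _ _ Dphi Dpsi].
have [/andP[_ u1] /andP[_ v1] cc dphi dpsi] := cl3.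
have u01 : 0 < lu F <= 1 by rewrite (nontrivial_lu_gt0 cl3 nt).
have v01 : 0 < lv F <= 1 by rewrite (nontrivial_lv_gt0 cl3 nt).
have t0 := delta_gt0 L.
have ph := diffeo01_homeo dphi; have sh := diffeo01_homeo dpsi.
have pd := diffeo01_distortion (k := 3) isT dphi Dphi; have sd := diffeo01_distortion (k := 3) isT dpsi Dpsi.
have pb := distortion_bilipschitz ph pd; have sb := distortion_bilipschitz sh sd.
have D1 : 1 <= expR (delta_of R b0) by rewrite -expR0 ler_expR ltW.
set c := lc F in cc *; set u := lu F in u01 *; set v := lv F in v01 *.
have c0 : 0 < c by case/andP: cc.
have c1 : c < 1 by case/andP: cc.
have li := left_increasing alpha_gt1 cc u01 ph.
have ri := right_increasing alpha_gt1 cc v01 sh.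
have crl : expands_cross_ratio (left_map alpha c u (lphi F)) 0 c.
  apply: (crx_closure c0 li (left_lipschitz alpha_gt1 cc u01 D1 pb)) => a' b' a'0 b'c.
  pose q x := u + (- u) * (- c^-1 * x + 1) `^ alpha.
  have qE x : left_chart alpha c u x = q x.
    rewrite /left_chart /q mulrBr mulr1 mulNr; congr (_ - _ * _ `^ _).
    by rewrite /left_coord; field; rewrite gt_eqF.
  apply: (crx_ext (g := fun x => lphi F (q x))).
    by move=> x _; rewrite /left_map qE.
  have dom x : 0 < x < c -> ldom F x.
    by move=> xc; split; [lra|rewrite lt_eqF//; case/andP: xc].
  apply: (@crx_chart R 3 (lphi F) isT dphi alpha u (- u) (- c^-1) 1 0 c F a0 isT _ _ _ dom _ SF _ _ a'0 b'c).
  - by rewrite mulrNN mulr_gt0 ?invr_gt0//; case/andP: u01.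
  - move=> x /andP[x0 xc]; have -> : - c^-1 * x + 1 = (c - x) / c.
      by field; rewrite gt_eqF.
    by rewrite divr_gt0 ?subr_gt0.
  - move=> x /andP[x0 xc]; rewrite -/(q x) -qE; have [_ Q1] := andP (left_Q01 alpha_gt1 cc u01 (x := c) ltac:(lra)).
    have A := left_Q_increasing alpha_gt1 cc u01 (lexx 0) x0 (ltW xc).
    have B := left_Q_increasing alpha_gt1 cc u01 (ltW x0) xc (lexx c).
    have [C _] := andP (left_Q01 alpha_gt1 cc u01 (x := 0) ltac:(lra)).
    by rewrite (le_lt_trans C A) (lt_le_trans B)// (le_trans Q1).
  - by move=> x /andP[x0 xc]; rewrite lfun_left// /left_map qE.
have crr : expands_cross_ratio (right_map alpha c v (lpsi F)) c 1.
  apply: (crx_closure c1 ri (right_lipschitz alpha_gt1 cc v01 D1 sb)) => a' b' a'0 b'c.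
  have c1n : 1 - c != 0 by rewrite gt_eqF// subr_gt0.
  pose q x := (1 - v) + v * ((1 - c)^-1 * x + - (c / (1 - c))) `^ alpha.
  have qE x : right_chart alpha c v x = q x.
    have -> : q x = 1 - v * (1 - ((1 - c)^-1 * x + - (c / (1 - c))) `^ alpha).
      by rewrite /q; ring.
    congr (1 - _ * (1 - _ `^ _)).
    by rewrite /right_coord; field.
  apply: (crx_ext (g := fun x => lpsi F (q x))).
    by move=> x _; rewrite /right_map qE.
  have dom x : c < x < 1 -> ldom F x.
    by move=> xc; split; [lra|rewrite gt_eqF//; case/andP: xc].
  apply: (@crx_chart R 3 (lpsi F) isT dpsi alpha (1 - v) v (1 - c)^-1 (- (c / (1 - c))) c 1 F a0 isT _ _ _ dom _ SF _ _ a'0 b'c).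
  - by rewrite mulr_gt0 ?invr_gt0 ?subr_gt0//; case/andP: v01.
  - move=> x /andP[x0 xc]; have -> : (1 - c)^-1 * x + - (c / (1 - c)) = (x - c) / (1 - c).
      by field.
    by rewrite divr_gt0 ?subr_gt0.
  - move=> x /andP[x0 xc]; rewrite -/(q x) -qE.
    have A := right_Q_increasing alpha_gt1 cc v01 (lexx c) x0 (ltW xc).
    have B := right_Q_increasing alpha_gt1 cc v01 (ltW x0) xc (lexx 1).
    have [C _] := andP (right_Q01 alpha_gt1 cc v01 (x := c) ltac:(lra)).
    have [_ Q1] := andP (right_Q01 alpha_gt1 cc v01 (x := 1) ltac:(lra)).
    have v1' : 0 <= 1 - v by rewrite subr_ge0.
    by rewrite (le_lt_trans (le_trans v1' C) A) (lt_le_trans B).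
  - by move=> x /andP[x0 xc]; rewrite lfun_right// /right_map qE.
have idc (f : R -> R) d : homeo01 f -> distortion_le d f ->
    tame_factor (1 + delta_of R b0) d id f.
  move=> fh fd; split => //.
  - by split.
  - move=> x y x0 xy y1; rewrite /=.
    have : (y - x) <= (1 + delta_of R b0) * (y - x) by rewrite ler_peMl ?subr_ge0// lerDl ltW.
    by [].
  - by apply: (crx_ext (g := fun x => 0 + 1 * x)); [move=> x _; rewrite /=; ring|exact: crx_affine].
exists (Branches c u v id (lphi F) id (lpsi F)); split.
  by split => //=; exact: idc.
split => //= x.
  by move=> /andP[_ xc]; rewrite lfun_left.
by move=> /andP[cx _]; rewrite lfun_right.
Qed.

End LevelZero.

(** * From the first-return map to the branches *)

Section RenormalizationData.
Variables (R : realType) (alpha : R).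
Hypothesis alpha_gt1 : 1 < alpha.
Implicit Types (F G : lorenz R) (br : branches R) (x y : R).

Lemma literS F n x : liter alpha F n.+1 x = obind (lmap alpha F) (liter alpha F n x).
Proof. by []. Qed.

Lemma lmap_some F x : 0 <= x <= 1 -> x != lc F -> lmap alpha F x = Some (lfun alpha F x).
Proof. by move=> x01 xc; rewrite /lmap x01 xc. Qed.

Lemma liter_add F m n x : liter alpha F (m + n) x =
  obind (liter alpha F m) (liter alpha F n x).
Proof.
elim: m => [|m IH]; first by case: (liter _ _ _ _).
by rewrite addSn !literS IH; case: (liter alpha F n x).
Qed.

Lemma liter_critical F n : liter alpha F n.+1 (lc F) = None.
Proof.
elim: n => [|n IH]; first by rewrite /liter/= /lmap eqxx andbF.
by rewrite literS IH.
Qed.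

Lemma lfun_range k F x : lorenz_class k F -> 0 <= x <= 1 -> 0 <= lfun alpha F x <= 1.
Proof.
move=> [/andP[u0 u1] /andP[v0 v1] c01 dphi dpsi] /andP[x0 x1].
have [phi_i phi0 phi1] := diffeo01_homeo dphi.
have [psi_i psi0 psi1] := diffeo01_homeo dpsi.
have a0 : 0 < alpha by exact: lt_trans ltr01 _.
rewrite /lfun; case: ltP => xc.
  rewrite /lorenzQ xc.
  have Y : 0 <= left_coord (lc F) x <= 1 by apply: left_Y => //; rewrite x0 ltW.
  have /andP[P0 P1] := pow01 alpha_gt1 (proj1 (andP Y)) (proj2 (andP Y)).
  rewrite -/(left_coord (lc F) x).
  have Q0 : 0 <= lu F * (1 - left_coord (lc F) x `^ alpha) by rewrite mulr_ge0// subr_ge0.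
  have Q1 : lu F * (1 - left_coord (lc F) x `^ alpha) <= 1.
    by apply: mulr_ile1 => //; rewrite ?subr_ge0// lerBlDr lerDl.
  have lo := increasing_onW phi_i (lexx 0) Q0 Q1; have hi := increasing_onW phi_i Q0 Q1 (lexx 1).
  by rewrite phi0 in lo; rewrite phi1 in hi; rewrite lo hi.
rewrite /lorenzQ ltNge xc /=.
have Y : 0 <= right_coord (lc F) x <= 1 by apply: right_T => //; rewrite xc.
have /andP[P0 P1] := pow01 alpha_gt1 (proj1 (andP Y)) (proj2 (andP Y)).
rewrite -/(right_coord (lc F) x).
have Q0 : 0 <= lv F * (1 - right_coord (lc F) x `^ alpha) by rewrite mulr_ge0// subr_ge0.
have Q1 : lv F * (1 - right_coord (lc F) x `^ alpha) <= 1.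
  by apply: mulr_ile1 => //; rewrite ?subr_ge0// lerBlDr lerDl.
have -> : 1 + lv F * (-1 + right_coord (lc F) x `^ alpha) =
  1 - lv F * (1 - right_coord (lc F) x `^ alpha) by ring.
set Q := 1 - _; have q0 : 0 <= Q by rewrite subr_ge0.
have q1 : Q <= 1 by rewrite lerBlDr lerDl.
have lo := increasing_onW psi_i (lexx 0) q0 q1; have hi := increasing_onW psi_i q0 q1 (lexx 1).
by rewrite psi0 in lo; rewrite psi1 in hi; rewrite lo hi.
Qed.

Lemma lfun_at0 k F : lorenz_class k F -> lfun alpha F 0 = 0.
Proof.
move=> [_ _ /andP[c0 c1] dphi _]; have [_ phi0 _] := diffeo01_homeo dphi.
rewrite lfun_left// /left_map /left_chart /left_coord subr0 divff ?gt_eqF//.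
by rewrite powR1 subrr mulr0.
Qed.

Lemma lfun_at1 k F : lorenz_class k F -> lfun alpha F 1 = 1.
Proof.
move=> [_ _ /andP[c0 c1] _ dpsi]; have [_ _ psi1] := diffeo01_homeo dpsi.
rewrite lfun_right// /right_map /right_chart /right_coord divff ?gt_eqF ?subr_gt0//.
by rewrite powR1 subrr mulr0 subr0.
Qed.

Lemma upper_lipschitz_sub K (f : R -> R) a b a' b' : a <= a' -> b' <= b ->
  upper_lipschitz K f a b -> upper_lipschitz K f a' b'.
Proof. by move=> aa bb fl x y ax xy yb; apply: fl => //; lra. Qed.

Lemma iter_comp_lipschitz (K L s t lo hi : R) (f g : R -> R) n :
  increasing_on f s t -> increasing_on g lo hi ->
  upper_lipschitz K f s t -> upper_lipschitz L g lo hi -> 0 < L ->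
  orbit_within lo hi g n (f s) -> orbit_within lo hi g n (f t) ->
  increasing_on (fun x => iter n g (f x)) s t /\
  upper_lipschitz (L ^+ n * K) (fun x => iter n g (f x)) s t.
Proof.
move=> fi gi fl gl L0; elim: n => [|n IH] os ot; first by rewrite expr0 mul1r.
have [Hi Hl] := IH (fun i ni => os i (ltnW ni)) (fun i ni => ot i (ltnW ni)).
have [/andP[lo1 hi1] /andP[lo2 hi2]] := (os n (ltnSn n), ot n (ltnSn n)).
split; first exact: (increasing_on_comp Hi gi).
by rewrite exprS -mulrA; apply: (upper_lipschitz_comp (ltW L0) Hi Hl gl).
Qed.

Lemma rescale_lipschitz (K m k a b m' : R) (S : R -> R) : 0 < k ->
  increasing_on S (m + k * a) (m + k * b) ->
  upper_lipschitz K S (m + k * a) (m + k * b) ->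
  increasing_on (fun x => (S (m + k * x) - m') / k) a b /\
  upper_lipschitz K (fun x => (S (m + k * x) - m') / k) a b.
Proof.
move=> k0 Si Sl; split=> x y ax xy yb.
  by rewrite ltr_pM2r ?invr_gt0// ltrD2r; apply: Si; rewrite ?lerD2l ?ltrD2l ?ler_pM2l ?ltr_pM2l.
have := Sl (m + k * x) (m + k * y).
rewrite !lerD2l !ler_pM2l// => /(_ ax xy yb) H.
have -> : (S (m + k * y) - m') / k - (S (m + k * x) - m') / k =
  (S (m + k * y) - S (m + k * x)) / k by field; rewrite gt_eqF.
rewrite ler_pdivrMr//; apply: (le_trans H); rewrite le_eqVlt; apply/orP; left.
by apply/eqP; ring.
Qed.

Section OneStep.
Variables (K D : R) (br : branches R) (F G : lorenz R) (a b : nat) (p q : R).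
Hypothesis K1 : 1 <= K.
Hypothesis D1 : 1 <= D.
Hypothesis tbr : tame alpha K D br.
Hypothesis mod : models alpha br F.
Local Notation c := (bc br).
Local Notation gl := (lbr alpha br).
Local Notation gr := (rbr alpha br).
Local Notation C := `[p, q]%classic.
Hypothesis ret : return_to alpha F p q G.
Hypothesis exp_l : return_exponent alpha F C `[p, lc F[%classic a.
Hypothesis exp_r : return_exponent alpha F C `]lc F, q]%classic b.
Hypothesis dyn_l : forall i x, (1 <= i <= a)%N -> `[p, lc F[%classic x ->
  exists2 y, liter alpha F i x = Some y & lc F < y < 1.
Hypothesis dyn_r : forall j x, (1 <= j <= b)%N -> `]lc F, q]%classic x ->
  exists2 y, liter alpha F j x = Some y & 0 < y < lc F.

Let h x := p + (q - p) * x.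
Let cE : lc F = c. Proof. by case: mod. Qed.
Let c01 := tame_c tbr.
Let u01 := tame_u tbr.
Let v01 := tame_v tbr.
Let Phih := tame_factor_homeo (tame_l tbr).
Let Psih := tame_factor_homeo (tame_r tbr).
Let E1 : 1 <= K * D. Proof. by rewrite -[leLHS]mulr1; apply: ler_pM. Qed.
Let Phib := tame_factor_bilipschitz (le_trans ler01 K1) (le_trans ler01 D1) (tame_l tbr).
Let Psib := tame_factor_bilipschitz (le_trans ler01 K1) (le_trans ler01 D1) (tame_r tbr).
Let gli : increasing_on gl 0 c := left_increasing alpha_gt1 c01 u01 Phih.
Let gri : increasing_on gr c 1 := right_increasing alpha_gt1 c01 v01 Psih.
Let gll : upper_lipschitz _ gl 0 c := left_lipschitz alpha_gt1 c01 u01 E1 Phib.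
Let grl : upper_lipschitz _ gr c 1 := right_lipschitz alpha_gt1 c01 v01 E1 Psib.
Let aa0 : (0 < a)%N. Proof. by case: exp_l. Qed.
Let bb0 : (0 < b)%N. Proof. by case: exp_r. Qed.
Let Gcls : lorenz_class 0 G. Proof. by case: ret. Qed.
Let Gc01 : 0 < lc G < 1. Proof. by case: Gcls. Qed.

Let C_le : 0 <= p /\ q <= 1.
Proof.
have [[C01 _] [cC nC] _ _ _] := ret.
have := cC c; rewrite /= cE in_itv/= => /(_ erefl)/andP[pc cq].
have pq := le_trans pc cq.
have := C01 p; have := C01 q; rewrite /= !in_itv/= !lexx pq /= => /(_ isT)/andP[_ ->].
by move=> /(_ isT)/andP[-> _].
Qed.

Let pcq : p <= c <= q.
Proof.
by have [_ [cC _] _ _ _] := ret; have := cC c; rewrite /= cE in_itv/=; apply.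
Qed.

Let no_return y : ~ first_return alpha F C c y.
Proof.
move=> [_ [n [n1 + _ _]]]; case: n n1 => // n _.
by rewrite -cE liter_critical.
Qed.

Let conj x : 0 <= x <= 1 -> x != lc G ->
  first_return alpha F C (h x) (h (lfun alpha G x)).
Proof.
move=> x01 xc; have [_ _ _ _ H] := ret.
have y01 := lfun_range Gcls x01.
by apply/H; rewrite ?in_itv//= lmap_some.
Qed.

Let h_neq_c x : 0 <= x <= 1 -> x != lc G -> h x != c.
Proof. by move=> x01 xc; apply/negP => /eqP E; have := conj x01 xc; rewrite E; exact: no_return. Qed.

Let p_lt_c : p < c.
Proof.
have n0 : 0 != lc G by rewrite lt_eqF//; case/andP: Gc01.
have := h_neq_c (x := 0); rewrite lexx ler01 /h mulr0 addr0 => /(_ isT n0) pc.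
by rewrite lt_neqAle pc; case/andP: pcq.
Qed.

Let c_lt_q : c < q.
Proof.
have n1 : 1 != lc G by rewrite gt_eqF//; case/andP: Gc01.
have := h_neq_c (x := 1); rewrite lexx ler01 /h mulr1 addrC subrK => /(_ isT n1) qc.
by rewrite lt_neqAle eq_sym qc; case/andP: pcq.
Qed.

Let qp0 : 0 < q - p. Proof. by rewrite subr_gt0 (lt_trans p_lt_c). Qed.
Let qpn : q - p != 0. Proof. by rewrite gt_eqF. Qed.

(** Every point of [[0, 1]] other than [lc G] has an image under [G], while the orbit of [c] stops
    at once and has no first return. So the point over [c] is [lc G]. *)
Lemma lc_renorm : lc G = (c - p) / (q - p).
Proof.
apply/eqP; rewrite eq_sym; apply/negPn/negP => ne.
have pc := p_lt_c; have cq := c_lt_q.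
have x01 : 0 <= (c - p) / (q - p) <= 1 by rewrite divr_ge0 ?ler_pdivrMr//; lra.
by have := h_neq_c x01 ne; rewrite /h mulrC divfK// addrC subrK eqxx.
Qed.

Let h_lt x : (x < lc G) = (h x < c).
Proof. by rewrite lc_renorm ltr_pdivlMr// ltrBrDl /h [x * _]mulrC. Qed.

Let h_gt x : (lc G < x) = (c < h x).
Proof. by rewrite lc_renorm ltr_pdivrMr// ltrBlDl /h [x * _]mulrC. Qed.

Let lmap_l x : 0 <= x < c -> lmap alpha F x = Some (gl x).
Proof.
move=> /andP[x0 xc]; have [_ M _] := mod.
rewrite lmap_some ?M ?x0 ?cE ?lt_eqF//=.
by rewrite (le_trans (ltW xc))// ltW//; case/andP: c01.
Qed.

Let lmap_r x : c < x <= 1 -> lmap alpha F x = Some (gr x).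
Proof.
move=> /andP[xc x1]; have [_ _ M] := mod.
rewrite lmap_some ?M ?x1 ?cE ?gt_eqF ?xc//= andbT.
by rewrite (le_trans _ (ltW xc))// ltW//; case/andP: c01.
Qed.

Let p0 : 0 <= p. Proof. by case: C_le. Qed.
Let q1 : q <= 1. Proof. by case: C_le. Qed.

Let L_in x : p <= x < c -> `[p, lc F[%classic x.
Proof. by rewrite /= in_itv/= cE. Qed.
Let R_in x : c < x <= q -> `]lc F, q]%classic x.
Proof. by rewrite /= in_itv/= cE. Qed.

Let liter_l x i : p <= x < c -> (i <= a)%N ->
  liter alpha F i.+1 x = Some (iter i gr (gl x)).
Proof.
move=> xr; elim: i => [|i IH] ia.
  by rewrite /liter/= lmap_l//; case/andP: xr => /(le_trans p0)-> ->.
rewrite literS IH ?(ltnW ia)//= lmap_r//.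
have [|y] := @dyn_l i.+1 x _ (L_in xr); first by rewrite ia.
by rewrite IH ?(ltnW ia)// => -[<-]; rewrite cE => /andP[-> /ltW->].
Qed.

Let liter_r x i : c < x <= q -> (i <= b)%N ->
  liter alpha F i.+1 x = Some (iter i gl (gr x)).
Proof.
move=> xr; elim: i => [|i IH] ib.
  by rewrite /liter/= lmap_r//; case/andP: xr => -> xq; exact: le_trans xq q1.
rewrite literS IH ?(ltnW ib)//= lmap_l//.
have [|y] := @dyn_r i.+1 x _ (R_in xr); first by rewrite ib.
by rewrite IH ?(ltnW ib)// => -[<-]; rewrite cE => /andP[/ltW-> ->].
Qed.

Let range_l x i : p <= x < c -> (i < a)%N -> c < iter i gr (gl x) < 1.
Proof.
move=> xr ia; have [|y] := @dyn_l i.+1 x _ (L_in xr); first by rewrite ia.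
by rewrite liter_l ?(ltnW ia)// => -[<-]; rewrite cE.
Qed.

Let range_r x i : c < x <= q -> (i < b)%N -> 0 < iter i gl (gr x) < c.
Proof.
move=> xr ib; have [|y] := @dyn_r i.+1 x _ (R_in xr); first by rewrite ib.
by rewrite liter_r ?(ltnW ib)// => -[<-]; rewrite cE.
Qed.

Let hr x : 0 <= x <= 1 -> p <= h x <= q.
Proof.
move=> /andP[x0 x1]; rewrite /h lerDl mulr_ge0 ?(ltW qp0)//=.
by rewrite -lerBrDl ler_piMr// ltW.
Qed.

Lemma lfun_renorm_l x : 0 <= x < lc G ->
  lfun alpha G x = (iter a gr (gl (h x)) - p) / (q - p).
Proof.
move=> /andP[x0 xc]; have x1 : x <= 1 by rewrite (le_trans (ltW xc))// ltW//; case/andP: Gc01.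
have x01 : 0 <= x <= 1 by rewrite x0.
have xcn : x != lc G by rewrite lt_eqF.
have hx : p <= h x < c by rewrite -h_lt xc andbT; case/andP: (hr x01).
have [_ RI _] := exp_l.
have := conj x01 xcn; rewrite (RI _ _ (L_in hx)) (liter_l hx (leqnn a)) => -[->].
by rewrite /h [_ - p]addrAC subrr add0r mulrAC mulfV// mul1r.
Qed.

Lemma lfun_renorm_r x : lc G < x <= 1 ->
  lfun alpha G x = (iter b gl (gr (h x)) - p) / (q - p).
Proof.
move=> /andP[xc x1]; have x0 : 0 <= x by rewrite (le_trans _ (ltW xc))// ltW//; case/andP: Gc01.
have x01 : 0 <= x <= 1 by rewrite x0.
have xcn : x != lc G by rewrite gt_eqF.
have hx : c < h x <= q by rewrite -h_gt xc /=; case/andP: (hr x01).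
have [_ RI _] := exp_r.
have := conj x01 xcn; rewrite (RI _ _ (R_in hx)) (liter_r hx (leqnn b)) => -[->].
by rewrite /h [_ - p]addrAC subrr add0r mulrAC mulfV// mul1r.
Qed.

Let fix_p : iter a gr (gl p) = p.
Proof.
have := @lfun_renorm_l 0; rewrite lexx (lfun_at0 Gcls); case/andP: Gc01 => -> _ /(_ isT).
rewrite /h mulr0 addr0 => /esym/eqP; rewrite mulf_eq0 invr_eq0 (negPf qpn) orbF subr_eq0.
by move/eqP.
Qed.

Let fix_q : iter b gl (gr q) = q.
Proof.
have := @lfun_renorm_r 1; rewrite lexx (lfun_at1 Gcls); case/andP: Gc01 => _ -> /(_ isT) /esym.
rewrite /h mulr1 [p + _]addrC subrK => /(congr1 (fun z => z * (q - p))).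
by rewrite divfK// mul1r => /(congr1 (fun z => z + p)); rewrite !subrK.
Qed.

Let p_gt0 : 0 < p.
Proof.
rewrite lt_def p0 andbT; apply/negP => /eqP pE.
have := range_l (x := p) (i := 0); rewrite lexx p_lt_c /= => /(_ isT aa0).
rewrite pE /lbr left_at0//; move=> /andP[c0 _].
by have := lt_trans (proj1 (andP c01)) c0; rewrite ltxx.
Qed.

Let q_lt1 : q < 1.
Proof.
rewrite lt_def q1 andbT; apply/negP => /eqP qE.
have := range_r (x := q) (i := 0); rewrite lexx c_lt_q /= => /(_ isT bb0).
rewrite -qE /rbr right_at1//; move=> /andP[_ c1].
by have := lt_trans c1 (proj2 (andP c01)); rewrite ltxx.
Qed.

(** The earliest such visit to [[p, q]] would be the first return of [p]; but [p] returns after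
    [a + 1] steps, to itself and left of [c], whereas these iterates are right of [c]. *)
Let out_l i : (i < a)%N -> q < iter i gr (gl p).
Proof.
have pc := p_lt_c; have cq := c_lt_q.
have pp : p <= p < c by rewrite lexx.
elim/ltn_ind: i => i IH ia; rewrite ltNge; apply/negP => zq.
have /andP[cz _] := range_l pp ia.
have fr : first_return alpha F C p (iter i gr (gl p)).
  split; first by rewrite /= in_itv/=; lra.
  exists i.+1; split => //.
  - exact: liter_l pp (ltnW ia).
  - by rewrite /= in_itv/=; lra.
  move=> [|k] z // /andP[_]; rewrite ltnS => ki; have ka := ltn_trans ki ia.
  rewrite (liter_l pp (ltnW ka)) => -[<-].
  by rewrite /= in_itv/= => /andP[_]; rewrite leNgt IH.
have [_ RI _] := exp_l.
move: fr => /(RI _ _ (L_in pp)); rewrite (liter_l pp (leqnn a)) fix_p => -[E].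
by move: cz; rewrite -E => /(lt_trans pc); rewrite ltxx.
Qed.

Let out_r j : (j < b)%N -> iter j gl (gr q) < p.
Proof.
have pc := p_lt_c; have cq := c_lt_q.
have pp : c < q <= q by rewrite lexx andbT.
elim/ltn_ind: j => j IH jb; rewrite ltNge; apply/negP => zq.
have /andP[_ zc] := range_r pp jb.
have fr : first_return alpha F C q (iter j gl (gr q)).
  split; first by rewrite /= in_itv/=; lra.
  exists j.+1; split => //.
  - exact: liter_r pp (ltnW jb).
  - by rewrite /= in_itv/=; lra.
  move=> [|k] z // /andP[_]; rewrite ltnS => ki; have ka := ltn_trans ki jb.
  rewrite (liter_r pp (ltnW ka)) => -[<-].
  by rewrite /= in_itv/= => /andP[]; rewrite leNgt IH.
have [_ RI _] := exp_r.
move: fr => /(RI _ _ (R_in pp)); rewrite (liter_r pp (leqnn b)) fix_q => -[E].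
by move: zc; rewrite -E => /(lt_trans cq); rewrite ltxx.
Qed.

Let right_orbit x i : p <= x <= c -> (i <= a)%N ->
  iter i gr (gl p) <= iter i gr (gl x) <= 1.
Proof.
have cc := c01; have pp := p_gt0; have pc := p_lt_c; have cq := c_lt_q.
move=> xr; elim: i => [|i IH] ia.
  by rewrite /= (increasing_onW gli) ?(gl_le1 alpha_gt1 c01 u01 Phih); lra.
have /andP[A B] := IH (ltnW ia); have H := out_l ia.
have cA : c <= iter i gr (gl p) by rewrite ltW// (lt_trans cq).
have U := increasing_onW gri cA A B.
have V := increasing_onW gri (le_trans cA A) B (lexx _).
have r1 : gr 1 = 1 := right_at1 alpha (bv br) c01 Psih.
rewrite r1 in V.
by apply/andP; split; [exact: U | exact: V].
Qed.

Let left_orbit x j : c <= x <= q -> (j <= b)%N ->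
  0 <= iter j gl (gr x) <= iter j gl (gr q).
Proof.
have cc := c01; have pp := q_lt1; have pc := p_lt_c; have cq := c_lt_q.
move=> xr; elim: j => [|j IH] jb.
  by rewrite /= (increasing_onW gri) ?(gr_ge0 alpha_gt1 c01 v01 Psih); lra.
have /andP[A B] := IH (ltnW jb); have H := out_r jb.
have Bc : iter j gl (gr q) <= c by rewrite ltW// (lt_trans H).
have U := increasing_onW gli A B Bc.
have V := increasing_onW gli (lexx _) A (le_trans B Bc).
have l0 : gl 0 = 0 := left_at0 alpha (bu br) c01 Phih.
rewrite l0 in V.
by apply/andP; split; [exact: V | exact: U].
Qed.

(** The return map extends continuously to [c] from the left, so its value there is, after
    rescaling, [c1m] of [G]; nontriviality and the range of [G] give the two bounds. *)
Let nontriv_l : c < iter a gr (gl c) <= q.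
Proof.
have cc := c01; have pp := p_gt0; have pc := p_lt_c; have cq := c_lt_q; have qp := qp0.
have o x : p <= x <= c -> orbit_within c 1 gr a (gl x).
  move=> xr i ia; have /andP[A B] := right_orbit xr (ltnW ia); have H := out_l ia.
  by rewrite B andbT; lra.
have [Si Sl] := iter_comp_lipschitz (increasing_on_sub (ltW pp) (lexx c) gli) gri
  (upper_lipschitz_sub (ltW pp) (lexx c) gll) grl
  (upper_lipschitz_gt0 (proj2 (andP c01)) gri grl) (o p ltac:(lra)) (o c ltac:(lra)).
have hc : p + (q - p) * lc G = c by rewrite lc_renorm mulrC divfK// addrC subrK.
have h0 : p + (q - p) * 0 = p by rewrite mulr0 addr0.
have := rescale_lipschitz (m := p) (a := 0) (b := lc G) p qp.
rewrite h0 hc => /(_ _ _ Si Sl)[Gi Gl].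
have G0 : 0 < lc G by case/andP: Gc01.
have lim : lfun alpha G x @[x --> (lc G)^'-] --> (iter a gr (gl (p + (q - p) * lc G)) - p) / (q - p).
  apply: (left_limit G0 Gi Gl) => x /andP[x0 xc].
  by apply: lfun_renorm_l; rewrite xc ltW.
have [_ _ _ /andP[_ nt] _] := ret.
have G1 : 0 <= lc G <= lc G by rewrite lexx andbT ltW.
rewrite /c1m (cvg_lim _ lim)// hc lc_renorm ltr_pM2r ?invr_gt0// ltrD2r in nt.
rewrite nt /=; rewrite -hc.
have B : (iter a gr (gl (p + (q - p) * lc G)) - p) / (q - p) <= 1.
  apply: (cvgr_to_le lim).
  near=> x.
  have x0 : 0 < x by near: x; exact: nbhs_left_gt.
  have xc : x < lc G by near: x; exact: nbhs_left_lt.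
  have x01 : 0 <= x <= 1 by have := Gc01; lra.
  by case/andP: (lfun_range Gcls x01).
by move: B; rewrite ler_pdivrMr// mul1r lerD2r.
Unshelve. all: by end_near. Qed.

Let nontriv_r : p <= iter b gl (gr c) < c.
Proof.
have cc := c01; have pp := q_lt1; have pc := p_lt_c; have cq := c_lt_q; have qp := qp0.
have o x : c <= x <= q -> orbit_within 0 c gl b (gr x).
  move=> xr i ia; have /andP[A B] := left_orbit xr (ltnW ia); have H := out_r ia.
  by rewrite A /=; lra.
have [Si Sl] := iter_comp_lipschitz (increasing_on_sub (lexx c) (ltW pp) gri) gli
  (upper_lipschitz_sub (lexx c) (ltW pp) grl) gll
  (upper_lipschitz_gt0 (proj1 (andP c01)) gli gll) (o c ltac:(lra)) (o q ltac:(lra)).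
have hc : p + (q - p) * lc G = c by rewrite lc_renorm mulrC divfK// addrC subrK.
have h1 : p + (q - p) * 1 = q by rewrite mulr1 addrC subrK.
have := rescale_lipschitz (m := p) (a := lc G) (b := 1) p qp.
rewrite h1 hc => /(_ _ _ Si Sl)[Gi Gl].
have G0 : lc G < 1 by case/andP: Gc01.
have lim : lfun alpha G x @[x --> (lc G)^'+] --> (iter b gl (gr (p + (q - p) * lc G)) - p) / (q - p).
  apply: (right_limit G0 Gi Gl) => x /andP[x0 xc].
  by apply: lfun_renorm_r; rewrite x0 ltW.
have [_ _ _ /andP[nt _] _] := ret.
rewrite /c1p (cvg_lim _ lim)// hc lc_renorm ltr_pM2r ?invr_gt0// ltrD2r in nt.
rewrite nt andbT; rewrite -hc.
have B : 0 <= (iter b gl (gr (p + (q - p) * lc G)) - p) / (q - p).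
  apply: (cvgr_to_ge lim).
  near=> x.
  have x0 : lc G < x by near: x; exact: nbhs_right_gt.
  have xc : x < 1 by near: x; exact: nbhs_right_lt.
  have x01 : 0 <= x <= 1 by have := Gc01; lra.
  by case/andP: (lfun_range Gcls x01).
by move: B; rewrite pmulr_lge0 ?invr_gt0// subr_ge0.
Unshelve. all: by end_near. Qed.

Lemma extract_renorm_data : renorm_data gl gr c a b p q.
Proof.
have pp := p_gt0; have pc := p_lt_c; have cq := c_lt_q; have qq := q_lt1.
split => //; lra.
Qed.

End OneStep.

Lemma renormalizes_data K D br w F G : 1 <= K -> 1 <= D -> tame alpha K D br ->
  models alpha br F -> renormalizes_to alpha w F G -> exists p q,
  [/\ renorm_data (lbr alpha br) (rbr alpha br) (bc br) w.1 w.2 p q,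
      return_to alpha F p q G, lc G = (bc br - p) / (q - p),
      (forall x, 0 <= x < lc G -> lfun alpha G x =
         (iter w.1 (rbr alpha br) (lbr alpha br (p + (q - p) * x)) - p) / (q - p)) &
      (forall x, lc G < x <= 1 -> lfun alpha G x =
         (iter w.2 (lbr alpha br) (rbr alpha br (p + (q - p) * x)) - p) / (q - p))].
Proof.
move=> K1 D1 tbr mod [p [q [[ret _] exl exr dl dr]]]; exists p, q; split => //.
- exact: (@extract_renorm_data K D br F G).

- exact: (lc_renorm mod ret).
- by apply: (@lfun_renorm_l K D br F G).
- by apply: (@lfun_renorm_r K D br F G).
Qed.

End RenormalizationData.

(** * Sets of zero content *)

Section Content.
Variable R : realType.
Implicit Types (X Y : set R) (e : R).

(** The closed intervals may be degenerate, so that points are covered at no cost. Finite covers can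
    be pulled back interval by interval, without measurability. *)
Definition small_cover X e := exists s : seq (R * R),
  [/\ forall I, I \in s -> I.1 <= I.2,
      forall x, X x -> exists2 I, I \in s & I.1 <= x <= I.2 &
      \sum_(I <- s) (I.2 - I.1) <= e].

Definition content0 X := forall e, 0 < e -> small_cover X e.

Lemma small_cover_sub X Y e e' : X `<=` Y -> e' <= e ->
  small_cover Y e' -> small_cover X e.
Proof.
move=> XY ee [s [s1 s2 s3]]; exists s; split => //; last exact: le_trans ee.
by move=> x /XY; exact: s2.
Qed.

Lemma small_cover_itv X a b : a <= b -> (forall x, X x -> a <= x <= b) ->
  small_cover X (b - a).
Proof.
move=> ab H; exists [:: (a, b)]; split.
- by move=> I; rewrite inE => /eqP->.
- by move=> x /H xab; exists (a, b); rewrite ?mem_head.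
- by rewrite big_seq1.
Qed.

Lemma small_coverU X Y e e' : small_cover X e -> small_cover Y e' ->
  small_cover (X `|` Y) (e + e').
Proof.
move=> [s [s1 s2 s3]] [r [r1 r2 r3]]; exists (s ++ r); split.
- by move=> I; rewrite mem_cat => /orP[/s1|/r1].
- move=> x [/s2|/r2] [I Is xI]; exists I => //; rewrite mem_cat Is ?orbT//.
- by rewrite big_cat; exact: lerD.
Qed.

Lemma content0_sub X Y : X `<=` Y -> content0 Y -> content0 X.
Proof. by move=> XY cY e e0; exact: (small_cover_sub XY (lexx _) (cY _ e0)). Qed.

Lemma content0U X Y : content0 X -> content0 Y -> content0 (X `|` Y).
Proof.
move=> cX cY e e0; have e2 : 0 < e / 2 by lra.
have -> : e = e / 2 + e / 2 by lra.
by apply: small_coverU; [exact: cX|exact: cY].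
Qed.

Lemma content0_set1 x : content0 [set x].
Proof.
move=> e e0; apply: (@small_cover_sub _ [set x] _ (x - x)) => //; first by rewrite subrr ltW.
by apply: small_cover_itv => // y ->; rewrite lexx.
Qed.

Lemma content0_geometric X lam e : 0 <= lam < 1 ->
  (forall n, small_cover X (lam ^+ n * e)) -> content0 X.
Proof.
move=> /andP[l0 l1] H d d0.
have lim : lam ^+ n * e @[n --> \oo] --> 0 * e.
  by apply: cvgMl; apply: cvg_expr; rewrite ger0_norm.
rewrite mul0r in lim.
have [n _ /(_ n (leqnn n)) /= nd] := cvgr_lt _ lim _ d0.
exact: (small_cover_sub _ (ltW nd) (H n)).
Qed.

(** For each interval of the cover one point of [D] mapped into it is chosen; the others are within
    its length divided by [k]. The two sides of the point account for the factor 2. *)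
Lemma content0_preimage X (D : set R) (g : R -> R) k : 0 < k ->
  (forall x y, D x -> D y -> k * `|x - y| <= `|g x - g y|) ->
  content0 X -> content0 [set x | D x /\ X (g x)].
Proof.
move=> k0 gk cX e e0.
have [|s [s1 s2 s3]] := cX (e * k / 2); first by rewrite !mulr_gt0.
(* The default 0 only occurs for intervals that [g] misses on [D], which have nothing to cover. *)
pose cl (I : R * R) := xget 0 [set x | D x /\ I.1 <= g x <= I.2].
pose wd (I : R * R) := (I.2 - I.1) / k.
exists [seq (cl J - wd J, cl J + wd J) | J <- s]; split.
- move=> J /mapP[I /s1 I12 ->] /=.
  have : 0 <= wd I by rewrite divr_ge0 ?(ltW k0)// subr_ge0.
  by lra.
- move=> x [Dx /s2[I Is gI]]; exists (cl I - wd I, cl I + wd I) => /=.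
    by apply/mapP; exists I.
  have [Dy /andP[y1 y2]] : [set x | D x /\ I.1 <= g x <= I.2] (cl I) by exact: (xgetPex _ (ex_intro _ x _)).
  have : `|x - cl I| <= wd I.
    rewrite ler_pdivlMr// mulrC; apply: (le_trans (gk _ _ Dx Dy)).
    by rewrite ler_norml; case/andP: gI => *; lra.
  by rewrite ler_norml => /andP[? ?]; lra.
- rewrite big_map /= (eq_bigr (fun I => 2 / k * (I.2 - I.1))); last first.
    by move=> I _; rewrite /wd; field; rewrite gt_eqF.
  rewrite -mulr_sumr mulrAC ler_pdivrMr//.
  by lra.
Qed.

Lemma content0_preimage_itv X (g : R -> R) k a b : 0 < k ->
  (forall x y, a <= x -> x <= y -> y <= b -> k * (y - x) <= g y - g x) ->
  content0 X -> content0 [set x | a <= x <= b /\ X (g x)].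
Proof.
move=> k0 gk; apply: (content0_preimage k0) => x y.
wlog xy : x y / x <= y => [W xr yr|/= xr yr].
  have [|yx] := leP x y; first by move=> xy; exact: W.
  by rewrite distrC [leRHS]distrC; apply: W => //; exact: ltW.
have := gk x y (proj1 (andP xr)) xy (proj2 (andP yr)).
rewrite distrC ger0_norm ?subr_ge0// => /le_trans; apply.
by rewrite distrC ler_norm.
Qed.

(** For each [n] a cover gives a measurable superset of measure at most [1 / (n + 1)], and the
    intersection of these is null. *)
Lemma content0_negligible X : content0 X -> (@lebesgue_measure R).-negligible X.
Proof.
move=> cX.
have H n : exists B : set R, [/\ measurable B, X `<=` B & (lebesgue_measure B <= n.+1%:R^-1%:E)%E].
  have [|s [s1 s2 s3]] := cX n.+1%:R^-1; first by rewrite invr_gt0.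
  suff [B [mB XB le]] : exists B : set R, [/\ measurable B,
      (forall x I, I \in s -> I.1 <= x <= I.2 -> B x) &
      (lebesgue_measure B <= (\sum_(I <- s) (I.2 - I.1))%:E)%E].
    exists B; split => //; last by apply: (le_trans le); rewrite lee_fin.
    by move=> x /s2[I Is]; exact: XB Is.
  elim: s s1 {s2 s3} => [|I s IH] s1.
    by exists set0; split => //; rewrite measure0 big_nil.
  have [|B [mB XB le]] := IH; first by move=> J Js; apply: s1; rewrite inE Js orbT.
  exists (`[I.1, I.2]%classic `|` B); split.
  - exact: measurableU.
  - move=> x J; rewrite inE => /predU1P[->|Js] xJ; first by left; rewrite /= in_itv.
    by right; exact: XB xJ.
  - apply: (le_trans (measureU2 _ _ _)) => //.
    rewrite big_cons EFinD; apply: leeD => //.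
    have := @lebesgue_measure_itv R `[I.1, I.2]; rewrite /= lte_fin => ->.
    case: ifPn => // h.
    by rewrite lee_fin subr_ge0 s1// mem_head.
pose B n := projT1 (cid (H n)).
have BP n : [/\ measurable (B n), X `<=` B n & (lebesgue_measure (B n) <= n.+1%:R^-1%:E)%E] := projT2 (cid (H n)).
exists (\bigcap_n B n); split.
- by apply: bigcap_measurable => // n _; case: (BP n).
- apply/eqP; rewrite eq_le measure_ge0 andbT; apply/lee_addgt0Pr => e e0.
  rewrite add0e.
  have [n _ /(_ n (leqnn n)) /= ne] : \forall n \near \oo, (n.+1%:R^-1 : R) < e.
    exact: near_infty_natSinv_lt (PosNum e0).
  have [mB _ le] := BP n.
  apply: (@le_trans _ _ (lebesgue_measure (B n))).
    apply: le_measure; rewrite ?inE//.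
      by apply: bigcap_measurable => // k _; case: (BP k).
    by apply: bigcap_inf.
  by apply: (le_trans le); rewrite lee_fin ltW.
- by move=> x Xx n _; case: (BP n) => _ + _; exact.
Qed.

End Content.

(** * Covers of the pieces between return intervals *)

Section ExtendedBranches.
Variables (R : realType).
Implicit Types (G : R -> R) (A x y z w B s t : R).

(** [[A, B]] is the extension of the range [[x, y]], with domain [[s0, t0]]. *)
Definition ext_branch G A x y B (s0 : R) s t (t0 : R) :=
  [/\ [/\ s0 < s, s < t & t < t0], increasing_on G s0 t0,
      exists K, upper_lipschitz K G s0 t0, expands_cross_ratio G s0 t0 &
      [/\ G s0 = A, G s = x, G t = y & G t0 = B]].

Lemma ext_branch_point G A x y B s0 s t t0 z : ext_branch G A x y B s0 s t t0 ->
  A <= z <= B -> exists2 w, s0 <= w <= t0 & G w = z.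
Proof.
move=> [[h1 h2 h3] Gi [K Gl] _ [G1 _ _ G4]] zr.
by apply: (lipschitz_surj _ Gi Gl); rewrite ?G1 ?G4//; lra.
Qed.

Lemma ext_branch_sub G A x y B s0 s t t0 s0' s' t' t0' :
  ext_branch G A x y B s0 s t t0 -> s0 <= s0' -> s0' < s' -> s' < t' ->
  t' < t0' -> t0' <= t0 ->
  ext_branch G (G s0') (G s') (G t') (G t0') s0' s' t' t0'.
Proof.
move=> [_ Gi [K Gl] Gc _] h1 h2 h3 h4 h5; split => //.
- exact: increasing_on_sub Gi.
- by exists K; exact: upper_lipschitz_sub Gl.
- exact: crx_sub Gc.
Qed.

Lemma ext_branch_lt G A x y B s0 s t t0 z w : ext_branch G A x y B s0 s t t0 ->
  s0 <= z <= t0 -> s0 <= w <= t0 -> (z < w) = (G z < G w).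
Proof. by move=> [_ Gi _ _ _] zr wr; rewrite (increasing_on_lt Gi). Qed.

Lemma ext_branch_comp G (g : R -> R) K lo hi A x y B s0 s t t0 :
  ext_branch G A x y B s0 s t t0 -> increasing_on g lo hi ->
  upper_lipschitz K g lo hi -> expands_cross_ratio g lo hi ->
  0 <= K -> lo <= A -> B <= hi ->
  ext_branch (fun z => g (G z)) (g A) (g x) (g y) (g B) s0 s t t0.
Proof.
move=> [h Gi [L Gl] Gc [G1 G2 G3 G4]] gi gl gc K0 loA Bhi.
rewrite -G1 in loA; rewrite -G4 in Bhi.
split; rewrite ?G1 ?G2 ?G3 ?G4//.
- exact: increasing_on_comp Gi gi _ _.
- by exists (K * L); exact: upper_lipschitz_comp Gl gl _ _.
- exact: crx_comp Gi gi _ _ Gc gc.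
Qed.

Variables (p c q m : R).
Hypothesis pcq : p < c < q.
Hypothesis m0 : 0 < m.
Let k := m * (q - p).

(** The cross ratios of [s0 < s < s1 < s2] and [s1 < s2 < t < t0] bound each outer piece by [1 / k]
    times the middle one, as lengths in the range are at most 1 and the space is at least [m]. The
    outer pieces keep extensions up to [c], so that the left or right branch can be applied next. *)
Lemma ext_branch_split G A x y B s0 s t t0 : ext_branch G A x y B s0 s t t0 ->
  0 <= A -> B <= 1 -> m <= x - A -> m <= B - y -> x < p -> q < y ->
  exists s1 sc s2, [/\ ext_branch G A x p c s0 s s1 sc,
    ext_branch G c q y B sc s2 t t0 &
    (s1 - s) + (t - s2) <= 2 / (k + 2) * (t - s)].
Proof.
move=> br A0 B1 mA mB xp qy.
have [[h1 h2 h3] Gi _ Gc [G1 G2 G3 G4]] := br; have pq := pcq; have mm := m0.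
have [s1 r1 E1] := ext_branch_point br (z := p) ltac:(lra).
have [sc rc Ec] := ext_branch_point br (z := c) ltac:(lra).
have [s2 r2 E2] := ext_branch_point br (z := q) ltac:(lra).
have rs : s0 <= s <= t0 by lra.
have rt : s0 <= t <= t0 by lra.
have l1 : s < s1 by rewrite (ext_branch_lt br)// G2 E1.
have l2 : s1 < sc by rewrite (ext_branch_lt br)// E1 Ec; lra.
have l3 : sc < s2 by rewrite (ext_branch_lt br)// E2 Ec; lra.
have l4 : s2 < t by rewrite (ext_branch_lt br)// G3 E2.
exists s1, sc, s2; split.
- rewrite -G1 -G2 -E1 -Ec; apply: (ext_branch_sub br); lra.
- rewrite -G3 -G4 -E2 -Ec; apply: (ext_branch_sub br); lra.
have k0 : 0 < k by rewrite mulr_gt0//; lra.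
have L : k * (s1 - s) <= s2 - s1.
  have := Gc s0 s s1 s2 (lexx _) h1 l1 ltac:(lra) ltac:(lra); rewrite G1 G2 E1 E2.
  set X := (s2 - s0) * (s1 - s); set Y := (s - s0) * (s2 - s1) => H.
  have X0 : 0 <= X by rewrite mulr_ge0; lra.
  have Y0 : 0 <= Y by rewrite mulr_ge0; lra.
  have H1 : k * X <= (x - A) * (q - p) * X by rewrite ler_wpM2r// ler_wpM2r//; lra.
  have H2 : (q - A) * (p - x) * Y <= Y by rewrite ler_piMl// mulr_ile1; lra.
  have H3 : (s - s0) * (k * (s1 - s)) <= k * X.
    rewrite mulrCA ler_pM2l//; apply: ler_wpM2r; lra.
  by rewrite -(ler_pM2l (_ : 0 < s - s0)); [rewrite -/Y; lra|lra].
have Rr : k * (t - s2) <= s2 - s1.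
  have := Gc s1 s2 t t0 ltac:(lra) ltac:(lra) l4 h3 (lexx _); rewrite G3 G4 E1 E2.
  set X := (t0 - s1) * (t - s2); set Y := (s2 - s1) * (t0 - t) => H.
  have X0 : 0 <= X by rewrite mulr_ge0; lra.
  have Y0 : 0 <= Y by rewrite mulr_ge0; lra.
  have H1 : k * X <= (q - p) * (B - y) * X.
    by rewrite ler_wpM2r// /k mulrC ler_wpM2l//; lra.
  have H2 : (B - p) * (y - q) * Y <= Y by rewrite ler_piMl// mulr_ile1; lra.
  have H3 : (t0 - t) * (k * (t - s2)) <= k * X.
    rewrite mulrCA ler_pM2l//; apply: ler_wpM2r; lra.
  by rewrite -(ler_pM2l (_ : 0 < t0 - t)); [rewrite [leRHS]mulrC -/Y; lra|lra].
rewrite mulrAC ler_pdivlMr; last by lra.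
by lra.
Qed.

Lemma ext_branch_trim_left G A x y B s0 s t t0 : ext_branch G A x y B s0 s t t0 ->
  A < c -> c < x -> exists sc, ext_branch G c x y B sc s t t0.
Proof.
move=> br Ac cx; have [[h1 h2 h3] Gi _ Gc [G1 G2 G3 G4]] := br.
have xB : x < B by rewrite -G2 -G4; apply: Gi; lra.
have [sc rc Ec] := ext_branch_point br (z := c) ltac:(lra).
have l : sc < s by rewrite (ext_branch_lt br) ?Ec ?G2//; lra.
by exists sc; rewrite -G2 -G3 -G4 -Ec; apply: (ext_branch_sub br); lra.
Qed.

Lemma ext_branch_trim_right G A x y B s0 s t t0 : ext_branch G A x y B s0 s t t0 ->
  y < c -> c < B -> exists tc, ext_branch G A x y c s0 s t tc.
Proof.
move=> br yc cB; have [[h1 h2 h3] Gi _ Gc [G1 G2 G3 G4]] := br.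
have xB : A < y by rewrite -G1 -G3; apply: Gi; lra.
have [tc rc Ec] := ext_branch_point br (z := c) ltac:(lra).
have l : t < tc by rewrite (ext_branch_lt br) ?Ec ?G3//; lra.
by exists tc; rewrite -G1 -G2 -G3 -Ec; apply: (ext_branch_sub br); lra.
Qed.

Let lam := 2 / (k + 2).
Variable E : R -> Prop.
Hypothesis E_gap : forall x, E x -> x <= p \/ q <= x.

(** Uniform in [G], so that the types of ranges can refer to one another in an induction. [n] counts
    the splittings, each of which gains the factor [lam]. *)
Definition covered n A x y B := forall G s0 s t t0,
  ext_branch G A x y B s0 s t t0 ->
  small_cover [set z | s <= z <= t /\ E (G z)] (lam ^+ n * (t - s)).

Lemma covered0 A x y B : covered 0 A x y B.
Proof.
move=> G s0 s t t0 [[_ st _] _ _ _ _]; rewrite expr0 mul1r.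
by apply: small_cover_itv => [|z []//]; exact: ltW.
Qed.

Lemma covered_split n A x y B : 0 <= A -> B <= 1 -> m <= x - A -> m <= B - y ->
  x < p -> q < y -> covered n A x p c -> covered n c q y B -> covered n.+1 A x y B.
Proof.
move=> A0 B1 mA mB xp qy cl cr G s0 s t t0 br.
have [s1 [sc [s2 [br1 br2 le]]]] := ext_branch_split br A0 B1 mA mB xp qy.
have k0 : 0 < k by rewrite mulr_gt0//; have := pcq; lra.
have lam0 : 0 <= lam by rewrite divr_ge0; lra.
have := small_coverU (cl _ _ _ _ _ br1) (cr _ _ _ _ _ br2); rewrite -mulrDr.
apply: small_cover_sub; last first.
  by rewrite exprSr -mulrA; apply: ler_wpM2l => //; exact: exprn_ge0.
have [[? ? ?] _ _ _ [_ _ G1 Gc]] := br1; have [[? ? ?] _ _ _ [_ G2 _ _]] := br2.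
have [[? ? ?] _ _ _ _] := br.
move=> z [/= zr Ez]; have [zp|zq] := E_gap Ez; [left|right]; split => //.
  rewrite (proj1 (andP zr)) /= leNgt (ext_branch_lt br); [|lra|lra].
  by rewrite G1 -leNgt.
rewrite (proj2 (andP zr)) andbT leNgt (ext_branch_lt br); [|lra|lra].
by rewrite G2 -leNgt.
Qed.

End ExtendedBranches.

Lemma min_positive (R : realType) (f : nat -> R) n :
  (forall j, (j < n)%N -> 0 < f j) -> exists2 m, 0 < m & forall j, (j < n)%N -> m <= f j.
Proof.
elim: n => [|n IH] f0; first by exists 1.
have [|m m0 mf] := IH; first by move=> j jn; apply: f0; exact: ltnW.
have fn := f0 n (ltnSn n).
exists (Num.min m (f n)); first by rewrite lt_min m0.
move=> j; rewrite ltnS leq_eqVlt => /predU1P[->|jn]; rewrite ge_min ?lexx ?orbT//.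
by rewrite mf.
Qed.

(** An interval starting at the fixed point [0] of [h] is exhausted by pulling
    back under [h]. *)
Lemma pullback_exhausts (R : realType) (P : R -> Prop) (h : R -> R) (p : R) :
  0 < p -> P p -> (forall x, 0 < x <= p -> x < h x) ->
  (forall y, 0 < y <= p -> exists2 x, 0 < x <= p & h x = y) ->
  (forall x y, 0 < x -> x <= y -> y <= p -> h x <= h y) ->
  (forall x, 0 < x <= p -> 0 < h x <= p -> P (h x) -> P x) ->
  forall e, 0 < e -> exists2 x, 0 < x < e & P x.
Proof.
move=> p0 Pp hx hs hm hP e e0.
pose S := [set x | 0 < x <= p /\ P x].
have Sp : S p by split => //; rewrite p0 lexx.
have lbS : lbound S 0 by move=> x [/andP[/ltW]].
have iS : has_inf S by split; [exists p | exists 0].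
have i0 : 0 <= inf S by apply: lb_le_inf; [exists p|].
have ip : inf S <= p by apply: ge_inf => //; case: iS.
have [i00|ipos] := leP (inf S) 0.
  have [x [/andP[x0 _] Px] xe] := inf_adherent e0 iS.
  by exists x; rewrite ?x0 //=; lra.
have hi : inf S < h (inf S) by apply: hx; rewrite ipos.
have [|y [/andP[y0 yp] Py] yi] := @inf_adherent _ S (h (inf S) - inf S) _ iS.
  by rewrite subr_gt0.
have [x /andP[x0 xp] xy] := hs y ltac:(lra).
have xi : x < inf S.
  by rewrite ltNge; apply/negP => ix; have := hm _ _ ipos ix xp; lra.
have : inf S <= x.
  apply: ge_inf; first by case: iS.
  by split; [rewrite x0; lra | apply: hP; rewrite ?xy ?y0//; lra].
by rewrite leNgt xi.
Qed.

(** * The set of points whose orbits avoid the return interval *)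

Section AvoidingSet.
Variables (R : realType) (gl gr : R -> R) (c Kl Kr kl kr : R) (a b : nat) (p q : R).
Hypothesis gli : increasing_on gl 0 c.
Hypothesis gri : increasing_on gr c 1.
Hypothesis gll : upper_lipschitz Kl gl 0 c.
Hypothesis grl : upper_lipschitz Kr gr c 1.
Hypothesis glc : expands_cross_ratio gl 0 c.
Hypothesis grc : expands_cross_ratio gr c 1.
Hypothesis gl0 : gl 0 = 0.
Hypothesis gr1 : gr 1 = 1.
Hypothesis glc1 : gl c <= 1.
Hypothesis grc0 : 0 <= gr c.
Hypothesis rd : renorm_data gl gr c a b p q.
Hypothesis b2 : (1 < b)%N.
Hypothesis kl0 : 0 < kl.
Hypothesis kr0 : 0 < kr.
Hypothesis expand_l : forall x y, 0 <= x -> x <= y -> y <= p -> kl * (y - x) <= gl y - gl x.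
Hypothesis expand_r : forall x y, q <= x -> x <= y -> y <= 1 -> kr * (y - x) <= gr y - gr x.
Hypothesis gl_gt : forall x, 0 < x <= p -> x < gl x.
Hypothesis gr_lt : forall x, q <= x < 1 -> gr x < x.
Variable E : R -> Prop.
Hypothesis E01 : forall x, E x -> 0 <= x <= 1.
Hypothesis E_gap : forall x, E x -> x <= p \/ q <= x.
Hypothesis E_l : forall x, E x -> x <= p -> E (gl x).
Hypothesis E_r : forall x, E x -> q <= x -> E (gr x).

Let pc := rd_p rd.
Let cq := rd_q rd.
Let c0 : 0 < c. Proof. by have := pc; lra. Qed.
Let c1 : c < 1. Proof. by have := cq; lra. Qed.
Let Kl0 : 0 <= Kl. Proof. exact/ltW/(upper_lipschitz_gt0 c0 gli gll). Qed.
Let Kr0 : 0 <= Kr. Proof. exact/ltW/(upper_lipschitz_gt0 c1 gri grl). Qed.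

Let lo j := iter j gl (gr q).
Let lo0 j := iter j gl (gr c).
Let hi i := iter i gr (gl p).
Let hi0 i := iter i gr (gl c).

Let lo_between j : (j <= b)%N -> 0 <= lo0 j /\ lo0 j < lo j.
Proof.
have := pc; have := cq => qq pp.
elim: j => [|j IH] jb; first by split => //; apply: gri; lra.
have [A B] := IH (ltnW jb); have C : lo j < p := rd_out_r rd jb.
have D : lo j <= c by lra.
split; last exact: gli A B D.
rewrite -gl0; exact: increasing_onW gli (lexx 0) A (le_trans (ltW B) D).
Qed.

Let hi_between i : (i <= a)%N -> hi0 i <= 1 /\ hi i < hi0 i.
Proof.
have := pc; have := cq => qq pp.
elim: i => [|i IH] ia; first by split => //; apply: gli; lra.
have [A B] := IH (ltnW ia); have C : q < hi i := rd_out_l rd ia.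
have D : c <= hi i by lra.
split; last exact: gri D B A.
rewrite -gr1; exact: increasing_onW gri (le_trans D (ltW B)) A (lexx 1).
Qed.

Let lo_p j : (j < b)%N -> lo j < p. Proof. exact: (rd_out_r rd). Qed.
Let q_hi i : (i < a)%N -> q < hi i. Proof. exact: (rd_out_l rd). Qed.

Let pcq : p < c < q. Proof. by have := pc; have := cq; lra. Qed.

Section Cover.
Variable m : R.
Hypothesis m0 : 0 < m.
Hypothesis m_lo : forall j, (j < b)%N -> m <= lo j - lo0 j.
Hypothesis m_hi : forall i, (i < a)%N -> m <= hi0 i - hi i.

Local Notation covered := (covered p q m E).
(** Ranges come in finitely many types. [gl] sends the left type [j] to the range from [lo j.+1] to
    [hi 0], which splits at [[p, q]] into the left type [j.+1] and the right type 0; similarly for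
    [gr] and the right types. *)
Let cL n j := covered n (lo0 j) (lo j) p c.
Let cR n i := covered n c q (hi i) (hi0 i).

Let cover_l G s0 s t t0 j n : (j < b)%N ->
  (forall s0 s t t0, ext_branch (fun z => gl (G z)) (lo0 j.+1) (lo j.+1) (hi 0) (hi0 0) s0 s t t0 ->
     small_cover [set z | s <= z <= t /\ E (gl (G z))] ((2 / (m * (q - p) + 2)) ^+ n * (t - s))) ->
  ext_branch G (lo0 j) (lo j) p c s0 s t t0 ->
  small_cover [set z | s <= z <= t /\ E (G z)] ((2 / (m * (q - p) + 2)) ^+ n * (t - s)).
Proof.
move=> jb H br; have [A _] := lo_between (ltnW jb).
have := H _ _ _ _ (ext_branch_comp br gli gll glc Kl0 A (lexx c)).
apply: small_cover_sub => // z [/= zr Ez]; split => //; apply: E_l => //.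
have [[? ? ?] Gi _ _ [_ _ <- _]] := br.
by apply: (increasing_onW Gi); lra.
Qed.

Let cover_r G s0 s t t0 i n : (i < a)%N ->
  (forall s0 s t t0, ext_branch (fun z => gr (G z)) (lo0 0) (lo 0) (hi i.+1) (hi0 i.+1) s0 s t t0 ->
     small_cover [set z | s <= z <= t /\ E (gr (G z))] ((2 / (m * (q - p) + 2)) ^+ n * (t - s))) ->
  ext_branch G c q (hi i) (hi0 i) s0 s t t0 ->
  small_cover [set z | s <= z <= t /\ E (G z)] ((2 / (m * (q - p) + 2)) ^+ n * (t - s)).
Proof.
move=> ia H br; have [A _] := hi_between (ltnW ia).
have := H _ _ _ _ (ext_branch_comp br gri grl grc Kr0 (lexx c) A).
apply: small_cover_sub => // z [/= zr Ez]; split => //; apply: E_r => //.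
have [[? ? ?] Gi _ _ [_ <- _ _]] := br.
by apply: (increasing_onW Gi); lra.
Qed.

(** The last left type is sent to the right type 0, and the last right type to the left type 0,
    without splitting. As [b > 1], at most two such moves precede a splitting. *)
Let all_covered n : (forall j, (j < b)%N -> cL n j) /\ (forall i, (i < a)%N -> cR n i).
Proof.
have a1 := rd_a0 rd; have b1 : (0 < b)%N := ltnW b2.
elim: n => [|n [IL IR]]; first by split=> *; exact: covered0.
have split_l j : (j.+1 < b)%N -> cL n.+1 j.
  move=> jb G s0 s t t0; apply: cover_l; first exact: ltnW.
  have [A B] := lo_between (ltnW jb); have [C D] := hi_between (leq0n a).
  move=> s0' s' t' t0' br; apply: (covered_split pcq m0 E_gap A C _ _ _ _ (IL _ jb) (IR _ a1) br).
  - exact: m_lo.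
  - exact: m_hi.
  - exact: lo_p.
  - exact: q_hi.
have split_r i : (i.+1 < a)%N -> cR n.+1 i.
  move=> ia G s0 s t t0; apply: cover_r; first exact: ltnW.
  have [A B] := lo_between (leq0n b); have [C D] := hi_between (ltnW ia).
  move=> s0' s' t' t0' br; apply: (covered_split pcq m0 E_gap A C _ _ _ _ (IL _ b1) (IR _ ia) br).
  - exact: m_lo.
  - exact: m_hi.
  - exact: lo_p.
  - exact: q_hi.
have all_r i : (i < a)%N -> cR n.+1 i.
  move=> ia; have [ia'|ai] := ltnP i.+1 a; first exact: split_r.
  have aE : a = i.+1 by apply/eqP; rewrite eqn_leq ai ia.
  move=> G s0 s t t0; apply: cover_r => // s0' s' t' t0'.
  (* The range ends at [p] and does not reach [q]; cutting its extension at [c] gives the left type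
     0. *)
  have fixp : hi i.+1 = p by rewrite -aE; exact: (rd_fix_l rd).
  rewrite fixp => br.
  have cc : c < hi0 i.+1 by rewrite -aE; case/andP: (rd_nontriv_l rd).
  have [tc br'] := ext_branch_trim_right br (proj1 (andP pcq)) cc.
  exact: (split_l 0%N b2) br'.
split => // j jb; have [jb'|bj] := ltnP j.+1 b; first exact: split_l.
have bE : b = j.+1 by apply/eqP; rewrite eqn_leq bj jb.
move=> G s0 s t t0; apply: cover_l => // s0' s' t' t0'.
have fixq : lo j.+1 = q by rewrite -bE; exact: (rd_fix_r rd).
rewrite fixq => br.
have cc : lo0 j.+1 < c by rewrite -bE; case/andP: (rd_nontriv_r rd).
have [sc br'] := ext_branch_trim_left br cc (proj2 (andP pcq)).
exact: (all_r 0%N a1) br'.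
Qed.

Let lam01 : 0 <= 2 / (m * (q - p) + 2) < 1.
Proof.
have k0 : 0 < m * (q - p) by rewrite mulr_gt0//; have := pcq; lra.
by rewrite divr_ge0 ?ltr_pdivrMr; lra.
Qed.

Let core_l : content0 [set z | gr q <= z <= p /\ E z].
Proof.
apply: (content0_geometric lam01) => n.
have [A B] := lo_between (leq0n b).
apply: ((all_covered n).1 0%N (ltnW b2) id (gr c) (gr q) p c); split => //.
- by split => //; [exact: (lo_p (ltnW b2))|case/andP: pcq].
- by exists 1 => x y _ xy _; rewrite mul1r.
- by apply: (@crx_ext _ _ (fun x => 0 + 1 * x)); [move=> x _; rewrite /=; ring|exact: crx_affine].
Qed.

Let core_r : content0 [set z | q <= z <= gl p /\ E z].
Proof.
apply: (content0_geometric lam01) => n.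
have [A B] := hi_between (leq0n a).
apply: ((all_covered n).2 0%N (rd_a0 rd) id c q (gl p) (gl c)); split => //.
- by split => //; [case/andP: pcq|exact: (q_hi (rd_a0 rd))].
- by exists 1 => x y _ xy _; rewrite mul1r.
- by apply: (@crx_ext _ _ (fun x => 0 + 1 * x)); [move=> x _; rewrite /=; ring|exact: crx_affine].
Qed.

Lemma content0_core :
  content0 [set z | gr q <= z <= p /\ E z] /\ content0 [set z | q <= z <= gl p /\ E z].
Proof. by []. Qed.

End Cover.

Let cores : content0 [set z | gr q <= z <= p /\ E z] /\ content0 [set z | q <= z <= gl p /\ E z].
Proof.
have [|m1 m10 H1] := @min_positive R (fun j => lo j - lo0 j) b.
  by move=> j jb; rewrite subr_gt0; case: (lo_between (ltnW jb)).
have [|m2 m20 H2] := @min_positive R (fun j => hi0 j - hi j) a.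
  by move=> j jb; rewrite subr_gt0; case: (hi_between (ltnW jb)).
apply: (@content0_core (Num.min m1 m2)); first by rewrite lt_min m10.
- by move=> j /H1; apply: le_trans; rewrite ge_min lexx.
- by move=> j /H2; apply: le_trans; rewrite ge_min lexx orbT.
Qed.

(** The core takes care of the points between [q] and [gl p]. Pulling back under [gl] gives zero
    content to the part of [E] in [[x, p]] for arbitrarily small [x > 0], and the rest lies in an
    interval of length [e / 2]. *)
Let left_part : content0 [set z | z <= p /\ E z].
Proof.
have pp := pc; have qq := cq; have [cl cr] := cores.
pose P d := content0 [set z | d <= z <= p /\ E z].
have H : forall e, 0 < e -> exists2 x, 0 < x < e & P x.
  apply: (@pullback_exhausts _ P gl p); first by lra.
  - apply: (content0_sub _ (content0_set1 p)) => z [/= zp _].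
    by apply/eqP; rewrite eq_le andbC.
  - exact: gl_gt.
  - move=> y yr.
    have [||x xr xy] := lipschitz_surj (a := 0) (b := p) (y := y) _
      (increasing_on_sub (lexx _) (ltW (proj2 (andP pp))) gli)
      (upper_lipschitz_sub (lexx _) (ltW (proj2 (andP pp))) gll).
    + by lra.
    + by rewrite gl0; have := gl_gt (x := p) ltac:(lra); lra.
    exists x => //; rewrite (proj2 (andP xr)) andbT lt_def (proj1 (andP xr)) andbT.
    by apply/eqP => x0; move: xy; rewrite x0 gl0; lra.
  - by move=> x y x0 xy yp; apply: (increasing_onW gli); lra.
  move=> x xr hx Ph.
  apply: (content0_sub _ (content0_preimage_itv kl0 expand_l (content0U Ph cr))) => z [/= zr Ez]; split; first by lra.
  have Eg := E_l Ez (proj2 (andP zr)).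
  have g1 := increasing_onW gli (ltW (proj1 (andP xr))) (proj1 (andP zr)) ltac:(lra).
  have g2 := increasing_onW gli (x := z) (y := p) ltac:(lra) ltac:(lra) ltac:(lra).
  by have [h|h] := E_gap Eg; [left|right]; split => //=; lra.
move=> e e0; have e2 : 0 < e / 2 by lra.
have [d d0 Pd] := H _ e2.
have -> : e = e / 2 + e / 2 by lra.
have A : small_cover [set z | 0 <= z <= e / 2] (e / 2).
  by have := @small_cover_itv R [set z | 0 <= z <= e / 2] 0 (e / 2) (ltW e2); rewrite subr0; apply.
apply: (small_cover_sub _ (lexx _) (small_coverU A (Pd _ e2))) => z [/= zp Ez].
have zr := E01 Ez.
by have [zd|dz] := leP z d; [left; rewrite /=; lra | right; split => //; rewrite zp ltW].
Qed.

Let right_part : content0 [set z | q <= z /\ E z].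
Proof.
have pp := pc; have qq := cq; have [cl cr] := cores.
pose P d := content0 [set z | q <= z <= 1 - d /\ E z].
pose h x := 1 - gr (1 - x).
have H : forall e, 0 < e -> exists2 x, 0 < x < e & P x.
  apply: (@pullback_exhausts _ P h (1 - q)); first by lra.
  - apply: (content0_sub _ (content0_set1 q)) => z [/= zp _].
    by apply: le_anti; lra.
  - by move=> x xr; have := gr_lt (x := 1 - x) ltac:(lra); rewrite /h; lra.
  - move=> y yr.
    have [||x xr xy] := lipschitz_surj (a := q) (b := 1) (y := 1 - y) _
      (increasing_on_sub (ltW (proj1 (andP qq))) (lexx _) gri)
      (upper_lipschitz_sub (ltW (proj1 (andP qq))) (lexx _) grl).
    + by lra.
    + by rewrite gr1; have := gr_lt (x := q) ltac:(lra); lra.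
    exists (1 - x); last by rewrite /h subKr xy subKr.
    have : x != 1 by apply/eqP => x0; move: xy; rewrite x0 gr1; lra.
    by rewrite neq_lt => /orP[]; lra.
  - move=> x y x0 xy yp; rewrite /h lerD2l lerN2.
    by apply: (increasing_onW gri); lra.
  move=> x xr hx Ph.
  apply: (content0_sub _ (content0_preimage_itv kr0 expand_r (content0U cl Ph))) => z [/= zr Ez]; split; first by lra.
  have Eg := E_r Ez (proj1 (andP zr)).
  have g1 := increasing_onW gri (x := z) (y := 1 - x) ltac:(lra) ltac:(lra) ltac:(lra).
  have g2 := increasing_onW gri (x := q) (y := z) ltac:(lra) ltac:(lra) ltac:(lra).
  by have [h1|h1] := E_gap Eg; [left|right]; split => //=; rewrite /h; lra.
move=> e e0; have e2 : 0 < e / 2 by lra.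
have [d d0 Pd] := H _ e2.
have -> : e = e / 2 + e / 2 by lra.
have A : small_cover [set z | 1 - e / 2 <= z <= 1] (e / 2).
  have h1 : 1 - e / 2 <= 1 by lra.
  by have := @small_cover_itv R [set z | 1 - e / 2 <= z <= 1] _ _ h1; rewrite subKr; apply.
apply: (small_cover_sub _ (lexx _) (small_coverU A (Pd _ e2))) => z [/= zp Ez].
have zr := E01 Ez.
by have [zd|dz] := leP (1 - d) z; [left; rewrite /=; lra | right; split => //; rewrite zp ltW].
Qed.

Lemma avoiding_content0 : content0 E.
Proof.
apply: (content0_sub _ (content0U left_part right_part)) => z Ez.
by have [h|h] := E_gap Ez; [left|right].
Qed.

End AvoidingSet.

(** * Zero content at one level of renormalization *)

Section Level.
Variables (R : realType) (alpha : R).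
Hypothesis alpha_gt1 : 1 < alpha.

Section Expanding.
Variables (K D : R) (br : branches R).
Hypothesis K1 : 1 <= K.
Hypothesis D1 : 1 <= D.
Hypothesis tbr : tame alpha K D br.
Local Notation c := (bc br).
Local Notation gl := (lbr alpha br).
Local Notation gr := (rbr alpha br).

Let c01 := tame_c tbr.
Let u01 := tame_u tbr.
Let v01 := tame_v tbr.
Let Phih := tame_factor_homeo (tame_l tbr).
Let Psih := tame_factor_homeo (tame_r tbr).
Let E1 : 1 <= K * D. Proof. by rewrite -[leLHS]mulr1; apply: ler_pM. Qed.
Let Phib := tame_factor_bilipschitz (le_trans ler01 K1) (le_trans ler01 D1) (tame_l tbr).
Let Psib := tame_factor_bilipschitz (le_trans ler01 K1) (le_trans ler01 D1) (tame_r tbr).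

Lemma left_expanding d : 0 <= d < c -> exists2 k, 0 < k &
  forall x y, 0 <= x -> x <= y -> y <= d -> k * (y - x) <= gl y - gl x.
Proof.
move=> /andP[d0 dc]; have cc := c01; have uu := u01; have al1 := alpha_gt1; have Ee := E1.
have k0 : 0 < bu br * alpha / c * left_coord c d `^ (alpha - 1).
  rewrite mulr_gt0 ?divr_gt0 ?mulr_gt0 ?powR_gt0 ?subr_gt0//; try lra.
  by rewrite divr_gt0; lra.
exists (bu br * alpha / c * left_coord c d `^ (alpha - 1) / (K * D)).
  by rewrite divr_gt0//; lra.
move=> x y x0 xy yd.
have [A _] := left_slope alpha_gt1 c01 u01 E1 Phib x0 xy (le_trans yd (ltW dc)).
rewrite mulrAC ler_pdivrMr; last by lra.
rewrite [leRHS]mulrC; apply: le_trans A; apply: ler_wpM2r; first by rewrite subr_ge0.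
apply: ler_wpM2l; first by rewrite divr_ge0 ?mulr_ge0; lra.
apply: ler_powRr; first by lra.
  by rewrite divr_ge0; lra.
by rewrite ler_pM2r ?invr_gt0; lra.
Qed.

Lemma right_expanding d : c < d <= 1 -> exists2 k, 0 < k &
  forall x y, d <= x -> x <= y -> y <= 1 -> k * (y - x) <= gr y - gr x.
Proof.
move=> /andP[cd d1]; have cc := c01; have uu := v01; have al1 := alpha_gt1; have Ee := E1.
have k0 : 0 < bv br * alpha / (1 - c) * right_coord c d `^ (alpha - 1).
  rewrite mulr_gt0 ?divr_gt0 ?mulr_gt0 ?powR_gt0 ?subr_gt0//; try lra.
  by rewrite divr_gt0; lra.
exists (bv br * alpha / (1 - c) * right_coord c d `^ (alpha - 1) / (K * D)).
  by rewrite divr_gt0//; lra.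
move=> x y dx xy y1.
have [A _] := right_slope alpha_gt1 c01 v01 E1 Psib (le_trans (ltW cd) dx) xy y1.
rewrite mulrAC ler_pdivrMr; last by lra.
rewrite [leRHS]mulrC; apply: le_trans A; apply: ler_wpM2r; first by rewrite subr_ge0.
apply: ler_wpM2l; first by rewrite divr_ge0 ?mulr_ge0; lra.
apply: ler_powRr; first by lra.
  by rewrite divr_ge0; lra.
by rewrite ler_pM2r ?invr_gt0; lra.
Qed.

(** The branches do not expand at [c], so an interval of radius [d] around [c] is covered
    separately. The expansion constants depend on [d], which is therefore fixed before the covers
    are chosen. *)
Lemma content0_lfun_preimage F (X : set R) : models alpha br F -> content0 X ->
  content0 [set x | [/\ 0 <= x <= 1, x != c & X (lfun alpha F x)]].
Proof.
move=> [_ Ml Mr] cX e e0; have cc := c01.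
pose d := Num.min (e / 8) (Num.min (c / 2) ((1 - c) / 2)).
have d0 : 0 < d by rewrite !lt_min; lra.
have [de dc d1] : [/\ d <= e / 8, d <= c / 2 & d <= (1 - c) / 2].
  by split; rewrite !ge_min lexx ?orbT.
have [k k0 kl] := left_expanding (d := c - d) ltac:(lra).
have [k' k'0 kr] := right_expanding (d := c + d) ltac:(lra).
have A := content0_preimage_itv k0 kl cX; have B := content0_preimage_itv k'0 kr cX.
have e4 : 0 < e / 4 by lra.
have cd : c - d <= c + d by lra.
have C := small_cover_itv cd (X := [set x | c - d <= x <= c + d]) (fun x H => H).
apply: (small_cover_sub _ _ (small_coverU (small_coverU (A _ e4) (B _ e4)) C)); last by lra.
move=> x [x01 /= xc Xx]; have [h1|h1] := leP x (c - d).
  by left; left; split => /=; [lra|rewrite -Ml//; lra].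
have [h2|h2] := leP (c + d) x.
  by left; right; split => /=; [lra|rewrite -Mr//; lra].
by right; rewrite /=; lra.
Qed.

End Expanding.

Variables (sigma beta : R) (b0 a b : nat) (br : branches R) (p q : R).
Hypothesis sigma01 : 0 < sigma < 1.
Hypothesis beta_pos : 0 < beta < (sigma / alpha) ^+ 2.
Hypothesis L : large alpha sigma beta b0.
Local Notation t := (delta_of R b0).
Local Notation c := (bc br).
Local Notation gl := (lbr alpha br).
Local Notation gr := (rbr alpha br).
Hypothesis tbr : tame alpha (1 + t) (expR t) br.
Hypothesis ab : combinatorics_bound alpha sigma beta b0 a b.
Hypothesis rd : renorm_data gl gr c a b p q.
Hypothesis eps_ge : eps_min alpha b0 <= 1 - c.
Hypothesis eps_le : 1 - c <= eps_max alpha sigma b0.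

Lemma level_avoiding (E : R -> Prop) : (forall x, E x -> 0 <= x <= 1) ->
  (forall x, E x -> x <= p \/ q <= x) -> (forall x, E x -> x <= p -> E (gl x)) ->
  (forall x, E x -> q <= x -> E (gr x)) -> content0 E.
Proof.
move=> E01 Eg El Er.
have t0 : 0 < t := delta_gt0 L.
have K1 : 1 <= 1 + t by rewrite lerDl ltW.
have D1 : 1 <= expR t by rewrite -expR0 ler_expR ltW.
have E1 : 1 <= (1 + t) * expR t by rewrite -[leLHS]mulr1; apply: ler_pM.
have c01 := tame_c tbr; have u01 := tame_u tbr; have v01 := tame_v tbr.
have Phih := tame_factor_homeo (tame_l tbr); have Psih := tame_factor_homeo (tame_r tbr).
have Phib := tame_factor_bilipschitz (le_trans ler01 K1) (le_trans ler01 D1) (tame_l tbr).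
have Psib := tame_factor_bilipschitz (le_trans ler01 K1) (le_trans ler01 D1) (tame_r tbr).
have pc := rd_p rd; have cq := rd_q rd.
have [kl kl0 exl] := left_expanding K1 D1 tbr (d := p) ltac:(lra).
have [kr kr0 exr] := right_expanding K1 D1 tbr (d := q) ltac:(lra).
have b2 : (1 < b)%N by case: ab => _ [h _]; exact: leq_trans (large_2 L) h.
have cc : 0 <= c <= c by rewrite lexx andbT ltW//; case/andP: c01.
have cc1 : c <= c <= 1 by rewrite lexx ltW//; case/andP: c01.
apply: (avoiding_content0 (left_increasing alpha_gt1 c01 u01 Phih)
  (right_increasing alpha_gt1 c01 v01 Psih) (left_lipschitz alpha_gt1 c01 u01 E1 Phib)
  (right_lipschitz alpha_gt1 c01 v01 E1 Psib) (tame_cl tbr) (tame_cr tbr)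
  (left_at0 _ _ c01 Phih) (right_at1 _ _ c01 Psih)
  (gl_le1 alpha_gt1 c01 u01 Phih cc) (gr_ge0 alpha_gt1 c01 v01 Psih cc1)
  rd b2 kl0 kr0 exl exr _ _ E01 Eg El Er).
- by move=> x xr; apply: (left_branch_gt alpha_gt1 sigma01 beta_pos L tbr ab rd).
- by move=> x xr; apply: (right_branch_lt alpha_gt1 sigma01 beta_pos L tbr ab rd) => //; lra.
Qed.

End Level.

(** * The nested return intervals and the weak Markov property *)

Section Tower.
Variables (R : realType) (alpha : R).
Hypothesis alpha_gt1 : 1 < alpha.
Implicit Types (x y z : R).

Lemma liter_range k (F : lorenz R) n x y : lorenz_class k F -> 0 <= x <= 1 ->
  liter alpha F n x = Some y -> 0 <= y <= 1.
Proof.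
move=> clF x01; elim: n y => [|n IH] y; first by case=> <-.
rewrite literS; case: (liter _ _ _ _) IH => //= z /(_ z erefl) z01.
rewrite /lmap; case: ifP => // _ [<-]; exact: lfun_range clF z01.
Qed.

Lemma first_entry_exists (F : lorenz R) (C : set R) m k x y : (m <= k)%N ->
  liter alpha F k x = Some y -> C y ->
  exists n z, [/\ (n <= k)%N, liter alpha F n x = Some z & first_entry alpha F C m x z].
Proof.
move=> mk Lk Cy.
pose P n := (m <= n)%N && `[< exists2 z, liter alpha F n x = Some z & C z >].
have Pk : P k by rewrite /P mk; apply/asboolP; exists y.
have exP : exists n, P n by exists k.
case: (ex_minnP exP) => n /andP[mn /asboolP[z Ln Cz]] min.
exists n, z; split => //; first exact: min.
exists n; split => // i z' /andP[mi ni] Li Cz'.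
have : P i by rewrite /P mi; apply/asboolP; exists z'.
by move=> /min; rewrite leqNgt ni.
Qed.

Section Return.
Variables (F G : lorenz R) (p q : R) (k : nat).
Hypothesis clF : lorenz_class k F.
Hypothesis ret : return_to alpha F p q G.
Hypothesis pq : p < q.
Let h x := p + (q - p) * x.
Let qp0 : 0 < q - p. Proof. by rewrite subr_gt0. Qed.

Let h_inj x y : h x = h y -> x = y.
Proof. by move/addrI/mulfI; apply; rewrite gt_eqF. Qed.

Let h_in x : 0 <= x <= 1 -> `[p, q]%classic (h x).
Proof.
move=> /andP[x0 x1]; rewrite /= in_itv/= lerDl mulr_ge0 ?(ltW qp0)//=.
by rewrite /h -lerBrDl ler_piMr// ltW.
Qed.

Let h_surj y : `[p, q]%classic y -> exists2 x, 0 <= x <= 1 & y = h x.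
Proof.
rewrite /= in_itv/= => yr; exists ((y - p) / (q - p)).
  by rewrite divr_ge0 ?ler_pdivrMr//; lra.
by rewrite /h mulrC divfK ?gt_eqF// addrC subrK.
Qed.

Lemma liter_return n x y : 0 <= x <= 1 -> liter alpha G n x = Some y ->
  exists m, liter alpha F m (p + (q - p) * x) = Some (p + (q - p) * y).
Proof.
have [_ _ clG _ H] := ret.
move=> x01; elim: n y => [|n IH] y; first by case=> <-; exists 0%N.
rewrite literS; case Lz : (liter alpha G n x) => [z|//] /= Ly.
have z01 := liter_range clG x01 Lz.
have y01 := liter_range clG z01 (n := 1) Ly.
have [m Lm] := IH _ Lz.
have /(H z y _ _)[] : lmap alpha G z = Some y by [].
  by rewrite in_itv. by rewrite in_itv.
move=> _ [m' [_ Lm' _ _]]; exists (m' + m)%N.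
by rewrite liter_add Lm /= Lm'.
Qed.

(** Strong induction on [n], cutting the orbit at its first return to the interval. *)
Lemma return_liter n x y : 0 <= x <= 1 -> 0 <= y <= 1 ->
  liter alpha F n (p + (q - p) * x) = Some (p + (q - p) * y) ->
  exists m, liter alpha G m x = Some y.
Proof.
have [_ _ clG _ H] := ret.
move=> + y01; elim/ltn_ind: n x => -[|n] IH x x01 Ln.
  by case: Ln => /h_inj ->; exists 0%N.
have [m [z [mn Lm fe]]] := first_entry_exists (ltn0Sn n) Ln (h_in y01).
have [m' [m'1 Lm' Cz min]] := fe.
have [z' z'01 zE] := h_surj Cz.
have Lz : lmap alpha G x = Some z'.
  by apply/H; rewrite ?in_itv//=; split; [exact: h_in|rewrite -/(h z') -zE].
have m'n : (m' <= n.+1)%N.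
  rewrite leqNgt; apply/negP => nm'.
  by apply: (min n.+1 _ _ Ln (h_in y01)); rewrite nm'.
have [||k' Lk'] := IH (n.+1 - m')%N _ z' z'01.
- by rewrite ltn_subrL m'1.
- by rewrite -/(h z') -zE; move: Ln; rewrite -{1}(subnK m'n) liter_add Lm'.
by exists (k' + 1)%N; rewrite liter_add /liter /= Lz.
Qed.

End Return.

Variables (G : nat -> lorenz R) (p q : nat -> R) (k0 : nat).
Local Notation f := (G 0).
Hypothesis cl0 : lorenz_class k0 f.
Hypothesis ret : forall n, return_to alpha (G n) (p n) (q n) (G n.+1).
Hypothesis pcq : forall n, 0 < p n < lc (G n) /\ lc (G n) < q n < 1.
Hypothesis lcE : forall n, lc (G n.+1) = (lc (G n) - p n) / (q n - p n).
Hypothesis half : forall n, q n - p n <= 2^-1.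

(** Composition of the affine maps onto the successive return intervals: the image of [[0, 1]] is
    the interval of depth [n] in the domain of [G 0]. *)
Fixpoint tower n x := if n is m.+1 then tower m (p m + (q m - p m) * x) else x.

Definition tower_width n := tower n 1 - tower n 0.

Let pq n : p n < q n. Proof. by have [? ?] := pcq n; lra. Qed.

Let cl n : exists k, lorenz_class k (G n).
Proof. by case: n => [|n]; [exists k0|exists 0%N; case: (ret n)]. Qed.

Lemma towerE n x : tower n x = tower n 0 + tower_width n * x.
Proof.
rewrite /tower_width; elim: n x => [|n IH] x /=; first by ring.
by rewrite IH [tower n (_ + _ * 0)]IH [tower n (_ + _ * 1)]IH; ring.
Qed.

Lemma tower_widthS n : tower_width n.+1 = tower_width n * (q n - p n).
Proof. by rewrite {1}/tower_width /= towerE [tower n (_ + _ * 0)]towerE; ring. Qed.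

Lemma tower_width_gt0 n : 0 < tower_width n.
Proof.
elim: n => [|n IH]; first by rewrite /tower_width /= subr0.
by rewrite tower_widthS mulr_gt0// subr_gt0.
Qed.

Lemma tower_width_le n : tower_width n <= 2^-1 ^+ n.
Proof.
elim: n => [|n IH]; first by rewrite /tower_width /= subr0.
rewrite tower_widthS exprSr; apply: ler_pM => //; first exact/ltW/tower_width_gt0.
by rewrite subr_ge0 ltW.
Qed.

Lemma tower_lt n x y : (tower n x < tower n y) = (x < y).
Proof. by rewrite towerE [X in _ < X]towerE ltrD2l ltr_pM2l// tower_width_gt0. Qed.

Lemma tower_le n x y : (tower n x <= tower n y) = (x <= y).
Proof. by rewrite !leNgt tower_lt. Qed.

Lemma tower_critical n : tower n (lc (G n)) = lc f.
Proof.
elim: n => [//|n IH]; rewrite lcE /= -[RHS]IH; congr (tower n _).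
by rewrite mulrC divfK ?gt_eqF ?subr_gt0// addrC subrK.
Qed.

Lemma tower_range n : 0 <= tower n 0 /\ tower n 1 <= 1.
Proof.
elim: n => [|n [A B]] //=; have [/andP[p0 _] /andP[_ q1]] := pcq n.
split.
  by apply: (le_trans A); rewrite tower_le mulr0 addr0 ltW.
by apply: le_trans B; rewrite tower_le mulr1 addrC subrK ltW.
Qed.

Lemma tower_critical_lt n : tower n 0 < lc f < tower n 1.
Proof.
rewrite -(tower_critical n) !tower_lt.
by have [k [_ _ c01 _ _]] := cl n; exact: c01.
Qed.

Lemma tower_surj n y : tower n 0 < y < tower n 1 -> exists2 x, 0 < x < 1 & y = tower n x.
Proof.
move=> /andP[y0 y1]; have w0 := tower_width_gt0 n; exists ((y - tower n 0) / tower_width n).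
  have y0' : 0 < y - tower n 0 by rewrite subr_gt0.
  by rewrite divr_gt0//= ltr_pdivrMr// mul1r ltrD2r.
by rewrite [RHS]towerE mulrC divfK ?gt_eqF// addrC subrK.
Qed.

Lemma liter_tower n k x y : 0 <= x <= 1 -> liter alpha (G n) k x = Some y ->
  exists m, liter alpha f m (tower n x) = Some (tower n y).
Proof.
elim: n k x y => [|n IH] k x y x01 Lk; first by exists k.
have [m Lm] := liter_return (ret n) x01 Lk.
apply: IH Lm; have [/andP[p0 _] /andP[_ q1]] := pcq n; have qp := pq n.
have := ler_wpM2l (ltW (_ : 0 < q n - p n)) (proj2 (andP x01)).
rewrite subr_gt0 mulr1 => /(_ qp) H1.
have : 0 <= (q n - p n) * x by rewrite mulr_ge0//; [lra|case/andP: x01].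
by lra.
Qed.

Lemma tower_liter n k x y : 0 <= x <= 1 -> 0 <= y <= 1 ->
  liter alpha f k (tower n x) = Some (tower n y) ->
  exists m, liter alpha (G n) m x = Some y.
Proof.
have rg m z : 0 <= z <= 1 -> 0 <= p m + (q m - p m) * z <= 1.
  move=> z01; have [/andP[p0 _] /andP[_ q1]] := pcq m; have qp := pq m.
  have := ler_wpM2l (ltW (_ : 0 < q m - p m)) (proj2 (andP z01)).
  rewrite subr_gt0 mulr1 => /(_ qp) H1.
  have : 0 <= (q m - p m) * z by rewrite mulr_ge0//; [lra|case/andP: z01].
  by lra.
elim: n k x y => [|n IH] k x y x01 y01 Lk; first by exists k.
have [m Lm] := IH _ _ _ (rg n _ x01) (rg n _ y01) Lk.
exact: return_liter (ret n) (pq n) _ _ _ x01 y01 Lm.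
Qed.

(** The ends correspond to 0 and 1, which [G n] fixes. A visit of their orbits to the open interval
    would, by [tower_liter], be an iterate of [G n] from 0 or 1 into the open unit interval. *)
Lemma tower_nice n : nice alpha f (tower n 0) (tower n 1).
Proof.
have [A B] := tower_range n; split => //; first exact: tower_critical_lt.
move=> x k y xE Lk; rewrite /= in_itv/= => /tower_surj[z z01 yE].
have [k' clk] := cl n; have [_ _ /andP[c0 c1] _ _] := clk.
have fix_liter e m : e \in [:: 0; 1] -> liter alpha (G n) m e = Some e.
  move=> ee; elim: m => // m IH; rewrite literS IH /= /lmap.
  move: ee; rewrite !inE => /orP[]/eqP ->.
    by rewrite lexx ler01 lt_eqF//= (lfun_at0 alpha clk).
  by rewrite lexx ler01 gt_eqF//= (lfun_at1 alpha clk).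
have z01' : 0 <= z <= 1 by lra.
have [e ee xe] : exists2 e, e \in [:: 0; 1] & x = tower n e.
  by case: xE => ->; [exists 0|exists 1]; rewrite ?inE ?eqxx ?orbT.
have e01 : 0 <= e <= 1 by move: ee; rewrite !inE => /orP[]/eqP->; rewrite ?lexx ?ler01.
rewrite yE xe in Lk; have [m] := tower_liter e01 z01' Lk.
rewrite fix_liter// => -[ez].
by move: ee; rewrite ez !inE => /orP[]/eqP zE; move: z01; rewrite zE ltxx ?andbF.
Qed.

(** The ends [p n] and [q n] are allowed, since only the interior of the return interval counts in
    [enters]. *)
Definition avoiding n x := 0 <= x <= 1 /\
  forall k z, liter alpha (G n) k x = Some z -> z <= p n \/ q n <= z.

Hypothesis avoid0 : forall n, content0 (avoiding n).
Hypothesis pre0 : forall X, content0 X ->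
  content0 [set x | [/\ 0 <= x <= 1, x != lc f & X (lfun alpha f x)]].

Let orbit_preimage k X : content0 X ->
  content0 [set x | 0 <= x <= 1 /\ exists2 y, liter alpha f k x = Some y & X y].
Proof.
elim: k X => [|k IH] X cX.
  by apply: (content0_sub _ cX) => x [_ [y [<-]]].
apply: (content0_sub _ (pre0 (IH _ cX))) => x [x01 [y]].
rewrite -addn1 liter_add [liter _ _ 1 _]/liter /= /lmap x01 /=.
case: eqP => // xc Ly Xy; split => //; split; first exact: lfun_range cl0 x01.
by exists y.
Qed.

Let tower_avoiding0 n : content0 [set z | exists2 y, avoiding n y & z = tower n y].
Proof.
have w0 := tower_width_gt0 n.
have wi : 0 < (tower_width n)^-1 by rewrite invr_gt0.
apply: (content0_sub _ (content0_preimage_itv (g := fun z => (z - tower n 0) / tower_width n)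
  (a := tower n 0) (b := tower n 1) wi _ (avoid0 n))).
  move=> z [y [y01 Ay] ->]; split; first by rewrite !tower_le.
  have -> // : (tower n y - tower n 0) / tower_width n = y.
  by rewrite towerE addrAC subrr add0r mulrAC mulfV ?mul1r// gt_eqF.
by move=> x y _ _ _; rewrite le_eqVlt; apply/orP; left; apply/eqP; ring.
Qed.

Definition enters n x := exists k y, liter alpha f k x = Some (tower n y) /\ 0 < y < 1.

(** A point that enters level [n] but not level [n + 1] has an iterate in the image of the avoiding
    set of [G n], so it lies in a countable union of sets of zero content. Such a union need not
    have zero content, whence the passage to negligible sets. *)
Lemma enters_ae n : (@lebesgue_measure R).-negligible [set x | 0 <= x <= 1 /\ ~ enters n x].
Proof.
elim: n => [|n IH].
  apply: content0_negligible.
  apply: (content0_sub _ (content0U (content0_set1 0) (content0_set1 1))) => x [x01 nx].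
  apply: contrapT => /not_orP[/eqP x0 /eqP x1]; apply: nx; exists 0%N, x; split => //.
  by rewrite !lt_def x0 eq_sym x1.
have hit k := content0_negligible (orbit_preimage k (tower_avoiding0 n)).
apply: negligibleS (negligibleU IH (negligible_bigcup hit)).
move=> x [x01 nx]; have [[k [y [Lk y01]]]|] := pselect (enters n x); last by left.
right; exists k => //; split => //; exists (tower n y) => //; exists y => //.
have y01' : 0 <= y <= 1 by lra.
split => // m z Lm; apply: contrapT => /not_orP[/negP + /negP]; rewrite -!ltNge => pz zq.
apply: nx; have qp := pq n.
have [m' Lm'] := liter_tower y01' Lm.
exists (m' + k)%N, ((z - p n) / (q n - p n)); split.
  rewrite liter_add Lk /= Lm' mulrC divfK ?gt_eqF ?subr_gt0//.
  by rewrite addrC subrK.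
by rewrite divr_gt0 ?ltr_pdivrMr; lra.
Qed.

Lemma transfer_ae n : {ae (@lebesgue_measure R), forall x, 0 <= x <= 1 ->
  exists y, transfer alpha f `]tower n 0, tower n 1[%classic x y}.
Proof.
apply: negligibleS (enters_ae n) => x /= /not_implyP[x01 nx]; split => // -[k [y [Lk y01]]].
apply: nx; have [|m [z [_ _ fe]]] := first_entry_exists (leq0n k) Lk (C := `]tower n 0, tower n 1[%classic).
  by rewrite /= in_itv/= !tower_lt.
by exists z.
Qed.

(** The widths are at most [2 ^ (- m)]. Once this is below half the distance from [c] to the ends,
    the space on each side of the deeper interval exceeds its length. *)
Lemma next_scaled n : exists m, scaled_nbhd 1 (tower n 0) (tower n 1) (tower m 0) (tower m 1).
Proof.
have /andP[c0 c1] := tower_critical_lt n.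
pose d := Num.min (lc f - tower n 0) (tower n 1 - lc f).
have d0 : 0 < d by rewrite lt_min !subr_gt0 c0.
have lim : (2^-1 : R) ^+ m @[m --> \oo] --> (0 : R).
  by apply: cvg_expr; rewrite ger0_norm ?invr_ge0//; lra.
have d2 : 0 < d / 2 by lra.
have [m _ /(_ m (leqnn m)) /= md] := cvgr_lt _ lim _ d2.
exists m; have /andP[e0 e1] := tower_critical_lt m; have w := tower_width_le m.
have : d <= lc f - tower n 0 by rewrite ge_min lexx.
have : d <= tower n 1 - lc f by rewrite ge_min lexx orbT.
by rewrite /tower_width in w => *; split; lra.
Qed.

Lemma tower_weak_markov : weak_markov alpha f.
Proof.
have [N NP] := choice next_scaled.
exists 1, (fun k => tower (iter k N 0%N) 0), (fun k => tower (iter k N 0%N) 1); split => // k _.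
have S := NP (iter k N 0%N); rewrite -iterS in S.
split => //; [exact: tower_nice| |exact: transfer_ae].
have w0 := tower_width_gt0 (iter k.+1 N 0%N); have [A B] := S.
by rewrite /tower_width in w0 => x; rewrite /= !in_itv/= => xr; lra.
Qed.

End Tower.

(** * Induction over the renormalizations *)

Section InfinitelyRenormalizable.
Variables (R : realType) (alpha sigma beta : R) (b0 : nat).
Hypothesis alpha_gt1 : 1 < alpha.
Hypothesis sigma01 : 0 < sigma < 1.
Hypothesis beta_pos : 0 < beta < (sigma / alpha) ^+ 2.
Hypothesis L : large alpha sigma beta b0.
Local Notation t := (delta_of R b0).

Definition level_bound br F :=
  [/\ tame alpha (1 + t) (expR t) br, models alpha br F,
      eps_min alpha b0 <= 1 - bc br & 1 - bc br <= eps_max alpha sigma b0].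

Let K1 : 1 <= 1 + t. Proof. by rewrite lerDl; exact/ltW/(delta_gt0 L). Qed.
Let D1 : 1 <= expR t. Proof. by rewrite -expR0 ler_expR; exact/ltW/(delta_gt0 L). Qed.

(** The renormalization of [G] enters as well: the bounds on the new [eps] need the position of the
    critical values of [G], which comes from its own renormalization data. *)
Lemma level_bound_next br w w' F G H : level_bound br F ->
  renormalizes_to alpha w F G -> renormalizes_to alpha w' G H ->
  Omega alpha sigma beta b0 w -> Omega alpha sigma beta b0 w' ->
  exists br', level_bound br' G.
Proof.
move=> [tbr mod e1 e2] FG GH ow ow'.
have [p [q [rd ret lcG Gl Gr]]] := renormalizes_data alpha_gt1 K1 D1 tbr mod FG.
have [br' [tbr' bcE lE rE]] := step_renorm alpha_gt1 sigma01 beta_pos L tbr ow rd e1 e2.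
have c'01 := tame_c tbr'.
have mod' : models alpha br' G.
  split; first by rewrite bcE.
    by move=> x /andP[x0 xc]; rewrite Gl ?lcG -?bcE ?x0// lE// x0 ltW.
  by move=> x /andP[xc x1]; rewrite Gr ?lcG -?bcE ?xc// rE// x1 ltW.
have [p' [q' [rd' _ _ _ _]]] := renormalizes_data alpha_gt1 K1 D1 tbr' mod' GH.
exists br'; split => //.
- exact: (next_eps_ge alpha_gt1 sigma01 beta_pos L tbr ow rd e1 e2 tbr' bcE lE rE rd' ow').
- exact: (next_eps_le alpha_gt1 sigma01 beta_pos L tbr ow rd e1 e2 tbr' bcE lE rE rd').
Qed.

Lemma infinitely_renormalizable_weak_markov (theta : R) w f :
  theta = scale_bound alpha -> (forall n, Omega alpha sigma beta b0 (w n)) ->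
  lorenzS_type alpha w f -> setK alpha sigma theta b0 f -> weak_markov alpha f.
Proof.
move=> thE ow [fS [G [G0 GR]]] fK; subst theta.
have [br0 [tbr0 mod0]] := tame_level0 alpha_gt1 L fS fK.
have [cl3 _ _] := fS; have [_ _ /andP[e1 e2] _ _] := fK; have [lc0 _ _] := mod0.
have inv n : exists br, level_bound br (G n).
  elim: n => [|n [br inv]]; last exact: (level_bound_next inv (GR n) (GR n.+1) (ow n) (ow n.+1)).
  by exists br0; rewrite G0; split => //; rewrite -lc0.
have data n : exists pq : R * R, [/\ return_to alpha (G n) pq.1 pq.2 (G n.+1),
    0 < pq.1 < lc (G n) /\ lc (G n) < pq.2 < 1,
    lc (G n.+1) = (lc (G n) - pq.1) / (pq.2 - pq.1), pq.2 - pq.1 <= 2^-1 &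
    forall E : R -> Prop, (forall x, E x -> 0 <= x <= 1) ->
      (forall x, E x -> x <= pq.1 \/ pq.2 <= x) ->
      (forall x, E x -> x != lc (G n) -> E (lfun alpha (G n) x)) -> content0 E].
  have [br [tbr mod i1 i2]] := inv n.
  have [p [q [rd ret lcG _ _]]] := renormalizes_data alpha_gt1 K1 D1 tbr mod (GR n).
  have [lcE Ml Mr] := mod; have pc := rd_p rd; have cq := rd_q rd.
  exists (p, q); split; rewrite /= ?lcE//.
    exact: (return_interval_half alpha_gt1 sigma01 beta_pos L tbr (ow n) rd i1 i2).
  move=> E E01 Eg El.
  apply: (level_avoiding alpha_gt1 sigma01 beta_pos L tbr (ow n) rd i1 i2 E01 Eg) => x Ex xr.
    have := El _ Ex; rewrite Ml ?lt_eqF//; [by apply|lra|].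
    by have := E01 _ Ex; lra.
  have := El _ Ex; rewrite Mr ?gt_eqF//; [by apply|lra|].
  by have := E01 _ Ex; lra.
have [pq pqP] := choice data.
rewrite -G0; have cl0 : lorenz_class 3 (G 0%N) by rewrite G0.
have cl n : exists k, lorenz_class k (G n).
  case: n => [|n]; [by exists 3%N|exists 0%N].
  by have [[]] := pqP n.
apply: (@tower_weak_markov _ _ alpha_gt1 G (fun n => (pq n).1) (fun n => (pq n).2) 3%N cl0).
- by move=> n; case: (pqP n).
- by move=> n; case: (pqP n).
- by move=> n; case: (pqP n).
- by move=> n; case: (pqP n).
(* The avoiding set is forward invariant, since an iterate of the image of [x] is a later iterate of
   [x]. *)
- move=> n; have [_ _ _ _ H] := pqP n; apply: H.
  + by move=> x [].
  + by move=> x [_ Ax]; exact: (Ax 0%N).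
  + move=> x [x01 Ax] xc; have [k clk] := cl n; split; first exact: lfun_range clk x01.
    by move=> k' z Lz; apply: (Ax (k' + 1)%N); rewrite liter_add /liter/= lmap_some.
- move=> X cX; have [lcE _ _] := mod0.
  by rewrite G0 lcE; exact: (content0_lfun_preimage alpha_gt1 K1 D1 tbr0 mod0 cX).
Qed.

End InfinitelyRenormalizable.

Lemma scale_bound_gt1 (R : realType) (alpha : R) : 1 < alpha -> 1 < scale_bound alpha.
Proof.
move=> al1; rewrite ltrDl powR_gt0// mulr_gt0 ?powR_gt0// mulr_gt0//.
exact: lt_le_trans (return_constant_ge8 al1).
Qed.

Theorem theorem5p2 (R : realType) (alpha sigma beta : R)
    (halpha : 1 < alpha) (hsigma : 0 < sigma < 1)
    (ha : exists a : nat, alpha + sigma <= a%:R + 1 <= 2 * alpha - sigma)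
    (hbeta : 0 < beta < (sigma / alpha) ^+ 2) :
  exists theta : R, 1 < theta /\
  exists B : nat, forall b0 : nat, (B <= b0)%N ->
  forall (w : nat -> nat * nat) (f : lorenz R),
    (forall n, Omega alpha sigma beta b0 (w n)) ->
    lorenzS_type alpha w f -> setK alpha sigma theta b0 f ->
    weak_markov alpha f.
Proof.
exists (scale_bound alpha); split; first exact: scale_bound_gt1.
have [B _ HB] := near_large halpha hsigma hbeta.
exists B => b0 Bb0 w f ow ft fK.
exact: (infinitely_renormalizable_weak_markov halpha hsigma hbeta (HB _ Bb0) erefl ow ft fK).
Qed.
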